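(* Let $1\le p<\infty$, $\gamma>-n$, $\omega_1,\omega_2\in\mathcal{W}_\gamma$, and $b\in Lip^\beta(\mathbb{R}^n)$ with $0<\beta\le1$. Let $\Phi$ be a radial measurable function on $\mathbb{R}^n$, let $\Omega\in L^{p'}(S^{n-1})$ with $\Omega\ne 0$ almost everywhere on $S^{n-1}$, and suppose there is $c>0$ with $\omega_1(x')\ge c$ for all $x'\in S^{n-1}$. Let $\lambda$ be such that $\lambda_1=\lambda-\frac{\beta p}{n+\gamma}>0$. If $$\mathcal{C}_4=\int_0^\infty\frac{|\Phi(t)|}{t^{1+(\gamma+n)\frac{\lambda_1-1}{p}}(1+t^{-1})^{-\beta}}\,dt<\infty,$$ then the commutator $\mathcal{H}^b_{\Phi,\Omega}$ is a bounded operator from $\dot{B}^{p,\lambda_1}(\omega_1,\omega_2)$ to $\dot{B}^{p,\lambda}(\omega_1,\omega_2)$.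
   Context: Notation: $n\ge 1$, $S^{n-1}=\{x\in\mathbb{R}^n:|x|=1\}$ with surface measure $\sigma$, $B(0,R)$ is the ball of radius $R$ centred at $0$, $\frac1p+\frac1{p'}=1$, and $\omega(E)=\int_E\omega(x)\,dx$. Weights: for $\gamma\in\mathbb{R}$, $\mathcal{W}_\gamma$ is the set of Lebesgue measurable functions $\omega$ on $\mathbb{R}^n$ with $\omega(x)>0$ for almost every $x$, $0<\int_{S^{n-1}}\omega\,d\sigma<\infty$, and $\omega(tx)=|t|^{\gamma}\omega(x)$ for all $t\in\mathbb{R}\setminus\{0\}$, $x\in\mathbb{R}^n$. Lipschitz space: $Lip^\beta(\mathbb{R}^n)$ is the set of $b:\mathbb{R}^n\to\mathbb{C}$ with $\|b\|_{Lip^\beta}=\sup_{x\ne y}\frac{|b(x)-b(y)|}{|x-y|^\beta}<\infty$. Commutator of the rough Hausdorff operator: for $\Phi:\mathbb{R}^n\to\mathbb{C}$ radial and measurable (write $\Phi(x)=\Phi(|x|)$, so $\Phi(t)$ makes sense for $t>0$) and $\Omega:S^{n-1}\to\mathbb{C}$ measurable, $$\mathcal{H}^b_{\Phi,\Omega}f(x)=\int_0^\infty\int_{S^{n-1}}\frac{\Phi(t)}{t}\,\Omega(y')\,f(|x|t^{-1}y')\,\big[b(x)-b(|x|t^{-1}y')\big]\,d\sigma(y')\,dt .$$ Two weighted Morrey space: for $0<p<\infty$, $\lambda>0$, $\dot{B}^{p,\lambda}(\omega_1,\omega_2)$ is the set of measurable $f$ with $\int_K|f|^p\omega_1\,dx<\infty$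 for every compact $K\subset\mathbb{R}^n$ and $$\|f\|_{\dot{B}^{p,\lambda}(\omega_1,\omega_2)}=\sup_{R>0}\Big(\frac{1}{\omega_2(B(0,R))^{\lambda}}\int_{B(0,R)}|f(x)|^p\omega_1(x)\,dx\Big)^{1/p}<\infty .$$ An operator $T$ given by an integral is bounded from $X$ to $Y$ if for every $f\in X$ the integral defining $Tf(x)$ converges absolutely for almost every $x$ and $\|Tf\|_Y\le C\|f\|_X$ with $C$ independent of $f$. *)

(* Defs.v *)
From HB Require Import structures.
From mathcomp Require Import all_boot all_order all_algebra.
From mathcomp Require Import all_classical all_reals all_analysis.
From mathcomp Require Import complex.

Set Implicit Arguments.
Unset Strict Implicit.
Unset Printing Implicit Defensive.
Import Order.TTheory GRing.Theory Num.Theory.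
Import numFieldNormedType.Exports.
Import Normc.

Local Open Scope classical_set_scope.
Local Open Scope ring_scope.
Local Open Scope complex_scope.

(* R^n is 'rV[R]_n, complex numbers are R[i], the modulus is normc.
   The library norm on 'rV[R]_n is the sup norm, hence enorm. *)

Definition enorm (R : realType) (n : nat) (x : 'rV[R]_n) : R :=
  Num.sqrt (\sum_(i < n) x ord0 i ^+ 2).

Definition eball (R : realType) (n : nat) (r : R) : set 'rV[R]_n :=
  [set x | enorm x < r].

Definition esphere (R : realType) (n : nat) : set 'rV[R]_n :=
  [set x | enorm x = 1].

(* Lebesgue measure on R^n: the restriction of the outer measure defined by
   countable covers by boxes to its Caratheodory sigma-algebra, that is, to the
   Lebesgue measurable sets. *)

Definition box (R : realType) (n : nat) (B : 'rV[R]_n * 'rV[R]_n) :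
    set 'rV[R]_n :=
  [set x | forall i, B.1 ord0 i <= x ord0 i <= B.2 ord0 i].

Definition box_volume (R : realType) (n : nat) (B : 'rV[R]_n * 'rV[R]_n) : R :=
  \prod_(i < n) Num.max 0 (B.2 ord0 i - B.1 ord0 i).

Definition leb_outer (R : realType) (n : nat) (A : set 'rV[R]_n) : \bar R :=
  ereal_inf [set (\esum_(B in G) (box_volume B)%:E)%E
    | G in [set G | countable G /\ A `<=` \bigcup_(B in G) box B]].

Section leb_outer_measure.
Context (R : realType) (n : nat).
Local Open Scope ereal_scope.
Local Notation mu := (@leb_outer R n).

Let vol_ge0 B : 0 <= (@box_volume R n B)%:E.
Proof. by rewrite lee_fin prodr_ge0// => i _; rewrite le_max lexx. Qed.

Let leb_outer_ge0 A : 0 <= mu A.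
Proof. by apply: le_ereal_inf_tmp => _ [G _ <-]; exact: esum_ge0. Qed.

Let leb_outer0 : mu set0 = 0.
Proof.
apply/eqP; rewrite eq_le leb_outer_ge0 andbT; apply: ereal_inf_lbound.
by exists set0; [split; [exact: countable0|exact: sub0set]|rewrite esum_set0].
Qed.

Let le_leb_outer : {homo mu : A B / A `<=` B >-> A <= B}.
Proof.
move=> A B AB; apply: le_ereal_inf_tmp => _ [G [cG BG] <-].
apply: ereal_inf_lbound; exists G => //; split => //.
exact: subset_trans BG.
Qed.

Let leb_outer_sigma_subadditive : sigma_subadditive mu.
Proof.
move=> A; have [[i ioo]|] := pselect (exists i, mu (A i) = +oo).
  rewrite (eseries_pinfty _ _ ioo) ?leey// => k _.
  by rewrite -ltNye (lt_le_trans _ (leb_outer_ge0 _)).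
rewrite -forallNE => Aoo.
suff add2e (e : {posnum R}) :
    mu (\bigcup_k A k) <= \sum_(i <oo) mu (A i) + e%:num%:E.
  by apply/lee_addgt0Pr => _/posnumP[].
apply: (le_trans _ (epsilon_trick xpredT (fun k => leb_outer_ge0 (A k)) _)) => //.
pose P k (G : set ('rV[R]_n * 'rV[R]_n)) :=
  [/\ countable G, A k `<=` \bigcup_(B in G) box B &
  \esum_(B in G) (box_volume B)%:E <= mu (A k) + (e%:num / (2 ^ k.+1)%:R)%:E].
have [G PG] : {G : (set ('rV[R]_n * 'rV[R]_n))^nat & forall k, P k (G k)}.
  apply: (@choice _ _ P) => k; rewrite /P.
  have muf : mu (A k) \is a fin_num.
    by rewrite ge0_fin_numE// ltey; apply/eqP; exact: Aoo.
  have ek : (0 < e%:num / (2 ^ k.+1)%:R)%R by [].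
  have [x [G [cG AG] <-] xS] := lb_ereal_inf_adherent ek muf.
  by exists G; split => //; exact/ltW.
apply: (@le_trans _ _ (\sum_(i <oo) \esum_(B in G i) (box_volume B)%:E)).
  apply: (@le_trans _ _ (\esum_(B in \bigcup_k G k) (box_volume B)%:E)).
    apply: ereal_inf_lbound; exists (\bigcup_k G k) => //; split.
      by apply: bigcup_countable => // k _; have [] := PG k.
    move=> x [k _ Akx]; have [_ /(_ _ Akx)[B GB Bx] _] := PG k.
    by exists B => //; exists k.
  rewrite seqDU_bigcup_eq esum_bigcupT; [|exact: trivIset_seqDU|by []].
  rewrite nneseries_esumT; last by move=> i; exact: esum_ge0.
  apply: le_esum => i _; rewrite esum_mkcond [leRHS]esum_mkcond.
  apply: le_esum => B _; case: ifPn => [/set_mem BG|_]; last by case: ifPn.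
  by rewrite mem_set//; exact: subset_seqDU BG.
by apply: lee_nneseries => k *; [exact: esum_ge0|have [] := PG k].
Qed.

HB.instance Definition _ := isOuterMeasure.Build R 'rV[R]_n mu
  leb_outer0 leb_outer_ge0 le_leb_outer leb_outer_sigma_subadditive.

End leb_outer_measure.

Definition lebesgue (R : realType) (n : nat) :
    set (caratheodory_type (@leb_outer R n)) -> \bar R :=
  @leb_outer R n.

HB.instance Definition _ (R : realType) (n : nat) :=
  isMeasure.Build _ _ _ (@lebesgue R n)
    (caratheodory_measure0 (@leb_outer R n))
    (@caratheodory_measure_ge0 R _ (@leb_outer R n))
    (@caratheodory_measure_sigma_additive R _ (@leb_outer R n)).

(* Surface measure: sigma(E) = n |{t y : 0 < t <= 1, y \in E}|, carried by the
   unit sphere and completed.  For n = 1 it is the counting measure on {-1, 1}. *)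

Definition unit_cone (R : realType) (n : nat) (E : set 'rV[R]_n) :
    set 'rV[R]_n :=
  [set x | exists t y, [/\ 0 < t <= 1, E y, esphere y & x = t *: y]].

Definition surface_outer (R : realType) (n : nat) (E : set 'rV[R]_n) : \bar R :=
  (n%:R%:E * leb_outer (unit_cone E))%E.

Section surface_outer_measure.
Context (R : realType) (n : nat).
Local Open Scope ereal_scope.
Local Notation mu := (@surface_outer R n).

Let n_ge0 : 0 <= n%:R%:E :> \bar R. Proof. by rewrite lee_fin. Qed.

Let surface_outer_ge0 A : 0 <= mu A.
Proof. by rewrite mule_ge0// outer_measure_ge0. Qed.

Let surface_outer0 : mu set0 = 0.
Proof.
rewrite /surface_outer (_ : unit_cone _ = set0) ?outer_measure0 ?mule0//.
by rewrite -subset0 => x [t [y []]].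
Qed.

Let le_surface_outer : {homo mu : A B / A `<=` B >-> A <= B}.
Proof.
move=> A B AB; apply: lee_wpmul2l => //; apply: le_outer_measure.
by move=> x [t [y [t01 /AB By Sy ->]]]; exists t, y.
Qed.

Let surface_outer_sigma_subadditive : sigma_subadditive mu.
Proof.
move=> A; rewrite /surface_outer.
rewrite nneseriesZl//; last by move=> i _; exact: outer_measure_ge0.
apply: lee_wpmul2l => //.
rewrite (_ : unit_cone _ = \bigcup_k unit_cone (A k)).
  exact: outer_measure_sigma_subadditive.
apply/seteqP; split => [x [t [y [t01 [k _ Ay] Sy ->]]]|].
  by exists k => //; exists t, y.
by move=> x [k _ [t [y [t01 Ay Sy ->]]]]; exists t, y; split => //; exists k.
Qed.

HB.instance Definition _ := isOuterMeasure.Build R 'rV[R]_n mu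
  surface_outer0 surface_outer_ge0 le_surface_outer
  surface_outer_sigma_subadditive.

End surface_outer_measure.

Definition surface (R : realType) (n : nat) :
    set (caratheodory_type (@surface_outer R n)) -> \bar R :=
  @surface_outer R n.

HB.instance Definition _ (R : realType) (n : nat) :=
  isMeasure.Build _ _ _ (@surface R n)
    (caratheodory_measure0 (@surface_outer R n))
    (@caratheodory_measure_ge0 R _ (@surface_outer R n))
    (@caratheodory_measure_sigma_additive R _ (@surface_outer R n)).

(* mu only selects the sigma-algebra. *)
Definition complex_measurable d (T : measurableType d) (R : realType)
    (mu : set T -> \bar R) (D : set T) (f : T -> R[i]) : Prop :=
  measurable_fun D (fun x => complex.Re (f x) : measurableTypeR R) /\
  measurable_fun D (fun x => complex.Im (f x) : measurableTypeR R).

Definition absolutely_integrable d (T : measurableType d) (R : realType)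
    (mu : {measure set T -> \bar R}) (D : set T) (f : T -> R[i]) : Prop :=
  complex_measurable mu D f /\ (\int[mu]_(x in D) (normc (f x))%:E < +oo)%E.

Definition complex_integral d (T : measurableType d) (R : realType)
    (mu : {measure set T -> \bar R}) (D : set T) (f : T -> R[i]) : R[i] :=
  (\int[mu]_(x in D) complex.Re (f x)) +i* (\int[mu]_(x in D) complex.Im (f x)).

Definition weight_class (R : realType) (n : nat) (gamma : R) :
    set ('rV[R]_n -> R) :=
  [set w | [/\ measurable_fun setT
                 (w : caratheodory_type (@leb_outer R n) -> measurableTypeR R),
               {ae @lebesgue R n, forall x, 0 < w x},
               (0 < \int[@surface R n]_(y in @esphere R n) (w y)%:E < +oo)%E &
               forall (t : R) x, t != 0 -> w (t *: x) = `|t| `^ gamma * w x]].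

Definition weight_measure (R : realType) (n : nat) (w : 'rV[R]_n -> R)
    (E : set 'rV[R]_n) : \bar R :=
  (\int[@lebesgue R n]_(x in E) (w x)%:E)%E.

Definition lip_seminorm (R : realType) (n : nat) (beta : R)
    (b : 'rV[R]_n -> R[i]) : \bar R :=
  ereal_sup [set r | exists x y, x != y /\
    r = (normc (b x - b y) / enorm (x - y) `^ beta)%:E].

Definition lipschitz_class (R : realType) (n : nat) (beta : R) :
    set ('rV[R]_n -> R[i]) :=
  [set b | (lip_seminorm beta b < +oo)%E].

Definition sphere_Lp (R : realType) (n : nat) (q : \bar R) :
    set ('rV[R]_n -> R[i]) :=
  [set Omega |
    complex_measurable (@surface R n) (@esphere R n) Omega /\
    ('N[@surface R n]_q[(fun y => (normc (Omega y))%:E)] < +oo)%E].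

Definition morrey_norm (R : realType) (n : nat) (p lambda : R)
    (w1 w2 : 'rV[R]_n -> R) (f : 'rV[R]_n -> R[i]) : \bar R :=
  ereal_sup [set
    poweR ((\int[@lebesgue R n]_(x in @eball R n r)
              (normc (f x) `^ p * w1 x)%:E)
           / poweR (weight_measure w2 (@eball R n r)) lambda)%E p^-1
    | r in [set r : R | 0 < r]].

Definition morrey (R : realType) (n : nat) (p lambda : R)
    (w1 w2 : 'rV[R]_n -> R) : set ('rV[R]_n -> R[i]) :=
  [set f | [/\ complex_measurable (@lebesgue R n) setT f,
               forall K : set 'rV[R]_n, compact K ->
                 (\int[@lebesgue R n]_(x in K)
                    (normc (f x) `^ p * w1 x)%:E < +oo)%E &
               (morrey_norm p lambda w1 w2 f < +oo)%E]].

(* Integrals over (0, oo) x S^{n-1} are iterated integrals, for the completed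
   measures; phi is the radial profile of Phi, Phi x = phi |x|. *)

Definition commutator_integrand (R : realType) (n : nat) (phi : R -> R[i])
    (Omega b f : 'rV[R]_n -> R[i]) (x : 'rV[R]_n) (t : R) (y : 'rV[R]_n) :
    R[i] :=
  phi t / t%:C * Omega y * f ((enorm x / t) *: y)
    * (b x - b ((enorm x / t) *: y)).

Definition hausdorff_commutator (R : realType) (n : nat) (phi : R -> R[i])
    (Omega b f : 'rV[R]_n -> R[i]) (x : 'rV[R]_n) : R[i] :=
  complex_integral (@completed_lebesgue_measure R) `]0, +oo[ (fun t =>
    complex_integral (@surface R n) (@esphere R n)
      (commutator_integrand phi Omega b f x t)).

Definition commutator_converges (R : realType) (n : nat) (phi : R -> R[i])
    (Omega b f : 'rV[R]_n -> R[i]) (x : 'rV[R]_n) : Prop :=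
  let F := commutator_integrand phi Omega b f x in
  [/\ {ae @completed_lebesgue_measure R, forall t : R, 0 < t ->
        absolutely_integrable (@surface R n) (@esphere R n) (F t)},
      complex_measurable (@completed_lebesgue_measure R) `]0, +oo[
        (fun t => complex_integral (@surface R n) (@esphere R n) (F t)) &
      (@completed_lebesgue_measure R).-integrable `]0, +oo[
        (fun t => \int[@surface R n]_(y in @esphere R n) (normc (F t y))%:E)%E].

Definition bounded_operator (R : realType) (n : nat)
    (T : ('rV[R]_n -> R[i]) -> 'rV[R]_n -> R[i])
    (converges : ('rV[R]_n -> R[i]) -> 'rV[R]_n -> Prop)
    (X Y : set ('rV[R]_n -> R[i]))
    (normX normY : ('rV[R]_n -> R[i]) -> \bar R) : Prop :=
  exists C : R, forall f, X f ->
    [/\ {ae @lebesgue R n, forall x, converges f x},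
        Y (T f) &
        (normY (T f) <= C%:E * normX f)%E].

(* Main.v *)
(** Every datum agrees almost everywhere with a Borel one.  A homogeneous weight is
   turned into a Borel homogeneous weight by restricting it to a sphere of a
   generic radius, and the profile of the radial function is read off on a generic
   ray.  Polar coordinates for Borel functions come from the homogeneity of the
   Lebesgue measure, [|{r y : 0 < r <= s, y in E}| = s^n sigma(E) / n], and the
   uniqueness of the product measure.

   Since [|b(x) - b(|x| t^-1 y)| <= C |x|^beta (1 + t^-1)^beta], the commutator is
   dominated by [C |x|^beta G(|x|)], where
   [G(r) = \int_0^oo k(t) \int_S |Omega(y) f(r t^-1 y)| dsigma(y) dt] and
   [k(t) = |Phi(t)| t^-1 (1 + t^-1)^beta].  Jensen's inequality for the weight
   [k(t) t^((n + gamma)(1 - lambda1) / p)], which has total mass C_4, and Hoelder's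
   inequality on the sphere reduce the estimate of [\int_(B(0, s)) G^p w1] to
   Tonelli's theorem and the substitution [x -> t x], which changes the
   radius [s] into [s / t]; the powers of [t] then recombine to C_4, and
   [|x|^(beta p) <= s^(beta p)] accounts for the passage from lambda1 to lambda. *)

From HB Require Import structures.
Require Import Defs.
From mathcomp Require Import all_boot all_order all_algebra.
From mathcomp Require Import all_classical all_reals all_analysis.
From mathcomp Require Import measurable_realfun ess_sup_inf complex.
From mathcomp Require Import ring lra.
Import Order.TTheory GRing.Theory Num.Theory.
Import numFieldNormedType.Exports.
Import Normc.
Local Open Scope classical_set_scope.
Local Open Scope ring_scope.

Set Implicit Arguments.
Unset Strict Implicit.
Unset Printing Implicit Defensive.

(** The obstacle is joint measurability: [f] is only Lebesgue measurable, and f(|x| t^-1 y) need not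
    be measurable in (x, t, y) for a product of completed sigma-algebras. Hence the computation is
    done with Borel data on [rowBorel] and brought back by completeness. The passage to Borel data
    needs Borel hulls of equal outer measure; for [surface_outer], which is defined through cones,
    they are extracted from polar coordinates. Spheres and rays being Lebesgue null (a ray when n >
    1), a Borel version says nothing about a fixed one; hence the generic radius and the generic
    ray.

    With a = n + gamma, the power M(t) = t^(a (1 - lambda1) / p) is the one that reproduces itself:
    Jensen's inequality leaves k M M^-p, the substitution contributes t^a, the Morrey bound on the
    ball of radius s / t contributes t^(-a lambda1), and M^-p t^(a - a lambda1) = 1. So k M is
    integrated a second time. The bound w1 >= c on the sphere turns the unweighted integral of |f|^p
    left by Hoelder's inequality into the weighted one that the Morrey norm controls. *)

Lemma aeS d (T : measurableType d) (R : realType)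
    (mu : {measure set T -> \bar R}) (P Q : T -> Prop) :
  (forall x, P x -> Q x) -> {ae mu, forall x, P x} -> {ae mu, forall x, Q x}.
Proof. by move=> PQ; apply: filterS. Qed.

Lemma aeI d (T : measurableType d) (R : realType)
    (mu : {measure set T -> \bar R}) (P Q : T -> Prop) :
  {ae mu, forall x, P x} -> {ae mu, forall x, Q x} ->
  {ae mu, forall x, P x /\ Q x}.
Proof. by move=> P1 Q1; apply: filterI. Qed.

(** * Borel versions *)

Section borel_regular_outer_measure.
Context (R : realType) (T : pointedType).
Variables (mu : {outer_measure set T -> \bar R}) (G : set (set T)).
Local Notation B := (g_sigma_algebraType G).
Local Notation C := (caratheodory_type mu).
Variable nu : {measure set B -> \bar R}.
Local Notation muC := (mu : {measure set C -> \bar R}).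
Hypothesis GC : G `<=` (@measurable _ C).
Hypothesis nuE : forall A : set B, measurable A -> nu A = mu A.

Lemma borel_sub_cara (A : set B) : measurable A -> measurable (A : set C).
Proof. by apply: smallest_sub => //; exact: sigma_algebra_measurable. Qed.

Lemma measurable_id_cara : measurable_fun [set: C] (idfun : C -> B).
Proof. by move=> _ A /borel_sub_cara; rewrite setTI. Qed.

Lemma measurable_fun_cara d (T' : measurableType d) (D : set B) (f : B -> T') :
  measurable D ->
  measurable_fun D f -> measurable_fun (D : set C) (f : C -> T').
Proof.
move=> mD mf _ A mA.
by have /borel_sub_cara := mf mD A mA.
Qed.

(** The identity is measurable from the Caratheodory to the Borel sigma-algebra and pushes [mu]
    forward to [nu], so nonnegative integrals agree; the general case follows by splitting into
    positive and negative parts. *)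
Lemma integral_cara (D : set B) (f : B -> \bar R) :
  measurable D -> measurable_fun D f ->
  (\int[muC]_(x in D) f x = \int[nu]_(x in D) f x)%E.
Proof.
move=> mD mf.
have E (g : B -> \bar R) : (forall x, 0 <= g x)%E -> measurable_fun D g ->
    (\int[muC]_(x in D) g x = \int[nu]_(x in D) g x)%E.
  move=> g0 mg.
  have E := ge0_integral_pushforward measurable_id_cara muC mD mg (in1W g0).
  refine (eq_trans (esym E) _).
  apply: eq_measure_integral => [|? A mA _]; first exact: measurable_id_cara.
  exact/esym/nuE.
rewrite integralE [RHS]integralE !E//; first exact: measurable_funeneg.
exact: measurable_funepos.
Qed.

Lemma ae_cara (P : T -> Prop) : {ae nu, forall x, P x} -> {ae muC, forall x, P x}.
Proof.
move=> [N [mN N0 PN]]; exists N; split => //; first exact: borel_sub_cara.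
by rewrite -[LHS]nuE.
Qed.

(** The way back from Borel functions: the Caratheodory measure is complete, so a change on a null
    set preserves measurability. *)
Lemma measurable_fun_ae_cara (D : set B) (f g : T -> R) :
  measurable D -> {ae nu, forall x, D x -> f x = g x} ->
  measurable_fun D (g : B -> R) -> measurable_fun (D : set C) (f : C -> R).
Proof.
move=> mD fg mg; apply/measurable_EFinP.
apply: (@ae_measurable_fun _ _ _ muC _ D (EFin \o g)).
- exact: measure_is_complete_caratheodory.
- by apply: ae_cara; apply: filterS fg => x /[apply] /= ->.
- by apply/measurable_EFinP; exact: measurable_fun_cara.
Qed.

Lemma integral_ae_cara (D : set B) (f g : T -> R) :
  measurable D -> {ae nu, forall x, D x -> f x = g x} ->
  measurable_fun D (g : B -> R) ->
  (\int[muC]_(x in D) (f x)%:E = \int[nu]_(x in D) (g x)%:E)%E.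
Proof.
move=> mD fg mg; rewrite -integral_cara//; last exact/measurable_EFinP.
apply: ae_eq_integral => //; first exact: borel_sub_cara.
- by apply/measurable_EFinP; exact: measurable_fun_ae_cara fg mg.
- by apply/measurable_EFinP; exact: measurable_fun_cara.
- by apply: ae_cara; apply: filterS fg => x /[apply] /= ->.
Qed.

Hypothesis mu_regular : forall A : set T,
  exists E : set B, [/\ measurable E, A `<=` E & mu E = mu A].

(** The exceptional set is only Caratheodory measurable; its Borel hull is still null. *)
Lemma ae_borel (P : T -> Prop) : {ae muC, forall x, P x} -> {ae nu, forall x, P x}.
Proof.
move=> [N [mN N0 PN]]; have [E [mE NE E0]] := mu_regular N.
exists E; split => //; last exact: subset_trans NE.
by rewrite nuE// E0.
Qed.

Hypothesis mu_sigma_finite : exists Q : nat -> set B,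
  [/\ forall k, measurable (Q k), \bigcup_k Q k = setT &
      forall k, (mu (Q k) < +oo)%E].

(** A Borel hull of [A] differs from [A] by a null set only when the measures can be subtracted,
    hence the hulls are taken of the pieces of finite measure [A] intersected with [Q k]. *)
Lemma cara_borel_set (A : set C) : measurable A ->
  exists E : set B, measurable E /\ {ae nu, forall x, A x <-> E x}.
Proof.
move=> mA; have [Q [mQ QT Qoo]] := mu_sigma_finite.
have /choice[E PE] k := mu_regular (A `&` Q k).
have mE k : measurable (E k : set B) by case: (PE k).
have AQE k : A `&` Q k `<=` E k by case: (PE k).
exists (\bigcup_k E k); split; first exact: bigcupT_measurable.
have D0 k : mu (E k `\` (A `&` Q k)) = 0%E.
  have [_ AE EA] := PE k.
  have mAQ : measurable (A `&` Q k : set C).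
    by apply: measurableI => //; exact: borel_sub_cara.
  have Afin : (mu (A `&` Q k) < +oo)%E.
    by apply: le_lt_trans (Qoo k); exact: le_outer_measure.
  rewrite (_ : mu _ = muC (E k `\` (A `&` Q k)))// measureD//=.
  - rewrite setIidr// EA subee//.
    by rewrite ge0_fin_numE// outer_measure_ge0.
  - exact: borel_sub_cara.
  - by rewrite EA.
have aeD k : {ae nu, forall x, ~ (E k `\` (A `&` Q k)) x}.
  apply: ae_borel; exists (E k `\` (A `&` Q k)); split => //.
  - apply: measurableD; first exact: borel_sub_cara.
    by apply: measurableI => //; exact: borel_sub_cara.
  - exact: D0.
  - by move=> x /= /contrapT.
have : {ae nu, forall x, forall k, ~ (E k `\` (A `&` Q k)) x}.
  exact: ae_foralln.
apply: filterS => x xD; split.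
  move=> Ax; have : (\bigcup_k Q k) x by rewrite QT.
  by case=> k _ Qkx; exists k => //; apply: AQE.
by case=> k _ Ekx; apply: contrapT => nAx; apply: (xD k); split => // -[].
Qed.

(** The sublevel sets at rational heights are replaced by Borel ones. Outside a single Borel null
    set [N] all these countably many replacements are exact, so [f] itself, made constant on [N], is
    Borel. *)
Lemma cara_borel_fun (f : T -> R) : measurable_fun setT (f : C -> R) ->
  exists2 g : B -> R, measurable_fun setT g & {ae nu, forall x, f x = g x}.
Proof.
move=> mf.
have mS (q : rat) : measurable ([set x | f x < ratr q] : set C).
  rewrite (_ : [set x | _] = [set: C] `&` f @^-1` `]-oo, ratr q[%classic).
    exact: mf.
  by rewrite setTI; apply/seteqP; split => x /=; rewrite in_itv.
have /choice[E PE] q := cara_borel_set (mS q).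
have mE q : measurable (E q : set B) by case: (PE q).
have aeE q : {ae nu, forall x, f x < ratr q <-> E q x} by case: (PE q).
(* Rationals are enumerated through [unpickle] so that countably many almost everywhere statements
   can be merged into one null set. *)
have aek k : {ae nu, forall x, forall q : rat, unpickle k = Some q ->
    (f x < ratr q <-> E q x)}.
  case: (unpickle k) => [q|]; last by apply: aeW.
  by apply: aeS (aeE q) => x fE _ [<-].
have [N [mN N0 subN]] := ae_foralln aek.
have PN x : ~ N x -> forall k q, unpickle k = Some q -> f x < ratr q <-> E q x.
  by move=> Nx; apply: contrapT => h; exact/Nx/subN.
exists (f \_ (~` N)); last first.
  exists N; split => // x /= fx; apply: contrapT => Nx; apply: fx.
  by rewrite patchE mem_set.
have mCN : measurable (~` N : set B) by exact: measurableC.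
apply/(measurable_restrictT _ mCN) => _.
apply: (measurability _ (RGenInftyO.measurableE R)) => //.
move=> _ [_ [r ->] <-].
rewrite (_ : _ `&` _ = \bigcup_(q in [set q : rat | ratr q < r]) (E q `\` N)).
  rewrite bigcup_mkcond; apply: bigcupT_measurable_rat => q.
  by case: ifPn => // _; exact: measurableD.
apply/seteqP; split => x /=.
  rewrite in_itv/= => -[Nx fr].
  have [q] := rat_in_itvoo fr; rewrite in_itv/= => /andP[fq qr].
  exists q => //; split => //.
  by apply/(PN _ Nx (pickle q) q) => //; rewrite pickleK.
move=> [q /= qr [Eq Nx]]; split => //; rewrite in_itv/=.
apply: lt_trans qr.
by apply/(PN _ Nx (pickle q) q) => //; rewrite pickleK.
Qed.

End borel_regular_outer_measure.

(** * Lebesgue measure as a Borel measure *)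

Section lebesgue_outer_measure.
Context (R : realType) (n : nat).
Local Notation V := 'rV[R]_n.
Local Notation mu := (@leb_outer R n).

Lemma box_volume_ge0 (B : V * V) : 0 <= box_volume B.
Proof. by apply: prodr_ge0 => i _; rewrite le_max lexx. Qed.

(** The map [c] may identify boxes of [G], while a cover is a set. Choosing one preimage [h y] of
    each image box embeds the sum over the image cover into the sum over [G]. *)
Lemma leb_outer_le_image (G : set (V * V)) (c : V * V -> V * V) (A : set V) :
  countable G -> A `<=` \bigcup_(B in G) box (c B) ->
  (mu A <= \esum_(B in G) (box_volume (c B))%:E)%E.
Proof.
move=> cG AG.
apply: (@le_trans _ _ (\esum_(B in c @` G) (box_volume B)%:E)%E).
  apply: ereal_inf_lbound; exists (c @` G) => //; split.
    exact: sub_countable (card_image_le _ _) cG.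
  by move=> x /AG[B GB xB]; exists (c B) => //; exists B.
have /choice[h hP] (y : V * V) : exists x, (c @` G) y -> G x /\ c x = y.
  have [[x Gx <-]|nG] := pselect ((c @` G) y); first by exists x.
  by exists y => /nG.
have inj_h : set_inj (c @` G) h.
  move=> y z /set_mem cy /set_mem cz hyz.
  by rewrite -(proj2 (hP _ cy)) -(proj2 (hP _ cz)) hyz.
apply: (@le_trans _ _ (\esum_(B in h @` (c @` G)) (box_volume (c B))%:E)%E).
  rewrite (esum_image (c @` G) h)//; apply: le_esum => y cy.
  by rewrite (proj2 (hP _ cy)).
apply: ge_ereal_sup => _ [X [fX XS] <-]; apply: esum_ge; exists X => //.
split => //; apply: (subset_trans XS) => _ [y cy <-].
exact: (proj1 (hP _ cy)).
Qed.

Lemma leb_outer_box (B : V * V) : (mu (box B) <= (box_volume B)%:E)%E.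
Proof.
rewrite -(esum_set1 (a := fun B => (box_volume B)%:E)) ?lee_fin ?box_volume_ge0//.
apply: (@leb_outer_le_image [set B] id); first exact: countable1.
by rewrite bigcup_set1.
Qed.

(** The two parts of a box on either side of the hyperplane where coordinate [i] equals [a]. A
    hyperplane that misses the box makes one part have volume 0, through the [Num.max 0] in
    [box_volume]. *)
Definition cut_above (i : 'I_n) (a : R) (B : V * V) : V * V :=
  (B.1, \row_j if j == i then Num.min (B.2 ord0 j) a else B.2 ord0 j).

Definition cut_below (i : 'I_n) (a : R) (B : V * V) : V * V :=
  (\row_j (if j == i then Num.max (B.1 ord0 j) a else B.1 ord0 j), B.2).

Lemma box_volume_cut i a B :
  box_volume (cut_above i a B) + box_volume (cut_below i a B) <= box_volume B.
Proof.
rewrite /box_volume (bigD1 i)//= [X in _ + X](bigD1 i)//= [leRHS](bigD1 i)//=.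
rewrite !mxE eqxx.
rewrite (eq_bigr (fun j => Num.max 0 (B.2 ord0 j - B.1 ord0 j))); last first.
  by move=> j ji; rewrite mxE (negbTE ji).
rewrite [X in _ + _ * X](eq_bigr (fun j => Num.max 0 (B.2 ord0 j - B.1 ord0 j))); last first.
  by move=> j ji; rewrite mxE (negbTE ji).
rewrite -mulrDl ler_wpM2r//.
  by apply: prodr_ge0 => j _; rewrite le_max lexx.
move: (B.1 ord0 i) (B.2 ord0 i) => l u.
case: (leP u a) => ua; case: (leP l a) => la.
- case: (leP 0 (u - l)); case: (leP 0 (u - a)); lra.
- case: (leP 0 (u - l)); lra.
- case: (leP 0 (u - l)); case: (leP 0 (a - l)); case: (leP 0 (u - a)); lra.
- case: (leP 0 (u - l)); case: (leP 0 (a - l)); lra.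
Qed.

(** Caratheodory's criterion: cutting every box of a cover along the hyperplane gives covers of both
    pieces, with total volume at most that of the original cover. *)
Lemma leb_outer_halfspace (i : 'I_n) (a : R) :
  measurable ([set x : V | x ord0 i <= a] : set (caratheodory_type mu)).
Proof.
apply: le_caratheodory_measurable => X /=.
apply: le_ereal_inf_tmp => _ [G [cG XG] <-].
have sub1 : X `&` [set x : V | x ord0 i <= a] `<=`
    \bigcup_(B in G) box (cut_above i a B).
  move=> x [/XG[B GB xB] /= xa]; exists B => // j; rewrite /= mxE.
  case: eqP => [->|_]; last exact: xB.
  by case/andP: (xB i) => -> /=; rewrite le_min xa andbT.
have sub2 : X `&` ~` [set x : V | x ord0 i <= a] `<=`
    \bigcup_(B in G) box (cut_below i a B).
  move=> x [/XG[B GB xB] /= /negP]; rewrite -ltNge => /ltW xa.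
  exists B => // j; rewrite /= mxE.
  case: eqP => [->|_]; last exact: xB.
  by case/andP: (xB i) => + ->; rewrite ge_max xa andbT => ->.
apply: le_trans (leeD (leb_outer_le_image cG sub1) (leb_outer_le_image cG sub2)) _.
rewrite -esumD; last 2 first.
- by move=> B _; rewrite lee_fin box_volume_ge0.
- by move=> B _; rewrite lee_fin box_volume_ge0.
by apply: le_esum => B _; rewrite -EFinD lee_fin box_volume_cut.
Qed.

(** Generators of the product sigma-algebra, that is, of the Borel sets of R^n. With all
    one-dimensional Borel sets as bases, measurability of a vector-valued map is measurability of
    its coordinates. *)
Definition coordinate_sets : set (set V) :=
  [set A | exists (i : 'I_n) (B : set (measurableTypeR R)),
    measurable B /\ A = [set x : V | B (x ord0 i)]].

Local Notation rowBorel := (g_sigma_algebraType coordinate_sets).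

Lemma measurable_coord (i : 'I_n) :
  measurable_fun setT (fun x : rowBorel => x ord0 i).
Proof.
move=> _ A mA; rewrite setTI; apply: sub_sigma_algebra.
by exists i, A.
Qed.

Lemma measurable_rowP d (T : measurableType d) (f : T -> rowBorel) :
  (forall i, measurable_fun setT (fun x => f x ord0 i)) -> measurable_fun setT f.
Proof.
move=> mf; apply: (@measurability _ _ T rowBorel setT f coordinate_sets erefl).
move=> _ [_ [i [B [mB ->]]] <-].
exact: mf.
Qed.

Lemma coordinate_sets_cara :
  coordinate_sets `<=` (@measurable _ (caratheodory_type mu)).
Proof.
move=> _ [i [B [mB ->]]].
suff : measurable_fun setT (fun x : caratheodory_type mu => x ord0 i).
  by move=> /(_ measurableT _ mB); rewrite setTI.
apply: (measurability _ (RGenOInfty.measurableE R)) => // _ [_ [r ->] <-].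
rewrite setTI (_ : _ @^-1` _ = ~` [set x : V | x ord0 i <= r]); last first.
  apply/seteqP; split => x /=; by rewrite in_itv/= andbT ltNge => /negP.
exact/measurableC/leb_outer_halfspace.
Qed.

End lebesgue_outer_measure.

Notation rowBorel R n := (g_sigma_algebraType (@coordinate_sets R n)).

Lemma bigcup_measurable_countable d (T : sigmaRingType d) (I : Type)
    (D : set I) (F : I -> set T) : countable D ->
  (forall i, D i -> measurable (F i)) -> measurable (\bigcup_(i in D) F i).
Proof.
move=> /countable_injP[f finj] mF.
rewrite (_ : \bigcup_(i in D) F i = \bigcup_(k in [set: nat])
    \bigcup_(i in [set i | D i /\ f i = k]) F i); last first.
  apply/seteqP; split => x.
    by move=> [i Di Fix]; exists (f i) => //; exists i.
  by move=> [k _ [i [Di _] Fix]]; exists i.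
apply: bigcupT_measurable => k.
have [[i [Di fik]]|noi] := pselect (exists i, D i /\ f i = k).
  rewrite (_ : [set i | _] = [set i]); first by rewrite bigcup_set1; exact: mF.
  apply/seteqP; split => [j [Dj fjk]|_ -> //].
  by apply: finj; rewrite ?inE// fjk.
rewrite (_ : [set i | _] = set0) ?bigcup_set0//.
by rewrite -subset0 => i ?; apply: noi; exists i.
Qed.

Section lebesgue_borel.
Context (R : realType) (n : nat).
Local Notation V := 'rV[R]_n.
Local Notation mu := (@leb_outer R n).
Local Notation VB := (rowBorel R n).

Lemma measurable_box (B : V * V) : measurable (box B : set VB).
Proof.
rewrite (_ : box B = \bigcap_(i in [set: 'I_n])
    (setT `&` (fun x : VB => x ord0 i) @^-1` `[B.1 ord0 i, B.2 ord0 i]%classic)).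
  apply: fin_bigcap_measurable; first exact: finite_finset.
  by move=> i _; exact: measurable_coord.
apply/seteqP; split => [x xB i _|x xB i].
  by split => //=; rewrite in_itv/=; exact: xB.
by have [] := xB i I; rewrite /= in_itv.
Qed.

(** The hull is the intersection over [k] of the unions of box covers whose total volume exceeds the
    outer measure by at most 1 / (k + 1). *)
Lemma leb_outer_regular (A : set V) :
  exists E : set VB, [/\ measurable E, A `<=` E & mu E = mu A].
Proof.
have [Aoo|Aoo] := eqVneq (mu A) +oo%E.
  exists setT; split => //; apply/eqP.
  by rewrite eq_le {1}Aoo leey le_outer_measure.
have Afin : mu A \is a fin_num by rewrite ge0_fin_numE ?ltey// outer_measure_ge0.
pose P k (G : set (V * V)) := [/\ countable G, A `<=` \bigcup_(B in G) box B &
  (\esum_(B in G) (box_volume B)%:E <= mu A + (k.+1%:R^-1)%:E)%E].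
have [G PG] : {G : (set (V * V))^nat & forall k, P k (G k)}.
  apply: (@choice _ _ P) => k; rewrite /P.
  have k0 : 0 < k.+1%:R^-1 :> R by [].
  have [x [G [cG AG] <-] xS] := lb_ereal_inf_adherent k0 Afin.
  by exists G; split => //; exact/ltW.
exists (\bigcap_k \bigcup_(B in G k) box B); split.
- apply: bigcapT_measurable => k; have [cG _ _] := PG k.
  by apply: bigcup_measurable_countable => // B _; exact: measurable_box.
- by move=> x Ax k _; have [_ AG _] := PG k; exact: AG.
- apply/eqP; rewrite eq_le; apply/andP; split; last first.
    by apply: le_outer_measure => x Ax k _; have [_ AG _] := PG k; exact: AG.
  apply/lee_addgt0Pr => _/posnumP[e].
  near \oo => k.
  have [cG _ Gle] := PG k.
  apply: (@le_trans _ _ (mu A + (k.+1%:R^-1)%:E)%E).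
    apply: le_trans Gle; apply: (@leb_outer_le_image _ _ (G k) id) => //.
    exact: bigcap_inf.
  rewrite leeD2l// lee_fin ltW//.
  by near: k; exact: near_infty_natSinv_lt.
Unshelve. all: by end_near. Qed.

Lemma leb_outer_sigma_finite : exists Q : nat -> set VB,
  [/\ forall k, measurable (Q k), \bigcup_k Q k = setT &
      forall k, (mu (Q k) < +oo)%E].
Proof.
exists (fun k => box (const_mx (- k%:R), const_mx k%:R)); split.
- by move=> k; exact: measurable_box.
- apply/seteqP; split => // x _.
  exists (Num.trunc (\sum_(i < n) `|x ord0 i|)).+1 => // i; rewrite /= !mxE -ler_norml.
  have /ltW := truncnS_gt (\sum_(i < n) `|x ord0 i|).
  by apply: le_trans; rewrite (bigD1 i)//= lerDl sumr_ge0.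
- by move=> k; apply: le_lt_trans (leb_outer_box _) _; exact: ltry.
Qed.

(** The same set function on the Borel sets, where product measures are formed and Tonelli's theorem
    is applied. *)
Definition leb_borel (A : set VB) : \bar R := mu A.

Lemma leb_borel0 : leb_borel set0 = 0%E.
Proof. exact: outer_measure0. Qed.

Lemma leb_borel_ge0 A : (0 <= leb_borel A)%E.
Proof. exact: outer_measure_ge0. Qed.

Lemma leb_borel_sigma_additive : semi_sigma_additive leb_borel.
Proof.
move=> F mF tF mUF; have bc := borel_sub_cara (@coordinate_sets_cara R n).
by apply: (@caratheodory_measure_sigma_additive R _ mu) => // [i|]; exact: bc.
Qed.

HB.instance Definition _ := isMeasure.Build _ VB R leb_borel
  leb_borel0 leb_borel_ge0 leb_borel_sigma_additive.

Lemma leb_borel_sigma_finite : sigma_finite setT leb_borel.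
Proof.
have [Q [mQ QT Qoo]] := leb_outer_sigma_finite.
by exists Q => // k; split.
Qed.

HB.instance Definition _ := Measure_isSigmaFinite.Build _ VB R leb_borel
  leb_borel_sigma_finite.

Lemma box_scale t (B : V * V) : 0 < t ->
  [set x : V | box B (t^-1 *: x)] = box (t *: B.1, t *: B.2).
Proof.
move=> t0; apply/seteqP; split => x /= xB i; have := xB i;
  by rewrite /= !mxE ler_pdivlMl// ler_pdivrMl.
Qed.

Lemma box_volume_scale t (B : V * V) : 0 < t ->
  box_volume (t *: B.1, t *: B.2) = t ^+ n * box_volume B.
Proof.
move=> t0; have -> : t ^+ n = \prod_(i < n) t by rewrite prodr_const card_ord.
rewrite /box_volume -big_split/=.
by apply: eq_bigr => i _; rewrite maxr_pMr ?(ltW t0)// mulr0 !mxE mulrBr.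
Qed.

Lemma leb_outer_scale_le t (A : set V) : 0 < t ->
  (mu [set x | A (t^-1 *: x)] <= (t ^+ n)%:E * mu A)%E.
Proof.
move=> t0; rewrite -lee_pdivrMl ?exprn_gt0//.
apply: le_ereal_inf_tmp => _ [G [cG AG] <-].
rewrite lee_pdivrMl ?exprn_gt0//.
have sub : [set x | A (t^-1 *: x)] `<=`
    \bigcup_(B in G) box (t *: B.1, t *: B.2).
  by move=> x /AG[B GB xB]; exists B => //; rewrite -box_scale.
apply: le_trans (leb_outer_le_image (c := fun B => (t *: B.1, t *: B.2)) cG sub) _.
under eq_esum do rewrite box_volume_scale// EFinM.
have tn0 : (0 <= (t ^+ n)%:E)%E by rewrite lee_fin exprn_ge0// ltW.
apply: ge_ereal_sup => _ [X [fX XG] <-].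
rewrite -ge0_mule_fsumr; last by move=> B; rewrite lee_fin box_volume_ge0.
by apply: lee_wpmul2l => //; apply: esum_ge; exists X.
Qed.

(** The missing inequality is the one already known, for the ratio [t^-1] and the dilated set. *)
Lemma leb_outer_scale t (A : set V) : 0 < t ->
  mu [set x | A (t^-1 *: x)] = ((t ^+ n)%:E * mu A)%E.
Proof.
move=> t0; apply/eqP; rewrite eq_le leb_outer_scale_le//=.
have ti0 : 0 < t^-1 by rewrite invr_gt0.
have := leb_outer_scale_le [set x | A (t^-1 *: x)] ti0.
have -> : [set x | [set x | A (t^-1 *: x)] (t^-1^-1 *: x)] = A.
  apply/seteqP; split => x /=; rewrite scalerA divff ?invr_eq0 ?gt_eqF// scale1r//.
by rewrite exprVn lee_pdivlMl ?exprn_gt0.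
Qed.

End lebesgue_borel.

(** * Integration against a measure with a density *)

Section density.
Context d (T : measurableType d) (R : realType).
Variables (mu nu : {measure set T -> \bar R}) (h : T -> R).
Hypotheses (mh : measurable_fun setT h) (h0 : forall x, 0 <= h x).
Hypothesis nuE : forall A, measurable A ->
  (nu A = \int[mu]_(x in A) (h x)%:E)%E.

Import HBNNSimple.

(** Both sides are limits along an increasing sequence of simple functions, by monotone convergence;
    for a simple function the identity is the hypothesis on each level set. *)
Lemma integral_density (f : T -> \bar R) :
  measurable_fun setT f -> (forall x, 0 <= f x)%E ->
  (\int[nu]_x f x = \int[mu]_x (f x * (h x)%:E))%E.
Proof.
move=> mf f0.
have mEh : measurable_fun setT (EFin \o h) by exact/measurable_EFinP.
pose g := nnsfun_approx measurableT mf.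
have gf x : (g k x)%:E @[k --> \oo] --> f x by exact: cvg_nnsfun_approx.
have ndg x i j : (i <= j)%N -> ((g i x)%:E <= (g j x)%:E)%E.
  by move=> ij; rewrite lee_fin; exact/lefP/nd_nnsfun_approx.
have mg k : measurable_fun setT (fun x => (g k x)%:E).
  exact/measurable_EFinP/measurable_funP.
transitivity (limn (fun k => \int[nu]_x (g k x)%:E))%E.
  rewrite -monotone_convergence//.
  - by apply: eq_integral => x _; apply/esym/cvg_lim => //; exact: gf.
  - by move=> k x _; rewrite lee_fin.
  - by move=> x _ i j; exact: ndg.
transitivity (limn (fun k => \int[mu]_x ((g k x)%:E * (h x)%:E)))%E; last first.
  rewrite -monotone_convergence//.
  - apply: eq_integral => x _; apply/cvg_lim => //.
    by apply: cvgeZr => //; exact: gf.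
  - by move=> k; exact: emeasurable_funM.
  - by move=> k x _; rewrite mule_ge0 ?lee_fin.
  - by move=> x _ i j ij; apply: lee_wpmul2r; [rewrite lee_fin|exact: ndg].
congr (limn _); apply/funext => k; move: (g k) => {mg ndg gf}{}g.
under eq_integral do rewrite fimfunE -fsumEFin//.
rewrite ge0_integral_fsum//; last 2 first.
- by move=> y; exact/measurable_EFinP/measurable_funM.
- by move=> y x _; rewrite nnfun_muleindic_ge0.
under [in RHS]eq_integral => x _.
  rewrite fimfunE -fsumEFin// ge0_mule_fsuml; last first.
    by move=> y; rewrite nnfun_muleindic_ge0.
  over.
rewrite ge0_integral_fsum//; last 2 first.
- move=> y; apply: emeasurable_funM => //.
  exact/measurable_EFinP/measurable_funM.
- by move=> y x _; rewrite mule_ge0// ?nnfun_muleindic_ge0// lee_fin.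
apply: eq_fsbigr => y /set_mem [x _ gxy].
have y0 : 0 <= y by rewrite -gxy.
rewrite integralZl_indic_nnsfun// integral_indic// setIT.
under [in RHS]eq_integral do rewrite EFinM -muleA.
rewrite ge0_integralZl//.
- congr (_ * _)%E; rewrite nuE// integral_mkcond.
  apply: eq_integral => z _; rewrite /= patchE indicE.
  by case: ifPn => _; rewrite ?mul1e ?mul0e.
- by apply: emeasurable_funM => //; exact/measurable_EFinP.
- by move=> z _; rewrite mule_ge0// lee_fin.
Qed.

End density.

(** * The radial measure r^(n-1) dr on the half-line *)

Section radial_measure.
Context {R : realType}.
Local Notation m := (@lebesgue_measure R).
Variable n : nat.

(** Extended by 0 to the whole line, so that the radial measure lives on the Borel sets of R and is
    determined by its values on the half-lines []-oo, b]]. *)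
Definition radial_density : R -> R :=
  (fun r : R => r ^+ n.-1 : R) \_ `]0, +oo[%classic.

Lemma radial_density_ge0 r : 0 <= radial_density r.
Proof.
rewrite /radial_density patchE; case: ifPn => //.
by rewrite inE /= in_itv/= andbT => /ltW r0; exact: exprn_ge0.
Qed.

Lemma radial_densityE r : 0 < r -> radial_density r = r ^+ n.-1.
Proof. by move=> r0; rewrite /radial_density patchE mem_set//= in_itv/= r0. Qed.

Lemma radial_density0 r : r <= 0 -> radial_density r = 0.
Proof.
move=> r0; rewrite /radial_density patchE memNset//= in_itv/= andbT.
by apply/negP; rewrite -leNgt.
Qed.

Lemma measurable_radial_density : measurable_fun setT radial_density.
Proof.
apply/(measurable_restrictT _ (measurable_itv _)).
by apply: measurable_funTS; exact: exprn_measurable.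
Qed.

Definition radial (A : set (measurableTypeR R)) : \bar R :=
  (\int[m]_(r in A) (radial_density r)%:E)%E.

Lemma radial0 : radial set0 = 0%E.
Proof. exact: integral_set0. Qed.

Lemma radial_ge0 A : (0 <= radial A)%E.
Proof. by apply: integral_ge0 => r _; rewrite lee_fin radial_density_ge0. Qed.

Lemma radial_sigma_additive : semi_sigma_additive radial.
Proof.
move=> F mF tF mUF; apply: cvg_toP.
  apply: ereal_nondecreasing_is_cvgn => i j ij.
  by apply: lee_sum_nneg_natr => // k _ _; exact: radial_ge0.
rewrite /radial ge0_integral_bigcup//=.
- by apply/measurable_funTS/measurable_EFinP; exact: measurable_radial_density.
- by move=> x _; rewrite lee_fin radial_density_ge0.
Qed.

HB.instance Definition _ := isMeasure.Build _ (measurableTypeR R) R radial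
  radial0 radial_ge0 radial_sigma_additive.

Lemma radial_itvNyc0 (b : R) : b <= 0 -> radial `]-oo, b]%classic = 0%E.
Proof.
move=> b0; apply: integral0_eq => r /=; rewrite in_itv/= => rb.
by rewrite radial_density0// (le_trans rb).
Qed.

Lemma radial_itvNyc (b : R) : (0 < n)%N -> 0 < b ->
  radial `]-oo, b]%classic = (b ^+ n / n%:R)%:E.
Proof.
move=> n0 b0.
have nn0 : n%:R != 0 :> R by rewrite pnatr_eq0 -lt0n.
rewrite /radial (_ : `]-oo, b]%classic = `]-oo, 0] `|` `]0, b])%classic; last first.
  apply/seteqP; split => r /=; rewrite !in_itv/=.
    by move=> rb; case: (leP r 0); [left|right].
  by case=> [r0|/andP[]//]; rewrite (le_trans r0)// ltW.
rewrite ge0_integral_setU//=; last 3 first.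
  by apply/measurable_funTS/measurable_EFinP; exact: measurable_radial_density.
  by move=> r _; rewrite lee_fin radial_density_ge0.
  by apply/disj_setPLR => r /=; rewrite !in_itv/= => r0;
    rewrite ltNge r0.
have := radial_itvNyc0 (lexx 0); rewrite /radial => ->; rewrite add0e.
rewrite integral_itv_obnd_cbnd//; last first.
  by apply/measurable_funTS/measurable_EFinP; exact: measurable_radial_density.
rewrite -integral_itv_obnd_cbnd; last first.
  by apply/measurable_funTS/measurable_EFinP; exact: measurable_radial_density.
(* The density is replaced by the power on []0, b]] only, since at 0 they are 0 and 1 when [n = 1];
   the endpoint is then restored for the fundamental theorem of calculus. *)
under eq_integral => r.
  rewrite inE/= in_itv/= => /andP[r0 _]; rewrite (radial_densityE r0); over.
rewrite integral_itv_obnd_cbnd; last first.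
  by apply/measurable_funTS/measurable_EFinP; exact: exprn_measurable.
rewrite (@continuous_FTC2 _ _ (fun r => r ^+ n * n%:R^-1))//=.
- by rewrite expr0n eqn0Ngt n0/= mul0r sube0.
- by apply: continuous_subspaceT => r; exact: exprn_continuous.
- split.
  + by move=> r _; apply: derivableM => //; exact: exprn_derivable.
  + by apply: cvg_at_right_filter; apply: cvgMl; exact: exprn_continuous.
  + by apply: cvg_at_left_filter; apply: cvgMl; exact: exprn_continuous.
- move=> r _; rewrite derive1Mr; last exact: exprn_derivable.
  by rewrite derive1E exp_derive scaler1 [_ *: _]mulrC mulfK.
Qed.

Lemma radial_sigma_finite : (0 < n)%N -> sigma_finite setT radial.
Proof.
move=> n0; exists (fun k => `]-oo, k.+1%:R]%classic).
  apply/seteqP; split => // r _; exists (Num.trunc r) => //=.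
  by rewrite in_itv/= ltW// truncnS_gt.
by move=> k; split => //; rewrite radial_itvNyc ?ltry.
Qed.

Lemma integral_radial (f : R -> \bar R) :
  measurable_fun setT f -> (forall r, 0 <= f r)%E ->
  (\int[radial]_r f r = \int[m]_r (f r * (radial_density r)%:E))%E.
Proof.
exact: (@integral_density _ (measurableTypeR R) R m radial radial_density
  measurable_radial_density radial_density_ge0 (fun A _ => erefl)).
Qed.

End radial_measure.

(** * Polar coordinates *)

Section euclidean_norm.
Context (R : realType) (n : nat).
Local Notation V := 'rV[R]_n.
Local Notation VB := (rowBorel R n).
Implicit Types x y : V.

Lemma enorm_ge0 x : 0 <= enorm x.
Proof. exact: sqrtr_ge0. Qed.

Lemma enorm_sqr x : enorm x ^+ 2 = \sum_(i < n) x ord0 i ^+ 2.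
Proof. by rewrite sqr_sqrtr// sumr_ge0// => i _; exact: sqr_ge0. Qed.

Lemma enormZ t x : enorm (t *: x) = `|t| * enorm x.
Proof.
rewrite /enorm -sqrtr_sqr -sqrtrM ?sqr_ge0//; congr Num.sqrt.
by rewrite mulr_sumr; apply: eq_bigr => i _; rewrite mxE exprMn.
Qed.

Lemma coord_le_enorm x i : `|x ord0 i| <= enorm x.
Proof.
rewrite -sqrtr_sqr ler_sqrt; last by apply: sumr_ge0 => j _; exact: sqr_ge0.
by rewrite (bigD1 i)//= lerDl sumr_ge0// => j _; exact: sqr_ge0.
Qed.

Lemma enorm_eq0 x : enorm x = 0 -> x = 0.
Proof.
move=> x0; apply/rowP => i; rewrite mxE; apply/eqP; rewrite -normr_le0 -x0.
exact: coord_le_enorm.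
Qed.

Lemma enorm0 : enorm (0 : V) = 0.
Proof. by rewrite -(scale0r (0 : V)) enormZ normr0 mul0r. Qed.

(* The factor 2 makes the Cauchy-Schwarz inequality unnecessary. *)
Lemma enormB_le x y : enorm (x - y) <= 2 * (enorm x + enorm y).
Proof.
have H0 : 0 <= 2 * (enorm x + enorm y) by rewrite mulr_ge0// addr_ge0// enorm_ge0.
rewrite -(ler_sqr (enorm_ge0 _) H0) enorm_sqr.
apply: (@le_trans _ _ (2 * (enorm x ^+ 2 + enorm y ^+ 2))).
  rewrite !enorm_sqr -big_split/= mulr_sumr; apply: ler_sum => i _.
  rewrite !mxE; have := sqr_ge0 (x ord0 i + y ord0 i); nra.
have := enorm_ge0 x; have := enorm_ge0 y; nra.
Qed.

Lemma enorm_le_coord x : enorm x <= \sum_(i < n) `|x ord0 i|.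
Proof.
have s0 : 0 <= \sum_(i < n) `|x ord0 i| by exact: sumr_ge0.
rewrite -(ler_sqr (enorm_ge0 _) s0) enorm_sqr expr2 mulr_suml; apply: ler_sum => i _.
rewrite -real_normK ?num_real// expr2 ler_wpM2l// (bigD1 i)//= lerDl; exact: sumr_ge0.
Qed.

Lemma measurable_enorm : measurable_fun setT (@enorm R n : VB -> R).
Proof.
rewrite (_ : @enorm R n =
    Num.sqrt \o (fun x : VB => \sum_(i < n) x ord0 i ^+ 2))//.
apply: measurableT_comp.
  by apply: continuous_measurable_fun; exact: sqrt_continuous.
apply: measurable_sum => i; apply: measurable_funX; exact: measurable_coord.
Qed.

(** Written as r (r^2)^-1 with a real power: the square keeps the base nonnegative, and both sides
    vanish at 0. *)
Lemma measurable_inv : measurable_fun setT (@GRing.inv R).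
Proof.
rewrite (_ : GRing.inv = (fun r : R => r * (r ^+ 2) `^ (-1))).
  apply: measurable_funM => //.
  by apply: (measurableT_comp (@measurable_powR R (-1))); exact: exprn_measurable.
apply/funext => r; rewrite powR_inv1 ?sqr_ge0//.
have [->|r0] := eqVneq r 0; first by rewrite invr0 mul0r.
by rewrite expr2 invfM mulrA divff// mul1r.
Qed.

Lemma measurable_scale d (T : measurableType d) (a : T -> R) (f : T -> VB) :
  measurable_fun setT a -> measurable_fun setT f ->
  measurable_fun setT ((fun z => a z *: (f z : V)) : T -> VB).
Proof.
move=> ma mf; apply: measurable_rowP => i.
rewrite (_ : (fun z => _) = (fun z => a z * (f z : V) ord0 i)); last first.
  by apply/funext => z; rewrite mxE.
apply: measurable_funM => //.
exact: (measurableT_comp (@measurable_coord R n i) mf).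
Qed.

(** The convention 0^-1 = 0 sends the origin to itself, so that x is |x| times its direction for
    every x. *)
Definition direction (x : VB) : VB := (enorm x)^-1 *: x.

Lemma measurable_direction : measurable_fun setT direction.
Proof.
apply: measurable_scale => //.
by apply: measurableT_comp measurable_enorm; exact: measurable_inv.
Qed.

Lemma enorm_direction x : x != 0 -> enorm (direction x) = 1.
Proof.
move=> x0; have e0 : enorm x != 0 by apply: contra x0 => /eqP/enorm_eq0 ->.
by rewrite enormZ ger0_norm ?mulVf// invr_ge0 enorm_ge0.
Qed.

Lemma scale_direction x : enorm x *: direction x = x.
Proof.
have [e0|e0] := eqVneq (enorm x) 0.
  by rewrite e0 scale0r (enorm_eq0 e0).
by rewrite /direction scalerA divff// scale1r.
Qed.

Lemma direction_scale t x : 0 < t -> direction (t *: x) = direction x.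
Proof.
move=> t0; rewrite /direction enormZ gtr0_norm// scalerA invfM -mulrA.
by rewrite [_ * t]mulrC mulrA mulVf ?gt_eqF// mul1r.
Qed.

Lemma direction_sphere x : enorm x = 1 -> direction x = x.
Proof. by move=> x1; rewrite /direction x1 invr1 scale1r. Qed.

(** The parameters t and y of a point of the cone are its norm and its direction; cones thereby
    become preimages under a Borel map. *)
Lemma unit_coneE (E : set V) :
  unit_cone E = [set x | 0 < enorm x <= 1 /\ E (direction x)].
Proof.
apply/seteqP; split => [_ [t [y [/andP[t0 t1] Ey Sy ->]]]|x [/andP[x0 x1] Ex]].
  rewrite /= direction_scale// direction_sphere// enormZ Sy mulr1 gtr0_norm//.
  by rewrite t0 t1.
exists (enorm x), (direction x); split => //; first by rewrite x0.
  apply: enorm_direction; apply/eqP => x00; by rewrite x00 enorm0 ltxx in x0.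
by rewrite scale_direction.
Qed.

Lemma measurable_esphere : measurable (@esphere R n : set VB).
Proof.
rewrite (_ : @esphere R n = setT `&` (@enorm R n : VB -> R) @^-1` [set 1]).
  exact: measurable_enorm.
by rewrite setTI.
Qed.

Lemma measurable_eball r : measurable (@eball R n r : set VB).
Proof.
rewrite (_ : eball r = setT `&` (@enorm R n : VB -> R) @^-1` `]-oo, r[%classic).
  exact: measurable_enorm.
by rewrite setTI; apply/seteqP; split => x /=; rewrite in_itv.
Qed.

(** The topology is that of the sup norm, so an open set is the union of the cubes with rational
    centre and rational radius contained in it, a countable family. *)
Lemma open_measurable_row (U : set V) : open U -> measurable (U : set VB).
Proof.
move=> oU.
pose c (q : 'rV[rat]_n) : V := map_mx (ratr : rat -> R) q.
pose Q (k : 'rV[rat]_n * rat) : set VB :=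
  [set x | forall i, `|c k.1 ord0 i - x ord0 i| < ratr k.2].
have mQ k : measurable (Q k).
  rewrite (_ : Q k = \bigcap_(i in [set: 'I_n])
      (setT `&` (fun x : VB => x ord0 i) @^-1` ball (c k.1 ord0 i) (ratr k.2))).
    apply: fin_bigcap_measurable; first exact: finite_finset.
    by move=> i _; apply: measurable_coord => //; exact: measurable_ball.
  by apply/seteqP; split => [x xB i _|x xB i]; [split => //; exact: xB|
     case: (xB i I)].
rewrite (_ : U = \bigcup_(k in [set k | Q k `<=` U]) Q k); last first.
  apply/seteqP; split => [x Ux|x [k kU]]; last exact: kU.
  have [e /= e0 eU] := (nbhs_ballP x U).1 (open_nbhs_nbhs (conj oU Ux)).
  (* Points of the cube are within [q] of its centre and the centre is within [q] of [x], so a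
     radius below e / 2 keeps the cube inside the ball of radius e about [x]. *)
  have e20 : 0 < e / 2 by rewrite divr_gt0.
  have [q] := rat_in_itvoo e20; rewrite in_itv/= => /andP[q0 qe].
  have /choice[z zP] (i : 'I_n) : exists z : rat, `|ratr z - x ord0 i| < ratr q :> R.
    have xq : x ord0 i - ratr q < x ord0 i + ratr q by lra.
    have [z] := rat_in_itvoo xq; rewrite in_itv/= => /andP[z1 z2].
    by exists z; rewrite ltr_norml; apply/andP; split; lra.
  exists (\row_i z i, q) => [y yQ|]; last by move=> i; rewrite /= !mxE; exact: zP.
  apply: eU; split => // i j; rewrite (ord1 i) /ball/=.
  have := yQ j; rewrite /= !mxE => yj; have := zP j => zj.
  rewrite distrC in zj.
  apply: le_lt_trans (ler_distD (ratr (z j)) _ _) _.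
  lra.
by apply: bigcup_measurable_countable; first exact: countableP.
Qed.

Lemma continuous_measurable_row (f : V -> R) :
  continuous f -> measurable_fun setT (f : VB -> R).
Proof.
move=> cf; apply: (measurability _ (RGenOpens.measurableE R)) => //.
move=> _ [_ [a [b ->]] <-]; rewrite setTI; apply: open_measurable_row.
by apply: open_comp => // x _; exact: cf.
Qed.

End euclidean_norm.

Section polar_coordinates.
Context (R : realType).
Local Notation m := (@lebesgue_measure R).

(** Valid in every dimension, as the instance below requires: for [n = 0] the truncated exponent
    [n.-1] is 0, as in dimension 1. *)
Lemma radial_sigma_finiteT (n : nat) : sigma_finite setT (@radial R n).
Proof.
case: n => [|n]; last exact: radial_sigma_finite.
exact: (@radial_sigma_finite R 1).
Qed.

HB.instance Definition _ (n : nat) :=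
  Measure_isSigmaFinite.Build _ (measurableTypeR R) R (@radial R n)
    (radial_sigma_finiteT n).

(** These half-lines are stable under intersection and have explicit radial measure, which makes
    them the right generator for uniqueness of measures. *)
Lemma measurable_itvNycE : @measurable _ (measurableTypeR R) =
  <<s [set A : set R | exists b, A = `]-oo, b]%classic] >>.
Proof.
apply/seteqP; split.
  rewrite [X in X `<=` _](RGenOInfty.measurableE R).
  apply: smallest_sub; first exact: smallest_sigma_algebra.
  move=> _ [x ->]; rewrite (_ : `]x, +oo[%classic = setT `\` `]-oo, x]%classic).
    apply: sigma_algebraCD; apply: sub_sigma_algebra; by exists x.
  by apply/seteqP; split => y /=; rewrite !in_itv/= andbT ltNge;
    [move/negP|case=> _ /negP].
apply: smallest_sub; first exact: sigma_algebra_measurable.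
by move=> _ [x ->]; exact: measurable_itv.
Qed.

Variable n : nat.
Local Notation V := 'rV[R]_n.
Local Notation VB := (rowBorel R n).
Local Notation L := (@leb_borel R n).

(** The cone over the part of [X] in [E] is the cone over [X] cut by the Borel set [D] of points
    with direction in [E]. So the splitting condition is n times that of [leb_outer] for [D]. *)
Lemma borel_cara_surface (E : set VB) : measurable E ->
  measurable (E : set (caratheodory_type (@surface_outer R n))).
Proof.
move=> mE; apply: le_caratheodory_measurable => X /=.
pose D : set VB := @direction R n @^-1` E.
have mD : measurable D.
  by rewrite -[D]setTI; exact: measurable_direction.
have cD := borel_sub_cara (@coordinate_sets_cara R n) mD.
rewrite /surface_outer (cD (unit_cone X)) ge0_muleDr ?outer_measure_ge0//.
rewrite (_ : unit_cone (X `&` E) = unit_cone X `&` D); last first.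
  by rewrite !unit_coneE; apply/seteqP; split => [x [? []]|x [[]]].
rewrite (_ : unit_cone (X `&` ~` E) = unit_cone X `&` ~` D)//.
by rewrite !unit_coneE; apply/seteqP; split => [x [? []]|x [[]]].
Qed.

Lemma coordinate_sets_cara_surface :
  @coordinate_sets R n `<=`
    (@measurable _ (caratheodory_type (@surface_outer R n))).
Proof.
move=> A GA; apply: borel_cara_surface; exact: sub_sigma_algebra.
Qed.

Definition surf_borel (A : set VB) : \bar R := surface_outer A.
Local Notation S := surf_borel.

Lemma surf_borel0 : S set0 = 0%E.
Proof. exact: outer_measure0. Qed.

Lemma surf_borel_ge0 A : (0 <= S A)%E.
Proof. exact: outer_measure_ge0. Qed.

Lemma surf_borel_sigma_additive : semi_sigma_additive S.
Proof.
move=> F mF tF mUF; have bc := borel_sub_cara coordinate_sets_cara_surface.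
by apply: (@caratheodory_measure_sigma_additive R _ (@surface_outer R n)) => // [i|];
  exact: bc.
Qed.

HB.instance Definition _ := isMeasure.Build _ VB R S
  surf_borel0 surf_borel_ge0 surf_borel_sigma_additive.

(** Every unit cone lies in the cube with side [-1, 1]. *)
Lemma surface_outer_lty (A : set V) : (surface_outer A < +oo)%E.
Proof.
rewrite /surface_outer lte_mul_pinfty//.
apply: (@le_lt_trans _ _ (leb_outer (box (const_mx (-1), const_mx 1 : V)))).
  apply: le_outer_measure => x; rewrite unit_coneE => -[/andP[_ x1] _] i.
  by rewrite /= !mxE -ler_norml (le_trans (coord_le_enorm _ _)).
by apply: le_lt_trans (leb_outer_box _) _; exact: ltry.
Qed.

Lemma surf_borel_sigma_finite : sigma_finite setT S.
Proof.
exists (fun=> setT); first by rewrite bigcup_const//; exists 0.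
by move=> _; split => //; exact: surface_outer_lty.
Qed.

HB.instance Definition _ := Measure_isSigmaFinite.Build _ VB R S
  surf_borel_sigma_finite.

Lemma surf_borel_compl_sphere : S (~` @esphere R n) = 0%E.
Proof.
rewrite /S /surface_outer (_ : unit_cone _ = set0) ?outer_measure0 ?mule0//.
by rewrite -subset0 => x [t [y [_ Sy Sy' _]]]; exact: Sy.
Qed.

Hypothesis n_gt0 : (0 < n)%N.

Lemma leb_borel_point0 : L [set 0] = 0%E.
Proof.
apply/eqP; rewrite eq_le measure_ge0 andbT.
apply: (@le_trans _ _ (leb_outer (box (0, 0 : V)))).
  by apply: le_outer_measure => _ -> i; rewrite /= !mxE lexx.
apply: le_trans (leb_outer_box _) _; rewrite lee_fin /box_volume.
by rewrite (bigD1 (Ordinal n_gt0))//= !mxE subrr maxxx mul0r.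
Qed.

Lemma leb_borel_cone (E : set VB) (b : R) : 0 < b ->
  L [set x | 0 < enorm x <= b /\ E (direction x)] =
  ((b ^+ n)%:E * L (unit_cone E))%E.
Proof.
move=> b0; rewrite -[RHS]leb_outer_scale//; congr (leb_outer _).
have bi0 : 0 < b^-1 by rewrite invr_gt0.
apply/seteqP; split => x; rewrite /= unit_coneE/= direction_scale// enormZ;
  by rewrite gtr0_norm// pmulr_rgt0// ler_pdivrMl// mulr1.
Qed.

(** The origin is a null set; it is added because the half-lines used for the uniqueness argument
    contain the radius 0. *)
Lemma leb_borel_cone0 (E : set VB) (b : R) : 0 < b ->
  L [set x | enorm x <= b /\ E (direction x)] =
  ((b ^+ n)%:E * L (unit_cone E))%E.
Proof.
move=> b0; rewrite -leb_borel_cone//; apply/eqP; rewrite eq_le; apply/andP; split.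
  apply: (@le_trans _ _ (leb_outer
      ([set x | 0 < enorm x <= b /\ E (direction x)] `|` [set (0 : V)]))).
    apply: le_outer_measure => x /= [xb Ex].
    have [->|x0] := eqVneq x 0; first by right.
    left; split => //; rewrite xb andbT lt_neqAle enorm_ge0 andbT eq_sym.
    by apply: contra x0 => /eqP/enorm_eq0 ->.
  apply: le_trans (outer_measureU2 _ _ _) _.
  rewrite [X in (_ + X)%E](_ : _ = 0%E) ?adde0//; exact: leb_borel_point0.
by apply: le_outer_measure => x /= [/andP[_ ?] ?].
Qed.

(** For fixed [E] both sides are measures in [A]: the image under the norm of Lebesgue measure
    restricted to directions in [E], and a multiple of the radial measure. They agree on half-lines
    by homogeneity, hence everywhere. *)
Lemma leb_borel_rectangle (A : set (measurableTypeR R)) (E : set VB) :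
  measurable A -> measurable E ->
  L [set x | A (enorm x) /\ E (direction x)] = (radial n A * S E)%E.
Proof.
move=> mA mE.
have mD : measurable (@direction R n @^-1` E : set VB).
  by rewrite -[X in measurable X]setTI; exact: measurable_direction.
have me : measurable_fun setT (@enorm R n : VB -> measurableTypeR R).
  exact: measurable_enorm.
have SEfin : S E \is a fin_num.
  by rewrite ge0_fin_numE ?surf_borel_ge0//; exact: surface_outer_lty.
have SE0 : 0 <= fine (S E) by rewrite fine_ge0 ?surf_borel_ge0.
pose m1 : {measure set (measurableTypeR R) -> \bar R} :=
  measure_function_pushforward__canonical__measure_function_Measure
    (mrestr L mD) me.
pose m2 : {measure set (measurableTypeR R) -> \bar R} :=
  mscale (NngNum SE0) (@radial R n).
have nn0 : n%:R != 0 :> R by rewrite pnatr_eq0 -lt0n.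
have m12 b : m1 `]-oo, b]%classic = m2 `]-oo, b]%classic.
  rewrite /m1 /m2 /= /pushforward /mrestr /mscale/=.
  rewrite (_ : _ `&` _ = [set x | enorm x <= b /\ E (direction x)]); last first.
    by apply/seteqP; split => x /=; rewrite in_itv.
  have [b0|b0] := ltP 0 b.
    (* The factor n in [surface_outer] cancels the denominator of b^n / n. *)
    rewrite leb_borel_cone0// radial_itvNyc// fineK// /S /surface_outer.
    rewrite [RHS]muleC muleA -EFinM -mulrA mulVf// mulr1.
    by rewrite muleC.
  rewrite radial_itvNyc0// mule0.
  apply/eqP; rewrite eq_le measure_ge0 andbT -leb_borel_point0.
  apply: le_outer_measure => x /= [xb _]; apply: enorm_eq0; apply/eqP.
  by rewrite eq_le enorm_ge0 andbT (le_trans xb).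
have -> : L [set x | A (enorm x) /\ E (direction x)] = m1 A by [].
have -> : (radial n A * S E)%E = m2 A by rewrite /m2/= /mscale/= fineK// muleC.
apply: (@measure_unique _ R (measurableTypeR R) _ (fun k => `]-oo, k%:R]%classic)
  measurable_itvNycE) => //.
- move=> _ _ [a ->] [b ->]; exists (Num.min a b); apply/seteqP; split => r /=;
    rewrite !in_itv/= le_min; [by case=> -> ->|by case/andP].
- by move=> k; exists k%:R.
- apply/seteqP; split => // r _; exists (Num.trunc r).+1 => //=.
  by rewrite in_itv/= ltW// truncnS_gt.
- by move=> _ [b ->]; exact: m12.
- move=> k; rewrite m12 /m2/= /mscale/=; have [k0|k0] := ltP 0 (k%:R : R).
    by rewrite radial_itvNyc//= fineK// lte_mul_pinfty ?surf_borel_ge0// ltry.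
  by rewrite radial_itvNyc0// mule0.
Qed.

Definition polar_map (x : VB) : measurableTypeR R * VB := (enorm x, direction x).

Lemma measurable_polar : measurable_fun setT polar_map.
Proof.
by apply: measurable_fun_pair; [exact: measurable_enorm|exact: measurable_direction].
Qed.

Lemma polar_measure (X : set (measurableTypeR R * VB)) : measurable X ->
  (radial n \x S)%E X = pushforward L polar_map X.
Proof.
move=> mX.
pose m' : {measure set (measurableTypeR R * VB) -> \bar R} :=
  measure_function_pushforward__canonical__measure_function_Measure L
    measurable_polar.
apply: (@product_measure_unique _ _ _ _ _ (radial n) S m') => // A E mA mE.
exact: leb_borel_rectangle.
Qed.

(** The image of Lebesgue measure under [polar_map] is the product measure, and g(x) is a function
    of [polar_map x] at every point, including the origin; Tonelli's theorem concludes. The inner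
    integral may run over the whole space because [surf_borel] is carried by the sphere. *)
Lemma polar (g : VB -> \bar R) :
  measurable_fun setT g -> (forall x, 0 <= g x)%E ->
  (\int[L]_x g x =
   \int[m]_r ((\int[S]_y g (r *: (y : V))) * (radial_density n r)%:E))%E.
Proof.
move=> mg g0.
pose G (z : measurableTypeR R * VB) := g (z.1 *: (z.2 : V)).
have mG : measurable_fun setT G.
  apply: (measurableT_comp mg).
  by apply: measurable_scale; [exact: measurable_fst|exact: measurable_snd].
have G0 z : (0 <= G z)%E by exact: g0.
transitivity (\int[L]_(x in polar_map @^-1` setT) (G \o polar_map) x)%E.
  rewrite preimage_setT; apply: eq_integral => x _.
  by rewrite /G/= scale_direction.
rewrite -(ge0_integral_pushforward measurable_polar L measurableT mG (in1W G0)).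
transitivity (\int[(radial n \x S)%E]_z G z)%E.
  apply: eq_measure_integral => [|? A mA _]; first exact: measurable_polar.
  exact/esym/polar_measure.
rewrite fubini_tonelli1//.
rewrite integral_radial//.
- exact: (measurable_fun_fubini_tonelli_F G).
- by move=> r; exact: integral_ge0.
Qed.

End polar_coordinates.

(** * Complex-valued functions: modulus and measurability *)

Section complex_modulus.
Context (R : realType).
Implicit Types z : R[i].

Lemma Re_le_normc z : `|complex.Re z| <= normc z.
Proof.
case: z => a b /=; rewrite -sqrtr_sqr ler_sqrt ?addr_ge0 ?sqr_ge0//.
by rewrite lerDl sqr_ge0.
Qed.

Lemma Im_le_normc z : `|complex.Im z| <= normc z.
Proof.
case: z => a b /=; rewrite -sqrtr_sqr ler_sqrt ?addr_ge0 ?sqr_ge0//.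
by rewrite lerDr sqr_ge0.
Qed.

Lemma normc_ge0 z : 0 <= normc z.
Proof. by case: z => a b; exact: sqrtr_ge0. Qed.

Lemma normc_le_ReIm z : normc z <= `|complex.Re z| + `|complex.Im z|.
Proof.
have s0 : 0 <= `|complex.Re z| + `|complex.Im z| by rewrite addr_ge0.
rewrite -(ler_sqr (normc_ge0 z) s0); case: z {s0} => a b /=.
rewrite sqr_sqrtr ?addr_ge0 ?sqr_ge0//.
rewrite -(real_normK (num_real a)) -(real_normK (num_real b)).
have := normr_ge0 a; have := normr_ge0 b; nra.
Qed.

End complex_modulus.

Section measurable_complex.
Context d (T : measurableType d) (R : realType).
Implicit Types f g : T -> R[i].

Definition measurable_complex f : Prop :=
  measurable_fun setT (fun x => complex.Re (f x)) /\
  measurable_fun setT (fun x => complex.Im (f x)).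

Lemma measurable_complexM f g : measurable_complex f -> measurable_complex g ->
  measurable_complex (fun x => f x * g x).
Proof.
move=> [f1 f2] [g1 g2]; split.
- rewrite (_ : (fun x => _) = (fun x => complex.Re (f x) * complex.Re (g x) -
      complex.Im (f x) * complex.Im (g x))).
    by apply: measurable_funB; exact: measurable_funM.
  by apply/funext => x; case: (f x); case: (g x).
- rewrite (_ : (fun x => _) = (fun x => complex.Re (f x) * complex.Im (g x) +
      complex.Im (f x) * complex.Re (g x))).
    by apply: measurable_funD; exact: measurable_funM.
  by apply/funext => x; case: (f x); case: (g x).
Qed.

Lemma measurable_complexB f g : measurable_complex f -> measurable_complex g ->
  measurable_complex (fun x => f x - g x).
Proof.
move=> [f1 f2] [g1 g2]; split.
- rewrite (_ : (fun x => _) = (fun x => complex.Re (f x) - complex.Re (g x))).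
    exact: measurable_funB.
  by apply/funext => x; case: (f x); case: (g x).
- rewrite (_ : (fun x => _) = (fun x => complex.Im (f x) - complex.Im (g x))).
    exact: measurable_funB.
  by apply/funext => x; case: (f x); case: (g x).
Qed.

Lemma measurable_normc f : measurable_complex f ->
  measurable_fun setT (fun x => normc (f x)).
Proof.
move=> [f1 f2].
rewrite (_ : (fun x => _) = Num.sqrt \o
    (fun x => complex.Re (f x) ^+ 2 + complex.Im (f x) ^+ 2)); last first.
  by apply/funext => x /=; case: (f x).
apply: measurableT_comp.
  by apply: continuous_measurable_fun; exact: sqrt_continuous.
by apply: measurable_funD; exact: measurable_funX.
Qed.

End measurable_complex.

Lemma measurable_complex_comp d d' (T : measurableType d) (T' : measurableType d')
    (R : realType) (f : T' -> R[i]) (h : T -> T') :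
  measurable_complex f -> measurable_fun setT h ->
  measurable_complex (fun x => f (h x)).
Proof.
by move=> [f1 f2] mh; split; [exact: (measurableT_comp f1 mh)|
  exact: (measurableT_comp f2 mh)].
Qed.

(** * Borel versions of complex-valued functions *)

Section complex_borel_version.
Context (R : realType) (T : pointedType).
Variables (mu : {outer_measure set T -> \bar R}) (G : set (set T)).
Local Notation B := (g_sigma_algebraType G).
Local Notation C := (caratheodory_type mu).
Variable nu : {measure set B -> \bar R}.
Local Notation muC := (mu : {measure set C -> \bar R}).
Hypothesis GC : G `<=` (@measurable _ C).
Hypothesis nuE : forall A : set B, measurable A -> nu A = mu A.
Implicit Types f g : T -> R[i].

Lemma complex_measurable_ae (D : set B) f g : measurable D ->
  {ae nu, forall x, D x -> f x = g x} -> measurable_complex (g : B -> R[i]) ->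
  complex_measurable muC D f.
Proof.
move=> mD fg [g1 g2]; split.
- apply: (measurable_fun_ae_cara GC nuE mD _ (measurable_funTS g1)).
  by apply: aeS fg => x /[apply] ->.
- apply: (measurable_fun_ae_cara GC nuE mD _ (measurable_funTS g2)).
  by apply: aeS fg => x /[apply] ->.
Qed.

Lemma complex_integral_ae (D : set B) f g : measurable D ->
  {ae nu, forall x, D x -> f x = g x} -> measurable_complex (g : B -> R[i]) ->
  complex_integral muC D f = complex_integral nu D g.
Proof.
move=> mD fg [g1 g2]; rewrite /complex_integral/=; congr Complex; rewrite /Rintegral.
- congr fine; apply: (integral_ae_cara GC nuE mD _ (measurable_funTS g1)).
  by apply: aeS fg => x /[apply] ->.
- congr fine; apply: (integral_ae_cara GC nuE mD _ (measurable_funTS g2)).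
  by apply: aeS fg => x /[apply] ->.
Qed.

Lemma integral_normc_ae (D : set B) f g : measurable D ->
  {ae nu, forall x, D x -> f x = g x} -> measurable_complex (g : B -> R[i]) ->
  (\int[muC]_(x in D) (normc (f x))%:E = \int[nu]_(x in D) (normc (g x))%:E)%E.
Proof.
move=> mD fg mg.
apply: (integral_ae_cara GC nuE mD _ (measurable_funTS (measurable_normc mg))).
by apply: aeS fg => x /[apply] ->.
Qed.

Hypothesis mu_regular : forall A : set T,
  exists E : set B, [/\ measurable E, A `<=` E & mu E = mu A].
Hypothesis mu_sigma_finite : exists Q : nat -> set B,
  [/\ forall k, measurable (Q k), \bigcup_k Q k = setT &
      forall k, (mu (Q k) < +oo)%E].

Lemma cara_borel_complex (D : set B) f : measurable D ->
  complex_measurable muC D f ->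
  exists2 g : B -> R[i], measurable_complex g &
    {ae nu, forall x, D x -> f x = g x}.
Proof.
move=> mD [f1 f2]; have mCD := borel_sub_cara GC mD.
have [g1 mg1 fg1] := cara_borel_fun GC nuE mu_regular mu_sigma_finite
  ((measurable_restrictT _ mCD).1 f1).
have [g2 mg2 fg2] := cara_borel_fun GC nuE mu_regular mu_sigma_finite
  ((measurable_restrictT _ mCD).1 f2).
exists (fun x => Complex (g1 x) (g2 x)) => //.
apply: aeS (aeI fg1 fg2) => x [E1 E2] Dx.
move: E1 E2; rewrite !patchE mem_set// => <- <-.
by case: (f x).
Qed.

End complex_borel_version.

(** * Borel hulls for the surface measure *)

Section surface_regular.
Context (R : realType) (n : nat) (n_gt0 : (0 < n)%N).
Local Notation m := (@lebesgue_measure R).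
Local Notation V := 'rV[R]_n.
Local Notation VB := (rowBorel R n).
Local Notation L := (@leb_borel R n).
Local Notation S := (@surf_borel R n).

Lemma le_surf_borel (A B : set VB) : A `<=` B -> (S A <= S B)%E.
Proof. exact: (@le_outer_measure R _ (@surface_outer R n)). Qed.

Lemma measurable_scale_preimage (A : set VB) (r : R) : measurable A ->
  measurable ([set y : V | A (r *: y)] : set VB).
Proof.
move=> mA; have ms : measurable_fun setT ((fun y => r *: (y : V)) : VB -> VB).
  by apply: (measurable_scale (a := cst r)).
by rewrite -[X in measurable X]setTI; exact: ms.
Qed.

Lemma polar_set (A : set VB) : measurable A ->
  (L A = \int[m]_r (S [set y : V | A (r *: y)] * (radial_density n r)%:E))%E.
Proof.
move=> mA; have := @integral_indic _ VB R L setT measurableT A mA.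
rewrite setIT => <-.
rewrite (polar n_gt0)//; last by apply/measurable_EFinP; exact: measurable_indic.
apply: eq_integral => r _; congr (_ * _)%E.
have := @integral_indic _ VB R S setT measurableT _ (measurable_scale_preimage r mA).
by rewrite setIT => <-.
Qed.

Lemma measurable_sections (A : set VB) : measurable A ->
  measurable_fun setT (fun r : R => S [set y : V | A (r *: y)]).
Proof.
move=> mA.
pose Z : set (R * VB) := [set z | A (z.1 *: (z.2 : V))].
have mZ : measurable Z.
  rewrite -[Z]setTI.
  apply: (measurable_scale (T := (R * VB)%type) (a := fst) (f := snd)) => //.
have := measurable_fun_xsection S mZ.
rewrite (_ : _ \o _ = fun r : R => S [set y : V | A (r *: y)])//.
apply/funext => r /=; congr S; apply/seteqP; split => y; by rewrite /xsection/= inE.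
Qed.

(** Let [G] be a Borel hull of the cone over [A] and f(r) the surface measure of the slice of [G] at
    radius r. Each slice with 0 < r <= 1 contains the part of [A] on the sphere, so f(r) >= s, the
    outer measure of [A]. But the integral of f(r) r^(n-1) over (0, 1] is at most that of the
    constant s, namely s / n, the measure of [G]. Hence f = s almost everywhere, and some slice is a
    hull. *)
Lemma surface_outer_regular (A : set V) :
  exists E : set VB, [/\ measurable E, A `<=` E &
    surface_outer E = surface_outer A].
Proof.
have [G [mG AG GA]] := leb_outer_regular (unit_cone A).
pose D : set VB := [set x | 0 < enorm x <= 1].
have mD : measurable D.
  rewrite (_ : D = setT `&` (@enorm R n : VB -> R) @^-1` `]0, 1]%classic).
    exact: measurable_enorm.
  by rewrite setTI; apply/seteqP; split => x /=; rewrite in_itv.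
pose f r := S [set y : V | G (r *: y)].
pose s := surface_outer A.
have sfin : s \is a fin_num.
  by rewrite ge0_fin_numE ?surface_outer_lty// outer_measure_ge0.
have sf r : 0 < r <= 1 -> (s <= f r)%E.
  move=> r01; apply: (@le_trans _ _ (surface_outer (A `&` @esphere R n))).
    rewrite /s /surface_outer lee_wpmul2l// le_outer_measure// => x.
    by move=> [t [y [t01 Ay Sy ->]]]; exists t, y.
  apply: le_outer_measure => y [Ay Sy] /=; apply: AG.
  by exists r, y.
have mS0 (B : set VB) : measurable B -> S (B `&` @esphere R n) = S B.
  move=> mB; apply/eqP; rewrite eq_le; apply/andP; split.
    by apply: le_outer_measure; exact: subIsetl.
  apply: (@le_trans _ _ (S ((B `&` @esphere R n) `|` ~` @esphere R n))).
    apply: le_outer_measure => x Bx.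
    by have [Sx|nSx] := pselect (esphere x); [left|right].
  apply: le_trans (outer_measureU2 _ _ _) _.
  rewrite [X in (_ + X)%E](_ : _ = 0%E) ?adde0//; exact: surf_borel_compl_sphere.
suff [r r01 fr] : exists2 r, 0 < r <= 1 & f r = s.
  (* The slice covers only the part of [A] on the sphere; the complement of the sphere, of surface
     measure 0, covers the rest. *)
  exists ([set y : V | G (r *: y)] `|` ~` @esphere R n); split.
  - apply: measurableU; first exact: measurable_scale_preimage.
    by apply: measurableC; exact: measurable_esphere.
  - move=> y Ay; have [Sy|nSy] := pselect (esphere y); last by right.
    by left; apply: AG; exists r, y.
  - rewrite -/s -fr; apply/eqP; rewrite eq_le; apply/andP; split; last first.
      by apply: le_outer_measure; exact: subsetUl.
    apply: le_trans (outer_measureU2 _ _ _) _.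
    rewrite [X in (_ + X)%E](_ : _ = 0%E) ?adde0//.
    exact: surf_borel_compl_sphere.
have mdens : measurable_fun setT (fun r : R => (radial_density n r)%:E).
  by apply/measurable_EFinP; exact: measurable_radial_density.
have mf : measurable_fun setT f by exact: measurable_sections.
(* Proved by adding the integral of the constant s, which is finite and can be cancelled, so that
   all integrands stay nonnegative. *)
have itv0 : (\int[m]_(r in `]0%R, 1%R]) ((f r - s) * (radial_density n r)%:E) = 0)%E.
  have d0 r : (0 <= (radial_density n r)%:E)%E by rewrite lee_fin radial_density_ge0.
  have Ds : (\int[m]_(r in `]0%R, 1%R]) (s * (radial_density n r)%:E) = leb_outer (unit_cone A))%E.
    rewrite ge0_integralZl//; last 2 first.
    - exact: measurable_funTS.
    - exact: outer_measure_ge0.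
    rewrite (_ : \int[m]_(r in `]0%R, 1%R]) (radial_density n r)%:E = n%:R^-1%:E)%E; last first.
      have := @radial_itvNyc R n 1 n_gt0 ltr01; rewrite expr1n mul1r => <-.
      rewrite /radial (_ : `]-oo, 1]%classic = `]-oo, 0] `|` `]0, 1])%classic; last first.
        apply/seteqP; split => r /=; rewrite !in_itv/=.
          by move=> rb; case: (leP r 0); [left|right].
        by case=> [r0|/andP[]//]; rewrite (le_trans r0).
      rewrite ge0_integral_setU//=; last 2 first.
        exact: measurable_funTS.
        by apply/disj_setPLR => r /=; rewrite !in_itv/= => r0;
          rewrite ltNge r0.
      by have := @radial_itvNyc0 R n _ (lexx 0); rewrite /radial => ->; rewrite add0e.
    rewrite /s /surface_outer muleAC -EFinM divff ?mul1e//.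
    by rewrite pnatr_eq0 -lt0n.
  have fs0 r : `]0, 1]%classic r -> (0 <= f r - s)%E.
    by rewrite /= in_itv/= => r01; rewrite sube_ge0 ?sfin ?orbT// sf.
  have Dfin : (\int[m]_(r in `]0%R, 1%R]) (s * (radial_density n r)%:E) \is a fin_num)%E.
    rewrite Ds ge0_fin_numE ?outer_measure_ge0//.
    apply: (@le_lt_trans _ _ (leb_outer (box (const_mx (-1), const_mx 1 : V)))).
      apply: le_outer_measure => x; rewrite unit_coneE => -[/andP[_ x1] _] i.
      by rewrite /= !mxE -ler_norml (le_trans (coord_le_enorm _ _)).
    by apply: le_lt_trans (leb_outer_box _) _; exact: ltry.
  have Dsum : (\int[m]_(r in `]0%R, 1%R]) ((f r - s) * (radial_density n r)%:E)
      + \int[m]_(r in `]0%R, 1%R]) (s * (radial_density n r)%:E)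
      <= leb_outer (unit_cone A))%E.
    rewrite -ge0_integralD//; last 4 first.
    - by move=> r r01; rewrite mule_ge0// fs0.
    - apply: measurable_funTS; apply: emeasurable_funM => //.
      by apply: emeasurable_funB.
    - by move=> r _; rewrite mule_ge0// outer_measure_ge0.
    - by apply: measurable_funTS; exact: emeasurable_funM.
    apply: (@le_trans _ _ (\int[m]_(r in `]0%R, 1%R]) (f r * (radial_density n r)%:E))%E).
      apply: ge0_le_integral => //.
      - by move=> r r01; rewrite adde_ge0// mule_ge0// ?fs0// outer_measure_ge0.
      - apply: measurable_funTS; apply: emeasurable_funD.
          by apply: emeasurable_funM => //; apply: emeasurable_funB.
        exact: emeasurable_funM.
      - by apply: measurable_funTS; exact: emeasurable_funM.
      - move=> r r01; rewrite -ge0_muleDl ?fs0 ?outer_measure_ge0//.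
        by rewrite subeK.
    (* Cutting [G] by the punctured unit ball [D] leaves, for 0 < r <= 1, the same slices up to
       points off the sphere. *)
    rewrite -GA; apply: (@le_trans _ _ (L (G `&` D))); last first.
      by apply: le_outer_measure; exact: subIsetl.
    rewrite polar_set//; last exact: measurableI.
    rewrite integral_mkcond; apply: ge0_le_integral => //.
    - by move=> r _; rewrite patchE; case: ifPn => // _; rewrite mule_ge0// surf_borel_ge0.
    - apply/(measurable_restrictT _ (measurable_itv _)); apply: measurable_funTS.
      exact: emeasurable_funM.
    - apply: emeasurable_funM => //; apply: measurable_sections; exact: measurableI.
    - move=> r _; rewrite patchE; case: ifPn => [|_]; last first.
        by rewrite mule_ge0// surf_borel_ge0.
      rewrite inE/= in_itv/= => /andP[r0 r1].
      apply: lee_wpmul2r; first exact: d0.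
      apply: (@le_trans _ _ (S ([set y : V | G (r *: y)] `&` @esphere R n))).
        by rewrite mS0//; exact: measurable_scale_preimage.
      apply: le_surf_borel => y [Gy Sy] /=; split => //.
      by rewrite /D/= enormZ (Sy : enorm y = 1) mulr1 gtr0_norm// r0.
  apply/eqP; rewrite eq_le; apply/andP; split; last first.
    by apply: integral_ge0 => r r01; rewrite mule_ge0// fs0.
  by rewrite -(leeD2rE _ _ Dfin) add0e [X in (_ <= X)%E]Ds; exact: Dsum.
have : ae_eq m `]0, 1]%classic (fun r => (f r - s) * (radial_density n r)%:E)%E (cst 0%E).
  apply/ae_eq_integral_abs => //.
    apply: measurable_funTS; apply: emeasurable_funM => //.
    by apply: emeasurable_funB.
  rewrite -[RHS]itv0; apply: eq_integral => r; rewrite inE/= in_itv/= => r01.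
  rewrite gee0_abs// mule_ge0//; first by rewrite sube_ge0 ?sfin ?orbT// sf.
  by rewrite lee_fin radial_density_ge0.
move=> [N [mN N0 subN]].
have [r [r01 Nr]] : exists r, `]0, 1]%classic r /\ ~ N r.
  apply: contrapT => nor.
  have : (m `]0%R, 1%R]%classic <= m N)%E.
    apply: le_measure; [by rewrite inE; apply: measurable_itv|by rewrite inE|].
    by move=> r r01; apply: contrapT => Nr; apply: nor; exists r.
  by rewrite N0 lebesgue_measure_itv/= lte01 oppr0 adde0 lee_fin ler10.
have {}r01' : 0 < r <= 1 by move: r01; rewrite /= in_itv.
exists r => //; apply: contrapT => frs; apply/Nr/subN => /= /(_ r01) /eqP.
rewrite mule_eq0 => /orP[|]; last first.
  case/andP: r01' => r0 _; rewrite eqe radial_densityE// expf_eq0.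
  by rewrite (gt_eqF r0) andbF.
move=> /eqP /(congr1 (fun z => z + s)%E); rewrite subeK// add0e.
exact: frs.
Qed.

Lemma surface_outer_sigma_finite : exists Q : nat -> set VB,
  [/\ forall k, measurable (Q k), \bigcup_k Q k = setT &
      forall k, (surface_outer (Q k) < +oo)%E].
Proof.
exists (fun=> setT); split => //; first by rewrite bigcup_const//; exists 0.
by move=> _; exact: surface_outer_lty.
Qed.

End surface_regular.

(** * Null sets and their sections *)

Section almost_everywhere.
Context (R : realType).
Local Open Scope ereal_scope.

Lemma ae_integral0 d (T : measurableType d) (mu : {measure set T -> \bar R})
    (f : T -> \bar R) : measurable_fun setT f -> (forall x, 0 <= f x) ->
  \int[mu]_x f x = 0 -> {ae mu, forall x, f x = 0}.
Proof.
move=> mf f0 if0.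
have : ae_eq mu setT f (cst 0).
  apply/ae_eq_integral_abs => //; rewrite -[RHS]if0.
  by apply: eq_integral => x _; rewrite gee0_abs.
by apply: aeS => x; exact.
Qed.

(** Tonelli's theorem for the indicator of [Z]; it serves to exchange the two variables in almost
    everywhere statements. *)
Lemma ae_sections d1 d2 (T1 : measurableType d1) (T2 : measurableType d2)
    (m1 : {sigma_finite_measure set T1 -> \bar R})
    (m2 : {sigma_finite_measure set T2 -> \bar R}) (Z : set (T1 * T2)) :
  measurable Z -> (forall t, m1 [set x | Z (x, t)] = 0) ->
  {ae m1, forall x, m2 [set t | Z (x, t)] = 0}.
Proof.
move=> mZ Z0.
have mZ1 x : measurable [set t | Z (x, t)].
  by have := measurable_xsection x mZ; rewrite /xsection; under eq_set do rewrite inE.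
have mZ2 t : measurable [set x | Z (x, t)].
  by have := measurable_ysection t mZ; rewrite /ysection; under eq_set do rewrite inE.
pose f (z : T1 * T2) : \bar R := (\1_Z z)%:E.
have mf : measurable_fun setT f by apply/measurable_EFinP; exact: measurable_indic.
have f0 z : 0 <= f z by rewrite lee_fin.
have E := fubini_tonelli (m1 := m1) (m2 := m2) f mf f0.
have E1 x : \int[m2]_t f (x, t) = m2 [set t | Z (x, t)].
  have := @integral_indic _ T2 R m2 setT measurableT _ (mZ1 x); rewrite setIT => <-.
  apply: eq_integral => t _; rewrite /f !indicE.
  by have -> : ((x, t) \in Z) = (t \in [set t | Z (x, t)]) by apply/idP/idP; rewrite !inE.
have E2 t : \int[m1]_x f (x, t) = 0.
  rewrite -(Z0 t).
  have := @integral_indic _ T1 R m1 setT measurableT _ (mZ2 t); rewrite setIT => <-.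
  apply: eq_integral => x _; rewrite /f !indicE.
  by have -> : ((x, t) \in Z) = (x \in [set x | Z (x, t)]) by apply/idP/idP; rewrite !inE.
have : {ae m1, forall x, \int[m2]_t f (x, t) = 0}.
  apply: ae_integral0.
  - exact: (measurable_fun_fubini_tonelli_F f).
  - by move=> x; exact: integral_ge0.
  - by rewrite E; apply: integral0_eq => t _.
by apply: aeS => x; rewrite E1.
Qed.

End almost_everywhere.

(** * Almost everywhere statements in polar coordinates *)

Section polar_almost_everywhere.
Context (R : realType) (n : nat) (n_gt0 : (0 < n)%N).
Local Notation m := (@lebesgue_measure R).
Local Notation V := 'rV[R]_n.
Local Notation VB := (rowBorel R n).
Local Notation L := (@leb_borel R n).
Local Notation S := (@surf_borel R n).

Lemma ae_nonzero : {ae L, forall x, x != 0}.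
Proof.
exists [set 0]; split.
- rewrite (_ : [set 0] = setT `&` (@enorm R n : VB -> R) @^-1` [set 0]).
    exact: measurable_enorm.
  rewrite setTI; apply/seteqP; split => [_ ->|x /enorm_eq0 //].
  exact: enorm0.
- exact: leb_borel_point0.
- by move=> x /= /negP; rewrite negbK => /eqP.
Qed.

Lemma ae_sphere : {ae S, forall y, esphere y}.
Proof.
exists (~` @esphere R n); split => //.
- by apply: measurableC; exact: measurable_esphere.
- exact: surf_borel_compl_sphere.
Qed.

(** In polar coordinates a null set gives a nonnegative radial integral equal to 0, so its slices
    are null for almost every r, the density r^(n-1) being nonzero for r > 0. *)
Lemma ae_polar (P : V -> Prop) : {ae L, forall x, P x} ->
  {ae m, forall r, 0 < r -> {ae S, forall y, P (r *: y)}}.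
Proof.
move=> [N [mN N0 PN]].
have [|||M [mM M0 subM]] := ae_integral0 (mu := m)
    (f := fun r => (S [set y : V | N (r *: y)] * (radial_density n r)%:E)%E).
- apply: emeasurable_funM; first exact: measurable_sections.
  by apply/measurable_EFinP; exact: measurable_radial_density.
- by move=> r; rewrite mule_ge0 ?surf_borel_ge0// lee_fin radial_density_ge0.
- by rewrite -polar_set.
exists M; split => //; apply: subset_trans subM => r /= nP /eqP.
rewrite mule_eq0 => E; apply: nP => r0; exists [set y : V | N (r *: y)]; split.
- exact: measurable_scale_preimage.
- move: E; rewrite eqe radial_densityE// expf_eq0 (gt_eqF r0) andbF orbF.
  by move/eqP.
- by move=> y /= ?; exact: PN.
Qed.

(** The rectangle formula with all radii allowed: the infinite radial mass is multiplied by 0. *)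
Lemma ae_direction (P : V -> Prop) : {ae S, forall y, P y} ->
  {ae L, forall x, P (direction x)}.
Proof.
move=> [N [mN N0 PN]]; exists (@direction R n @^-1` N); split.
- by rewrite -[X in measurable X]setTI; exact: measurable_direction.
- have := leb_borel_rectangle n_gt0 measurableT mN.
  rewrite [X in (_ * X)%E](N0) mule0 => <-; congr leb_borel.
  by apply/seteqP; split => x //= [].
- by move=> x /= ?; exact: PN.
Qed.

Lemma ae_enorm (P : R -> Prop) : {ae m, forall r, 0 < r -> P r} ->
  {ae L, forall x, P (enorm x)}.
Proof.
move=> [N [mN N0 PN]].
have : {ae L, forall x, ~ N (enorm x)}.
  exists ((@enorm R n : VB -> measurableTypeR R) @^-1` N); split.
  - by rewrite -[X in measurable X]setTI; exact: measurable_enorm.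
  - have := leb_borel_rectangle n_gt0 mN measurableT.
    rewrite (_ : radial n N = 0%E) ?mul0e; last first.
      apply: null_set_integral => //.
        by apply/measurable_funTS/measurable_EFinP; exact: measurable_radial_density.
    by move=> <-; congr leb_borel; apply/seteqP; split => x //= [].
  - by move=> x /= /contrapT.
move=> NE; apply: aeS (aeI NE ae_nonzero) => x [Nx x0].
apply: contrapT => Px; apply/Nx/PN => /= H; apply/Px/H.
rewrite lt_neqAle enorm_ge0 andbT eq_sym.
by apply: contra x0 => /eqP/enorm_eq0 ->.
Qed.

Lemma ae_scale (P : V -> Prop) t : 0 < t -> {ae L, forall x, P x} ->
  {ae L, forall x, P (t *: x)}.
Proof.
move=> t0 [N [mN N0 PN]]; exists [set x : V | N (t *: x)]; split.
- exact: measurable_scale_preimage.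
- have ti0 : 0 < t^-1 by rewrite invr_gt0.
  have := leb_outer_scale N ti0; rewrite invrK.
  by rewrite [X in (_ * X)%E](N0 : leb_outer N = 0%E) mule0.
- by move=> x /= ?; exact: PN.
Qed.

(** For each fixed t > 0 the dilation by 1 / t preserves null sets, so the bad x form a null set;
    [ae_sections] then exchanges x and t. *)
Lemma ae_quotient (P : R -> Prop) : {ae m, forall r, 0 < r -> P r} ->
  {ae L, forall x, {ae m, forall t, 0 < t -> P (enorm x / t)}}.
Proof.
move=> [N [mN N0 PN]].
(* Only positive radii are kept, so that t = 0, where the quotient takes the default value 0,
   contributes no bad point. *)
pose N' : set R := N `&` `]0, +oo[%classic.
have mN' : measurable N' by apply: measurableI => //; exact: measurable_itv.
have aeN' : {ae m, forall r, 0 < r -> ~ N' r}.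
  by exists N; split => // r /= /not_implyP[_ /contrapT[]].
(* [ae_sections] asks for null sections at every t. The absolute value makes the factor positive for
   all nonzero t and agrees with division for t > 0. *)
pose Z : set (VB * measurableTypeR R) := [set z | N' (enorm z.1 * `|z.2^-1|)].
have mZ : measurable Z.
  rewrite -[Z]setTI.
  have mq : measurable_fun setT
      (fun z : VB * measurableTypeR R => enorm z.1 * `|z.2^-1| : R).
    apply: measurable_funM.
      exact: (measurableT_comp (@measurable_enorm R n) measurable_fst).
    apply: measurableT_comp => //.
    exact: (measurableT_comp (@measurable_inv R) measurable_snd).
  exact: mq.
have Z0 t : L [set x | Z (x, t)] = 0%E.
  rewrite /Z/=; have [t0|t0] := eqVneq t 0.
    rewrite (_ : [set x | _] = set0) ?measure0// -subset0 => x /= [_].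
    by rewrite t0 invr0 normr0 mulr0 /= in_itv/= ltxx.
  have ti0 : 0 < `|t^-1| by rewrite normr_gt0 invr_eq0.
  have [M [mM M0 subM]] := ae_scale ti0 (ae_enorm aeN').
  apply/eqP; rewrite eq_le measure_ge0 andbT -M0.
  apply: le_outer_measure => x /= Nx; apply: subM => /=.
  by rewrite enormZ normr_id mulrC => /(_ Nx).
have ae1 := @ae_sections R _ _ VB (measurableTypeR R) L m Z mZ Z0.
 apply: aeS (aeI ae1 ae_nonzero) => x [Zx x0].
exists [set t | Z (x, t)]; split => //.
  by have := measurable_xsection x mZ; rewrite /xsection; under eq_set do rewrite inE.
move=> t /= /not_implyP[t0 nP]; rewrite /Z/= ger0_norm ?invr_ge0 ?ltW//.
have xt0 : 0 < enorm x / t.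
  rewrite divr_gt0// lt_neqAle enorm_ge0 andbT eq_sym.
  by apply: contra x0 => /eqP/enorm_eq0 ->.
split; last by rewrite /= in_itv/= xt0.
by apply: PN => /= /(_ xt0).
Qed.

End polar_almost_everywhere.

(** * Power inequalities *)

Section weighted_jensen.
Context (R : realType).
Local Open Scope ereal_scope.

(** Either g <= c, or g = g^(1-p) g^p <= c^(1-p) g^p because the exponent 1 - p is nonpositive. *)
Lemma le_young_power (p c : R) (g : \bar R) : (1 <= p)%R -> (0 < c)%R -> 0 <= g ->
  g <= (c `^ (1 - p))%:E * g `^ p + c%:E.
Proof.
move=> p1 c0; have p0 : (0 < p)%R by exact: lt_le_trans p1.
case: g => [g||]//; last first.
  by rewrite poweRyr ?gt_eqF// gt0_muley ?lte_fin ?powR_gt0// addye.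
rewrite !lee_fin => g0.
have [gc|cg] := leP g c.
  by rewrite -[leLHS]add0r lerD// mulr_ge0// powR_ge0.
rewrite -[leLHS]addr0 lerD ?(ltW c0)//.
rewrite -(mulr_powRB1 g0 p0) mulrCA -[leLHS]mulr1 ler_wpM2l//.
rewrite -opprB powRN mulrC ler_pdivlMr ?powR_gt0// mul1r.
by apply: ge0_ler_powR; rewrite ?nnegrE ?subr_ge0// ltW.
Qed.

(* Young's inequality with a free parameter c, optimized at the end, replaces
   Hoelder's inequality; it costs the factor 2 `^ p. *)
Lemma weighted_jensen d (T : measurableType d) (mu : {measure set T -> \bar R})
    (W : T -> R) (g : T -> \bar R) (p X : R) :
  (1 <= p)%R -> (0 < X)%R ->
  measurable_fun setT W -> (forall x, (0 <= W x)%R) ->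
  measurable_fun setT g -> (forall x, 0 <= g x) ->
  \int[mu]_x (W x)%:E <= X%:E ->
  (\int[mu]_x ((W x)%:E * g x)) `^ p <=
  (2 `^ p * X `^ (p - 1))%:E * \int[mu]_x ((W x)%:E * g x `^ p).
Proof.
move=> p1 X0 mW W0 mg g0 WX.
have p0 : (0 < p)%R by exact: lt_le_trans p1.
have mEW : measurable_fun setT (EFin \o W) by exact/measurable_EFinP.
have mgp : measurable_fun setT (fun x => g x `^ p).
  exact: (measurableT_comp (measurable_poweR _) mg).
have C0 : (0 < 2 `^ p * X `^ (p - 1))%R by rewrite mulr_gt0// powR_gt0.
set I := \int[mu]_x ((W x)%:E * g x).
set Y := \int[mu]_x ((W x)%:E * g x `^ p).
have I0 : 0 <= I by apply: integral_ge0 => x _; rewrite mule_ge0 ?lee_fin.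
have Y0 : 0 <= Y.
  by apply: integral_ge0 => x _; rewrite mule_ge0 ?lee_fin ?poweR_ge0.
have young c : (0 < c)%R -> I <= (c `^ (1 - p))%:E * Y + (c * X)%:E.
  move=> c0.
  apply: (@le_trans _ _ (\int[mu]_x ((c `^ (1 - p))%:E * ((W x)%:E * g x `^ p) +
      c%:E * (W x)%:E))).
    apply: ge0_le_integral => //.
    - by move=> x _; rewrite mule_ge0 ?lee_fin.
    - exact: emeasurable_funM.
    - apply: emeasurable_funD; apply: emeasurable_funM => //.
      exact: emeasurable_funM.
    - move=> x _; rewrite muleCA [X in _ + X]muleC -ge0_muleDr//; last 2 first.
        by rewrite mule_ge0 ?lee_fin ?powR_ge0 ?poweR_ge0.
        by rewrite lee_fin ltW.
      by apply: lee_wpmul2l; [rewrite lee_fin|exact: le_young_power].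
  rewrite ge0_integralD//; last 4 first.
  - by move=> x _; rewrite !mule_ge0 ?lee_fin ?powR_ge0 ?poweR_ge0.
  - by apply: emeasurable_funM => //; exact: emeasurable_funM.
  - by move=> x _; rewrite mule_ge0 ?lee_fin// ltW.
  - exact: emeasurable_funM.
  rewrite ge0_integralZl//; last 3 first.
  - exact: emeasurable_funM.
  - by move=> x _; rewrite mule_ge0 ?lee_fin ?poweR_ge0.
  - by rewrite lee_fin powR_ge0.
  rewrite ge0_integralZl//; last 2 first.
  - by move=> x _; rewrite lee_fin.
  - by rewrite lee_fin ltW.
  apply: leeD => //; rewrite EFinM; apply: lee_wpmul2l => //.
  by rewrite lee_fin ltW.
have [Yoo|Yoo] := eqVneq Y +oo; first by rewrite Yoo gt0_muley ?leey// lte_fin.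
have Yfin : Y \is a fin_num by rewrite ge0_fin_numE ?ltey.
(* No optimal [c] exists here, but the bound reduces to c X with [c] arbitrarily small, so the
   integral vanishes. *)
have [Y00|Yn0] := eqVneq Y 0.
  rewrite Y00 mule0; suff -> : I = 0 by rewrite poweR0r// gt_eqF.
  apply/eqP; rewrite eq_le I0 andbT; apply/lee_addgt0Pr => e e0.
  have := young (e / X)%R; rewrite divr_gt0// Y00 mule0 divfK ?gt_eqF//.
  exact.
pose y := fine Y; have YE : Y = y%:E by rewrite fineK.
have y0 : (0 < y)%R by rewrite fine_gt0// lt0e Yn0 Y0 ltey.
(* This value makes the two terms of the bound equal: c^(1-p) y = c X. *)
pose c := ((y / X) `^ p^-1)%R.
have c0 : (0 < c)%R by rewrite powR_gt0// divr_gt0.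
have cp : (c `^ p = y / X)%R.
  by rewrite -powRrM mulVf ?gt_eqF// powRr1// divr_ge0// ltW.
have cY : ((c `^ (1 - p)) * y = c * X)%R.
  rewrite powRB; last by apply/implyP => _; rewrite gt_eqF.
  rewrite powRr1 ?(ltW c0)// cp.
  by field; rewrite !gt_eqF.
have I2 : I <= (2 * (c * X))%:E.
  by apply: le_trans (young c c0) _; rewrite YE -EFinM cY -EFinD mulr2n mulrDl mul1r.
apply: (@le_trans _ _ ((2 * (c * X))%:E `^ p)).
  have cX0 : 0 <= (2 * (c * X))%:E by rewrite lee_fin !mulr_ge0// ltW.
  by apply: (gt0_ler_poweR (ltW p0)) => //; rewrite in_itv/= leey andbT.
have Xp : (X `^ p = X * X `^ (p - 1))%R by rewrite mulr_powRB1// ltW.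
have E : ((2 * (c * X)) `^ p = 2 `^ p * X `^ (p - 1) * y)%R.
  rewrite powRM ?mulr_ge0 ?ltW// powRM ?ltW// cp Xp.
  by field; rewrite gt_eqF.
by rewrite poweR_EFin YE -EFinM E.
Qed.

End weighted_jensen.

(** * Integrals of real powers near the origin *)

Section radial_power.
Context (R : realType).
Local Notation m := (@lebesgue_measure R).

Lemma integral_powR_segment (a e s : R) : 0 < a -> 0 < e -> e < s ->
  (\int[m]_(r in `[e, s]) (r `^ (a - 1))%:E = ((s `^ a - e `^ a) / a)%:E)%E.
Proof.
move=> a0 e0 es.
have an0 : a != 0 by rewrite gt_eqF.
have der (r : R) : 0 < r -> derivable (fun r : R => r `^ a) r 1.
  by move=> r0; apply: derivable_powR; rewrite in_itv/= r0.
have cpow b (r : R) : 0 < r -> {for r, continuous (fun r : R => r `^ b)}.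
  move=> r0; apply/differentiable_continuous/derivable1_diffP.
  by apply: derivable_powR; rewrite in_itv/= r0.
rewrite (@continuous_FTC2 _ _ (fun r => r `^ a * a^-1))//.
- by rewrite -EFinB -mulrBl.
- apply: continuous_in_subspaceT => r; rewrite inE/= in_itv/= => /andP[er _].
  by apply: cpow; exact: lt_le_trans er.
- split.
  + move=> r; rewrite in_itv/= => /andP[er _].
    by apply: derivableM => //; apply: der; exact: lt_trans er.
  + by apply: cvg_at_right_filter; apply: cvgMl; exact: cpow.
  + by apply: cvg_at_left_filter; apply: cvgMl; apply: cpow; exact: lt_trans es.
- move=> r; rewrite in_itv/= => /andP[er _].
  have r0 : 0 < r by exact: lt_trans er.
  rewrite derive1Mr; last exact: der.
  rewrite powR_derive1 ?in_itv/= ?r0//.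
  by rewrite mulrC mulrA mulVf// mul1r.
Qed.

(** For a < 1 the power is unbounded at 0. The fundamental theorem is therefore applied on the
    segments [s / (k + 2), s], where the shift by 2 keeps the left end below s; monotone convergence
    gives the limit, and the contribution of the left end tends to 0 because a > 0. *)
Lemma integral_powR_ball (a s : R) : 0 < a -> 0 < s ->
  (\int[m]_(r in `]0%R, s[) (r `^ (a - 1))%:E = (s `^ a / a)%:E)%E.
Proof.
move=> a0 s0.
have mp : measurable_fun setT (fun r : R => (r `^ (a - 1))%:E).
  by apply/measurable_EFinP; exact: measurable_powR.
pose e (k : nat) : R := s / k.+2%:R.
have e0 k : 0 < e k by rewrite divr_gt0.
have es k : e k < s by rewrite ltr_pdivrMr// ltr_pMr// ltr1n.
have -> : (\int[m]_(r in `]0%R, s[) (r `^ (a - 1))%:E =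
    \int[m]_(r in `]0%R, s]) (r `^ (a - 1))%:E)%E.
  apply: integral_itv_bndo_bndc; exact: measurable_funTS.
have bigE : \bigcup_k `[e k, s]%classic = `]0, s]%classic.
  apply/seteqP; split => [r [k _]|r] /=; rewrite !in_itv/= => /andP[r1 r2].
    by rewrite r2 (lt_le_trans (e0 k)).
  exists (Num.trunc (s / r)) => //=; rewrite in_itv/= r2 andbT.
  rewrite ler_pdivrMr// -ler_pdivrMl// mulrC ltW//.
  apply: lt_le_trans (truncnS_gt _) _; by rewrite ler_nat.
have cv1 : (\int[m]_(r in `[e k, s]) (r `^ (a - 1))%:E @[k --> \oo] -->
    \int[m]_(r in `]0%R, s]) (r `^ (a - 1))%:E)%E.
  rewrite -bigE.
  apply: (@ge0_nondecreasing_set_cvg_integral _ (measurableTypeR R) R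
    (fun k => `[e k, s]%classic) (fun r => (r `^ (a - 1))%:E) m).
  - move=> i j ij; apply/subsetPset => r /=; rewrite !in_itv/= => /andP[ir ->].
    rewrite andbT (le_trans _ ir)// ler_pM2l// lef_pV2 ?posrE//.
    by rewrite ler_nat.
  - by move=> i; exact: measurable_itv.
  - by move=> i; exact: measurable_funTS.
  - by move=> i r _; rewrite lee_fin powR_ge0.
have cv2 : (\int[m]_(r in `[e k, s]) (r `^ (a - 1))%:E @[k --> \oo] -->
    (s `^ a / a)%:E)%E.
  under eq_fun do rewrite integral_powR_segment//.
  apply: cvg_EFin; first by near=> k.
  have -> : s `^ a / a = (s `^ a - 0) * a^-1 by rewrite subr0.
  apply: cvgMl; apply: cvgB; first exact: cvg_cst.
  apply: ((cvg_at_rightP _ _ _).1 (powR_cvg0 a0)); split => //.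
  rewrite -[X in _ --> X](mulr0 s); apply: cvgMr.
  by rewrite (cvg_shiftS (@harmonic R)); exact: cvg_harmonic.
by rewrite (cvg_unique _ cv1 cv2).
Unshelve. all: by end_near. Qed.

End radial_power.

(** * Homogeneous weights *)

Section radial_integrals.
Context (R : realType) (n : nat) (n_gt0 : (0 < n)%N).
Local Notation m := (@lebesgue_measure R).
Local Notation V := 'rV[R]_n.
Local Notation VB := (rowBorel R n).
Local Notation L := (@leb_borel R n).
Local Notation S := (@surf_borel R n).
Local Open Scope ereal_scope.

(** A ball becomes a factor depending on the norm only, which polar coordinates treat like any other
    radial function. *)
Definition below (s r : R) : \bar R := ((r < s)%R%:R)%:E.

Lemma below_ge0 s r : 0 <= below s r.
Proof. by rewrite lee_fin. Qed.

Lemma measurable_below s : measurable_fun setT (below s).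
Proof.
rewrite (_ : below s = EFin \o (\1_(`]-oo, s[%classic : set R))).
  apply/measurable_EFinP; apply: measurable_indic; exact: measurable_itv.
by apply/funext => r; rewrite /below/= indicE mem_setE in_itv.
Qed.

Lemma integral_eball (s : R) (F : VB -> \bar R) :
  \int[L]_(x in @eball R n s) F x = \int[L]_x (F x * below s (enorm x)).
Proof.
rewrite integral_mkcond; apply: eq_integral => x _; rewrite patchE /below.
case: ifPn => [|]; first by rewrite inE/= => ->; rewrite mule1.
by rewrite notin_setE => /negP/negbTE; rewrite /eball/= => ->; rewrite mule0.
Qed.

Lemma measurable_sphere_integral (h : VB -> \bar R) :
  measurable_fun setT h -> (forall x, 0 <= h x) ->
  measurable_fun setT (fun r : R => \int[S]_y h (r *: (y : V))).
Proof.
move=> mh h0.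
pose f (z : R * VB) := h (z.1 *: (z.2 : V)).
have mf : measurable_fun setT f.
  apply: (measurableT_comp mh).
  by apply: measurable_scale; [exact: measurable_fst|exact: measurable_snd].
exact: (@measurable_fun_fubini_tonelli_F _ _ R VB R S f mf (fun z => h0 _)).
Qed.

Lemma integral_scale (t : R) (h : VB -> \bar R) : (0 < t)%R ->
  measurable_fun setT h -> (forall x, 0 <= h x) ->
  \int[L]_x h (t^-1 *: (x : V)) = (t ^+ n)%:E * \int[L]_x h x.
Proof.
move=> t0 mh h0.
have tn0 : (0 <= t ^+ n)%R by rewrite exprn_ge0// ltW.
pose f (x : VB) : VB := t^-1 *: (x : V).
have mf : measurable_fun setT f by apply: (measurable_scale (a := cst t^-1%R)).
have <- := ge0_integral_mscale L measurableT (NngNum tn0) mh (fun x _ => h0 x).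
have E := ge0_integral_pushforward mf L measurableT mh (in1W h0).
rewrite preimage_setT in E; refine (eq_trans (esym E) _).
apply: eq_measure_integral => A mA _; exact: leb_outer_scale.
Qed.

Variable gamma : R.

Definition homogeneous (q : VB -> R) := forall (r : R) (y : V), (0 < r)%R ->
  enorm y = 1%R -> q (r *: y) = (r `^ gamma * q y)%R.

(** Separation of variables: on the sphere of radius r the weight is r^gamma times its values on the
    unit sphere. *)
Lemma integral_homogeneous_radial (q : VB -> R) (k : R -> \bar R) :
  measurable_fun setT q -> (forall x, (0 <= q x)%R) -> homogeneous q ->
  measurable_fun setT k -> (forall r, 0 <= k r) ->
  \int[L]_x ((q x)%:E * k (enorm x)) =
  (\int[S]_y (q y)%:E) *
    \int[m]_r ((r `^ gamma)%:E * k r * (radial_density n r)%:E).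
Proof.
move=> mq q0 hq mk k0.
have mEq : measurable_fun setT (EFin \o q) by exact/measurable_EFinP.
have mkn : measurable_fun setT (fun x : VB => k (enorm x)).
  exact: (measurableT_comp mk (@measurable_enorm R n)).
have d0 r : 0 <= (radial_density n r)%:E by rewrite lee_fin radial_density_ge0.
have md : measurable_fun setT (fun r : R => (radial_density n r)%:E).
  by apply/measurable_EFinP; exact: measurable_radial_density.
rewrite (polar n_gt0); last 2 first.
- exact: emeasurable_funM.
- by move=> x; rewrite mule_ge0 ?lee_fin.
rewrite -ge0_integralZl//; last 3 first.
- apply: emeasurable_funM => //; apply: emeasurable_funM => //.
  by apply/measurable_EFinP; exact: measurable_powR.
- by move=> r _; rewrite !mule_ge0 ?lee_fin ?powR_ge0 ?radial_density_ge0.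
- by apply: integral_ge0 => y _; rewrite lee_fin.
apply: eq_integral => r _; have [r0|r0] := leP r 0%R.
  by rewrite radial_density0// !mule0.
rewrite muleA; congr (_ * _); rewrite muleC -ge0_integralZl//; last 2 first.
- by move=> y _; rewrite lee_fin.
- by rewrite mule_ge0 ?lee_fin ?powR_ge0.
have mr : measurable_fun setT ((fun y => r *: (y : V)) : VB -> VB).
  exact: (measurable_scale (a := cst r)).
apply: ge0_ae_eq_integral => //.
- apply: emeasurable_funM.
    exact: (measurableT_comp mEq mr).
  exact: (measurableT_comp mkn mr).
- exact: emeasurable_funM.
- by move=> y _; rewrite mule_ge0 ?lee_fin.
- by move=> y _; rewrite !mule_ge0 ?lee_fin ?powR_ge0.
apply: aeS (@ae_sphere R n) => y Sy _.
rewrite hq// enormZ (Sy : enorm y = 1%R) mulr1 gtr0_norm// EFinM.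
by rewrite muleAC.
Qed.

Lemma integral_radial_mul (k : R -> \bar R) (h : VB -> \bar R) :
  measurable_fun setT k -> (forall r, 0 <= k r) ->
  measurable_fun setT h -> (forall x, 0 <= h x) ->
  \int[L]_x (k (enorm x) * h x) =
  \int[m]_r (k r * (\int[S]_y h (r *: (y : V))) * (radial_density n r)%:E).
Proof.
move=> mk k0 mh h0.
have mkn : measurable_fun setT (fun x : VB => k (enorm x)).
  exact: (measurableT_comp mk (@measurable_enorm R n)).
rewrite (polar n_gt0); last 2 first.
- exact: emeasurable_funM.
- by move=> x; rewrite mule_ge0.
apply: eq_integral => r _; have [r0|r0] := leP r 0%R.
  by rewrite radial_density0// !mule0.
congr (_ * _).
have mr : measurable_fun setT ((fun y => r *: (y : V)) : VB -> VB).
  exact: (measurable_scale (a := cst r)).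
have mhr : measurable_fun setT (fun y : VB => h (r *: (y : V))).
  exact: (measurableT_comp mh mr).
rewrite -ge0_integralZl//.
apply: ge0_ae_eq_integral => //.
- by apply: emeasurable_funM => //; exact: (measurableT_comp mkn mr).
- exact: emeasurable_funM.
- by move=> y _; rewrite mule_ge0.
- by move=> y _; rewrite mule_ge0.
apply: aeS (@ae_sphere R n) => y Sy _.
by rewrite enormZ (Sy : enorm y = 1%R) mulr1 gtr0_norm.
Qed.

(** The radial factor is r^gamma r^(n-1) = r^(n + gamma - 1), integrable at 0 exactly because n +
    gamma > 0. *)
Lemma integral_homogeneous_eball (q : VB -> R) (s : R) :
  measurable_fun setT q -> (forall x, (0 <= q x)%R) -> homogeneous q ->
  (0 < n%:R + gamma)%R -> (0 < s)%R ->
  \int[L]_(x in @eball R n s) (q x)%:E =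
  (\int[S]_y (q y)%:E) * (s `^ (n%:R + gamma) / (n%:R + gamma))%:E.
Proof.
move=> mq q0 hq a0 s0; rewrite integral_eball integral_homogeneous_radial//;
  [|exact: measurable_below|exact: below_ge0].
congr (_ * _); rewrite -(integral_powR_ball a0 s0) [RHS]integral_mkcond.
apply: eq_integral => r _; rewrite patchE /below.
have [r0|r0] := leP r 0%R.
  rewrite radial_density0// mule0 memNset//= in_itv/= => /andP[].
  by rewrite ltNge r0.
have [rs|rs] := ltP r s; last first.
  rewrite mule0 mul0e memNset//= in_itv/= => /andP[_].
  by rewrite ltNge rs.
rewrite mem_set/=; last by rewrite in_itv/= r0.
rewrite mule1 -EFinM radial_densityE// -powR_mulrn ?ltW// -powRD; last first.
  by apply/implyP => _; rewrite gt_eqF.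
congr (_ `^ _)%:E; rewrite -{2}(prednK n_gt0) -natr1; ring.
Qed.

(** The spherical integral depends on |x| only, so polar coordinates split off the mass of [q] on
    the sphere. The remaining radial integral is folded back into a Lebesgue integral of |x|^gamma
    h(x / t), and the substitution x -> t x produces t^n from the measure, t^gamma from the weight
    and the radius s / t. *)
Lemma integral_eball_sphere (q : VB -> R) (h : VB -> \bar R) (s t : R) :
  measurable_fun setT q -> (forall x, (0 <= q x)%R) -> homogeneous q ->
  measurable_fun setT h -> (forall x, 0 <= h x) -> (0 < t)%R ->
  \int[L]_(x in @eball R n s)
     ((q x)%:E * \int[S]_y h ((enorm x / t)%R *: (y : V))) =
  (\int[S]_y (q y)%:E) * ((t `^ (n%:R + gamma))%:E *
    \int[L]_(x in @eball R n (s / t)%R) ((enorm x `^ gamma)%:E * h x)).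
Proof.
move=> mq q0 hq mh h0 t0.
pose H (r : R) := \int[S]_y h (r *: (y : V)).
have mH : measurable_fun setT H by exact: measurable_sphere_integral.
have H0 r : 0 <= H r by exact: integral_ge0.
have mpow : measurable_fun setT (fun r : R => (r `^ gamma)%:E).
  by apply/measurable_EFinP; exact: measurable_powR.
pose k r := (r `^ gamma)%:E * below s r.
have mk : measurable_fun setT k.
  by apply: emeasurable_funM => //; exact: measurable_below.
have k0 r : 0 <= k r by rewrite mule_ge0 ?below_ge0 ?lee_fin ?powR_ge0.
have mHt : measurable_fun setT (fun r : R => H (r / t)%R).
  by apply: (measurableT_comp mH); exact: mulrr_measurable.
transitivity ((\int[S]_y (q y)%:E) *
    \int[m]_r (k r * H (r / t)%R * (radial_density n r)%:E)).
  rewrite integral_eball.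
  transitivity (\int[L]_x ((q x)%:E * (below s (enorm x) * H (enorm x / t)%R))).
    by apply: eq_integral => x _; rewrite -muleA; congr (_ * _); rewrite muleC.
  rewrite (@integral_homogeneous_radial q (fun r => below s r * H (r / t)%R))//.
  - congr (_ * _); apply: eq_integral => r _; congr (_ * _).
    by rewrite /k muleA.
  - by apply: emeasurable_funM => //; exact: measurable_below.
  - by move=> r; rewrite mule_ge0 ?below_ge0.
congr (_ * _).
have mf : measurable_fun setT ((fun x => t^-1 *: (x : V)) : VB -> VB).
  exact: (measurable_scale (a := cst t^-1%R)).
transitivity (\int[L]_x (k (enorm x) * h (t^-1 *: (x : V)))).
  rewrite (@integral_radial_mul k (fun x => h (t^-1 *: (x : V))))//.
    apply: eq_integral => r _; congr (_ * _ * _); rewrite /H.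
    by apply: eq_integral => y _; rewrite scalerA mulrC.
  exact: (measurableT_comp mh mf).
pose g (z : VB) := (t `^ gamma)%:E * ((enorm z `^ gamma)%:E * h z * below (s / t)%R (enorm z)).
have mg' : measurable_fun setT
    (fun z : VB => (enorm z `^ gamma)%:E * h z * below (s / t)%R (enorm z)).
  apply: emeasurable_funM.
    by apply: emeasurable_funM => //; exact: (measurableT_comp mpow (@measurable_enorm R n)).
  exact: (measurableT_comp (measurable_below _) (@measurable_enorm R n)).
have g'0 z : 0 <= (enorm z `^ gamma)%:E * h z * below (s / t)%R (enorm z).
  by rewrite !mule_ge0 ?below_ge0 ?lee_fin ?powR_ge0.
transitivity (\int[L]_x g (t^-1 *: (x : V))).
  apply: eq_integral => x _; rewrite /g /k enormZ gtr0_norm ?invr_gt0//.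
  have -> : (enorm x `^ gamma = t `^ gamma * (t^-1 * enorm x) `^ gamma)%R.
    rewrite -powRM ?mulr_ge0 ?invr_ge0 ?enorm_ge0 ?(ltW t0)//.
    by rewrite mulrA divff ?gt_eqF// mul1r.
  have -> : below (s / t)%R (t^-1 * enorm x)%R = below s (enorm x).
    by rewrite /below ltr_pdivlMr// mulrAC mulVf ?gt_eqF// mul1r.
  rewrite EFinM -!muleA; congr (_ * (_ * _)); exact: muleC.
rewrite integral_scale//; last 2 first.
- exact: emeasurable_funM.
- by move=> x; rewrite mule_ge0 ?lee_fin ?powR_ge0.
rewrite /g ge0_integralZl//; last by rewrite lee_fin powR_ge0.
rewrite integral_eball muleA; congr (_ * _).
by rewrite -EFinM -powR_mulrn ?ltW// -powRD//; apply/implyP => _; rewrite gt_eqF.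
Qed.

End radial_integrals.

(** * Hoelder's inequality raised to the power p *)

Section power_hoelder.
Context d (T : measurableType d) (R : realType) (mu : {measure set T -> \bar R}).
Local Open Scope ereal_scope.

Lemma hoelder_bounded (Om g : T -> R) (K : R) :
  measurable_fun setT Om -> measurable_fun setT g ->
  (forall y, (0 <= Om y)%R) -> (forall y, (0 <= g y)%R) -> (0 <= K)%R ->
  {ae mu, forall y, (Om y <= K)%R} ->
  \int[mu]_y (Om y * g y)%:E <= K%:E * \int[mu]_y (g y)%:E.
Proof.
move=> mO mg O0 g0 K0 OK.
rewrite -ge0_integralZl//; last first.
  by move=> y _; rewrite lee_fin.
  exact/measurable_EFinP.
apply: ae_ge0_le_integral => //.
- by move=> y _; rewrite lee_fin mulr_ge0.
- by apply/measurable_EFinP; exact: measurable_funM.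
- by move=> y _; rewrite mule_ge0 ?lee_fin.
- by apply: emeasurable_funM => //; exact/measurable_EFinP.
- by apply: aeS OK => y OyK _; rewrite -EFinM lee_fin ler_wpM2r.
Qed.

(** Jensen's inequality with the weight Om^q, q = p / (p - 1), applied to g Om^(1-q). Since q + (1 -
    q) p = 0, the weight disappears from the right-hand side. *)
Lemma hoelder_power (Om g : T -> R) (p X : R) : (1 < p)%R -> (0 < X)%R ->
  measurable_fun setT Om -> measurable_fun setT g ->
  (forall y, (0 <= Om y)%R) -> (forall y, (0 <= g y)%R) ->
  \int[mu]_y (Om y `^ (p / (p - 1)))%:E <= X%:E ->
  (\int[mu]_y (Om y * g y)%:E) `^ p <=
  (2 `^ p * X `^ (p - 1))%:E * \int[mu]_y (g y `^ p)%:E.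
Proof.
move=> p1 X0 mO mg O0 g0 OX.
have p10 : (0 < p - 1)%R by rewrite subr_gt0.
have p0 : (0 < p)%R by exact: lt_trans p1.
set q := (p / (p - 1))%R in OX *.
have q0 : (0 < q)%R by rewrite divr_gt0.
have pq : (q + (1 - q) * p = 0)%R by rewrite /q; field; rewrite gt_eqF.
have mpow (b : R) : measurable_fun setT (fun y => Om y `^ b)%R.
  exact: (measurableT_comp (@measurable_powR R b) mO).
have mgp (b : R) : measurable_fun setT (fun y => g y `^ b)%R.
  exact: (measurableT_comp (@measurable_powR R b) mg).
(* Where [Om] vanishes both sides are 0, as q > 0; elsewhere the exponents q and 1 - q add up to
   1. *)
have E y : (Om y * g y)%:E = (Om y `^ q)%:E * (g y * Om y `^ (1 - q))%:E.
  rewrite -EFinM; congr EFin; have [->|Oy] := eqVneq (Om y) 0%R.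
    by rewrite powR0 ?gt_eqF// !mul0r.
  rewrite mulrCA -powRD; last by rewrite Oy implybT.
  by rewrite addrC subrK powRr1// mulrC.
under eq_integral do rewrite E.
apply: le_trans (weighted_jensen (mu := mu) (ltW p1) X0 (mpow q) _ _ _ OX) _.
- by move=> y; exact: powR_ge0.
- by apply/measurable_EFinP; exact: measurable_funM.
- by move=> y; rewrite lee_fin mulr_ge0 ?powR_ge0.
apply: lee_wpmul2l; first by rewrite lee_fin mulr_ge0 ?powR_ge0.
apply: ge0_le_integral => //.
- by move=> y _; rewrite mule_ge0 ?poweR_ge0 ?lee_fin ?powR_ge0.
- apply: emeasurable_funM; first exact/measurable_EFinP.
  apply: (measurableT_comp (measurable_poweR _)).
  by apply/measurable_EFinP; exact: measurable_funM.
- exact/measurable_EFinP.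
- move=> y _; rewrite poweR_EFin -EFinM lee_fin powRM ?powR_ge0// -powRrM.
  have [->|Oy] := eqVneq (Om y) 0%R.
    by rewrite powR0 ?gt_eqF// mul0r powR_ge0.
  by rewrite mulrCA -powRD ?Oy ?implybT// pq powRr0 mulr1.
Qed.

End power_hoelder.

(** * The radial majorant *)

Section radial_majorant.
Context (R : realType) (n : nat) (n_gt0 : (0 < n)%N).
Local Notation m := (@lebesgue_measure R).
Local Notation V := 'rV[R]_n.
Local Notation VB := (rowBorel R n).
Local Notation L := (@leb_borel R n).
Local Notation S := (@surf_borel R n).
Local Open Scope ereal_scope.
Variables (p gamma lambda1 : R) (k : R -> R) (Om f q : VB -> R).
Hypotheses (p_ge1 : (1 <= p)%R) (mk : measurable_fun setT k)
  (k_ge0 : forall t, (0 <= k t)%R) (k_le0 : forall t, (t <= 0)%R -> k t = 0%R).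
Hypotheses (mOm : measurable_fun setT Om) (Om_ge0 : forall y, (0 <= Om y)%R).
Hypotheses (mf : measurable_fun setT f) (f_ge0 : forall y, (0 <= f y)%R).
Hypotheses (mq : measurable_fun setT q) (q_ge0 : forall y, (0 <= q y)%R)
  (q_hom : homogeneous gamma q).

Definition sphere_mean (r : R) : \bar R :=
  \int[S]_y (Om y * f (r *: (y : V)))%:E.

(** The integral may run over the whole line because [k] vanishes for t <= 0. *)
Definition radial_majorant (r : R) : \bar R :=
  \int[m]_t ((k t)%:E * sphere_mean (r / t)).

Lemma sphere_mean_ge0 r : 0 <= sphere_mean r.
Proof. by apply: integral_ge0 => y _; rewrite lee_fin mulr_ge0. Qed.

Lemma measurable_sphere_mean : measurable_fun setT sphere_mean.
Proof.
pose F (z : R * VB) := (Om z.2 * f (z.1 *: (z.2 : V)))%:E.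
have mF : measurable_fun setT F.
  apply/measurable_EFinP; apply: measurable_funM.
    exact: (measurableT_comp mOm measurable_snd).
  apply: (measurableT_comp mf).
  by apply: measurable_scale; [exact: measurable_fst|exact: measurable_snd].
apply: (@measurable_fun_fubini_tonelli_F _ _ R VB R S F mF).
by move=> z; rewrite lee_fin mulr_ge0.
Qed.

Lemma measurable_quotient_mean : measurable_fun setT
  (fun z : VB * R => sphere_mean (enorm z.1 / z.2)).
Proof.
apply: (measurableT_comp measurable_sphere_mean); apply: measurable_funM.
  exact: (measurableT_comp (@measurable_enorm R n) measurable_fst).
exact: (measurableT_comp (@measurable_inv R) measurable_snd).
Qed.

Lemma measurable_radial_majorant :
  measurable_fun setT (fun x : VB => radial_majorant (enorm x)).
Proof.
pose F' (z : VB * measurableTypeR R) : \bar R := (k z.2)%:E * sphere_mean (enorm z.1 / z.2).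
have mF' : measurable_fun setT F'.
  apply: emeasurable_funM; last exact: measurable_quotient_mean.
  by apply/measurable_EFinP; exact: (measurableT_comp mk measurable_snd).
have F'0 z : 0 <= F' z by rewrite mule_ge0 ?lee_fin ?sphere_mean_ge0.
exact: (@measurable_fun_fubini_tonelli_F _ _ VB (measurableTypeR R) R m F' mF' F'0).
Qed.

Let a := (n%:R + gamma)%R.
Let M (t : R) := (t `^ (a * (1 - lambda1) / p))%R.

(** Finite bounds that keep the estimate independent of their origin: [X] for the mass C_4, [K] for
    Hoelder's inequality with Omega, [c] for the weight on the sphere, [N] for the Morrey norm of
    f. *)
Variables (X K c N : R).
Hypotheses (X_gt0 : (0 < X)%R) (K_ge0 : (0 <= K)%R) (c_gt0 : (0 < c)%R)
  (N_ge0 : (0 <= N)%R).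
Hypothesis kM_le : \int[m]_t (k t * M t)%:E <= X%:E.
Hypothesis Om_hoelder : forall g : VB -> R, measurable_fun setT g ->
  (forall y, (0 <= g y)%R) ->
  (\int[S]_y (Om y * g y)%:E) `^ p <= K%:E * \int[S]_y (g y `^ p)%:E.
Hypothesis q_ge : {ae S, forall y, (c <= q y)%R}.
Hypothesis f_le : forall s, (0 < s)%R ->
  \int[L]_(x in @eball R n s) (f x `^ p * q x)%:E <= (N * s `^ (a * lambda1))%:E.

Let P (r : R) := \int[S]_y (f (r *: (y : V)) `^ p)%:E.
(** What Jensen's inequality leaves in front of the p-th power of the mean: the weight k M, and M^-p
    from having divided the mean by M. *)
Let w t := (k t * M t * M t `^ (- p))%R.

Let mM : measurable_fun setT M.
Proof. exact: measurable_powR. Qed.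

Let mw : measurable_fun setT w.
Proof.
apply: measurable_funM; first exact: measurable_funM.
exact: (measurableT_comp (@measurable_powR R (- p)) mM).
Qed.

Let w_ge0 t : (0 <= w t)%R.
Proof. by rewrite !mulr_ge0 ?powR_ge0. Qed.

Let mfp : measurable_fun setT (fun x : VB => (f x `^ p)%:E).
Proof.
by apply/measurable_EFinP; exact: (measurableT_comp (@measurable_powR R p) mf).
Qed.

Let fp_ge0 (x : VB) : 0 <= (f x `^ p)%:E.
Proof. by rewrite lee_fin powR_ge0. Qed.

Let mP : measurable_fun setT P.
Proof. exact: (measurable_sphere_integral mfp fp_ge0). Qed.

Let P_ge0 r : 0 <= P r.
Proof. exact: integral_ge0. Qed.

Let mPq : measurable_fun setT (fun z : VB * R => P (enorm z.1 / z.2)).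
Proof.
apply: (measurableT_comp mP); apply: measurable_funM.
  exact: (measurableT_comp (@measurable_enorm R n) measurable_fst).
exact: (measurableT_comp (@measurable_inv R) measurable_snd).
Qed.

(** The integrand is written as (k M) times (mean / M). Jensen's inequality for the weight k M comes
    first, then Hoelder's inequality on each sphere turns the p-th power of the mean into the
    integral [P] of f^p. *)
Lemma radial_majorant_power (r : R) :
  radial_majorant r `^ p <=
  (2 `^ p * X `^ (p - 1) * K)%:E * \int[m]_t ((w t)%:E * P (r / t)).
Proof.
have p0 : (0 < p)%R by exact: lt_le_trans p_ge1.
have mrt : measurable_fun setT (fun t : R => r / t)%R.
  by apply: measurable_funM => //; exact: measurable_inv.
have mSt : measurable_fun setT (fun t : R => sphere_mean (r / t)).
  exact: (measurableT_comp measurable_sphere_mean mrt).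
have mPt : measurable_fun setT (fun t : R => P (r / t)).
  exact: (measurableT_comp mP mrt).
have mMN b : measurable_fun setT (fun t => (M t `^ b)%:E).
  by apply/measurable_EFinP; exact: (measurableT_comp (@measurable_powR R b) mM).
have mEw : measurable_fun setT (fun t => (w t)%:E) by exact/measurable_EFinP.
have mkM : measurable_fun setT (fun t => k t * M t)%R by exact: measurable_funM.
have kM0 t : (0 <= k t * M t)%R by rewrite mulr_ge0 ?powR_ge0.
have E t : (k t)%:E * sphere_mean (r / t) =
    (k t * M t)%:E * (sphere_mean (r / t) * (M t `^ (-1))%:E).
  have [t0|t0] := leP t 0%R; first by rewrite k_le0// mul0r !mul0e.
  rewrite [X in _ = _ * X]muleC muleA -EFinM -mulrA powR_inv1 ?powR_ge0//.
  by rewrite mulfV ?mulr1// gt_eqF// powR_gt0.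
rewrite /radial_majorant; under eq_integral do rewrite E.
apply: le_trans (weighted_jensen (mu := m) p_ge1 X_gt0 mkM kM0 _ _ kM_le) _.
- exact: (emeasurable_funM mSt (mMN (-1)%R)).
- by move=> t; rewrite mule_ge0 ?sphere_mean_ge0 ?lee_fin ?powR_ge0.
have C0 : (0 <= 2 `^ p * X `^ (p - 1))%R by rewrite mulr_ge0 ?powR_ge0.
rewrite [X in _ <= X * _]EFinM -muleA.
apply: lee_wpmul2l; first by rewrite lee_fin.
rewrite -ge0_integralZl//; last 2 first.
- exact: (emeasurable_funM mEw mPt).
- by move=> t _; rewrite mule_ge0 ?lee_fin.
apply: ge0_le_integral => //.
- by move=> t _; rewrite mule_ge0 ?poweR_ge0 ?lee_fin.
- apply: emeasurable_funM; first exact/measurable_EFinP.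
  apply: (measurableT_comp (measurable_poweR _)).
  exact: (emeasurable_funM mSt (mMN (-1)%R)).
- by apply: emeasurable_funM => //; exact: emeasurable_funM.
- move=> t _; rewrite poweRM ?sphere_mean_ge0 ?lee_fin ?powR_ge0//.
  rewrite poweR_EFin -powRrM mulN1r [X in _ * X]muleC muleA -EFinM -/(w t).
  rewrite [leRHS]muleCA; apply: lee_wpmul2l; first by rewrite lee_fin.
  rewrite /sphere_mean /P; apply: (@Om_hoelder (fun y => f ((r / t) *: (y : V)))) => //.
  apply: (measurableT_comp mf); exact: (measurable_scale (a := cst (r / t)%R)).
Qed.

Hypothesis Q_lty : \int[S]_y (q y)%:E < +oo.

(** After Tonelli's theorem t is fixed, and the integral over the ball of radius s becomes one over
    the ball of radius s / t. All powers of t coming from [w], the substitution and the Morrey bound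
    combine to k(t) M(t), whose integral supplies the last factor of X^p. *)
Lemma integral_radial_majorant (s : R) : (0 < s)%R ->
  \int[L]_(x in @eball R n s) ((q x)%:E * radial_majorant (enorm x) `^ p) <=
  (2 `^ p * X `^ p * K * fine (\int[S]_y (q y)%:E) * c^-1 * N *
    s `^ (a * lambda1))%:E.
Proof.
move=> s0; have p0 : (0 < p)%R by exact: lt_le_trans p_ge1.
set Q := \int[S]_y (q y)%:E.
have Q0 : 0 <= Q by apply: integral_ge0 => y _; rewrite lee_fin.
have QE : Q = (fine Q)%:E by rewrite fineK// ge0_fin_numE.
have fQ0 : (0 <= fine Q)%R by rewrite fine_ge0.
have mB := measurable_eball (R := R) (n := n) s.
have mEq : measurable_fun setT (fun x => (q x)%:E) by exact/measurable_EFinP.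
have mEw : measurable_fun setT (fun t => (w t)%:E) by exact/measurable_EFinP.
pose C1 := (2 `^ p * X `^ (p - 1) * K)%R.
have C10 : (0 <= C1)%R by rewrite !mulr_ge0 ?powR_ge0.
pose F (z : VB * measurableTypeR R) : \bar R := (q z.1)%:E * below s (enorm z.1) * ((w z.2)%:E * P (enorm z.1 / z.2)).
have mF : measurable_fun setT F.
  apply: emeasurable_funM; last first.
    apply: emeasurable_funM => //.
    exact: (measurableT_comp mEw measurable_snd).
  apply: emeasurable_funM; first exact: (measurableT_comp mEq measurable_fst).
  apply: (measurableT_comp (measurable_below s)).
  exact: (measurableT_comp (@measurable_enorm R n) measurable_fst).
have F0 z : 0 <= F z by rewrite !mule_ge0 ?below_ge0 ?lee_fin.
have mFx : measurable_fun setT (fun x : VB => \int[m]_t F (x, t)).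
  exact: (@measurable_fun_fubini_tonelli_F _ _ VB (measurableTypeR R) R m F mF F0).
have mPw : measurable_fun setT
    (fun x : VB => \int[m]_t ((w t)%:E * P (enorm x / t))).
  pose F' (z : VB * measurableTypeR R) : \bar R := (w z.2)%:E * P (enorm z.1 / z.2).
  have mF' : measurable_fun setT F'.
    by apply: emeasurable_funM => //; exact: (measurableT_comp mEw measurable_snd).
  have F'0 z : 0 <= F' z by rewrite mule_ge0 ?lee_fin.
  exact: (@measurable_fun_fubini_tonelli_F _ _ VB (measurableTypeR R) R m F' mF' F'0).
have mwP (r : R) : measurable_fun setT (fun t : R => (w t)%:E * P (r / t)).
  apply: (emeasurable_funM mEw); apply: (measurableT_comp mP _).
  by apply: measurable_funM => //; exact: measurable_inv.
have mPx (t : R) : measurable_fun setT (fun x : VB => P (enorm x / t)).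
  apply: (measurableT_comp mP _).
  by apply: measurable_funM => //; exact: measurable_enorm.
have mbelow : measurable_fun setT (fun x : VB => below s (enorm x)).
  exact: (measurableT_comp (measurable_below s) (@measurable_enorm R n)).
have mG := measurable_radial_majorant.
apply: (@le_trans _ _ (C1%:E * \int[L]_x \int[m]_t F (x, t))).
  rewrite -ge0_integralZl//; last by move=> x _; apply: integral_ge0.
  rewrite integral_eball; apply: ge0_le_integral => //.
  - by move=> x _; rewrite !mule_ge0 ?below_ge0 ?poweR_ge0 ?lee_fin.
  - apply: emeasurable_funM; last exact: mbelow.
    apply: (emeasurable_funM mEq).
    exact: (measurableT_comp (measurable_poweR _) mG).
  - exact: emeasurable_funM.
  - move=> x _; rewrite /F/= ge0_integralZl//; last 3 first.
    + exact: mwP.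
    + by move=> t _; rewrite mule_ge0 ?lee_fin.
    + by rewrite mule_ge0 ?below_ge0 ?lee_fin.
    rewrite muleCA muleAC; apply: lee_wpmul2l.
      by rewrite mule_ge0 ?below_ge0 ?lee_fin.
    exact: radial_majorant_power.
rewrite (@fubini_tonelli _ _ VB (measurableTypeR R) R L m F mF F0).
have inner t : \int[L]_x F (x, t) <=
    (fine Q * c^-1 * N * s `^ (a * lambda1))%:E * (k t * M t)%:E.
  have [t0|t0] := leP t 0%R.
    rewrite k_le0// mul0r mule0 integral0_eq// => x _.
    by rewrite /F/= /w k_le0// !mul0r mul0e mule0.
  have -> : \int[L]_x F (x, t) = (w t)%:E * \int[L]_(x in @eball R n s)
      ((q x)%:E * P (enorm x / t)).
    rewrite integral_eball -ge0_integralZl//; last 3 first.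
    - exact: (emeasurable_funM (emeasurable_funM mEq (mPx t)) mbelow).
    - by move=> x _; rewrite !mule_ge0 ?below_ge0 ?lee_fin.
    - by rewrite lee_fin.
    apply: eq_integral => x _; rewrite /F/= muleCA; congr (_ * _).
    by rewrite muleAC.
  rewrite (@integral_eball_sphere _ _ n_gt0 gamma q (fun x => (f x `^ p)%:E) s t)//.
  rewrite -/Q QE -/a.
  have st0 : (0 < s / t)%R by rewrite divr_gt0.
  (* By homogeneity the lower bound on the sphere gives c |x|^gamma <= q(x) almost everywhere, which
     turns the power of |x| into the weight of the Morrey norm. *)
  have le1 : \int[L]_(x in @eball R n (s / t)) ((enorm x `^ gamma)%:E * (f x `^ p)%:E)
      <= (c^-1 * (N * (s / t) `^ (a * lambda1)))%:E.
    rewrite EFinM.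
    apply: (@le_trans _ _ (c^-1%:E * \int[L]_(x in @eball R n (s / t)) (f x `^ p * q x)%:E)); last first.
      by apply: lee_wpmul2l; [rewrite lee_fin invr_ge0 ltW|exact: f_le].
    have mfq : measurable_fun setT (fun x : VB => (f x `^ p * q x)%:E).
      apply/measurable_EFinP; apply: measurable_funM => //.
      exact: (measurableT_comp (@measurable_powR R p) mf).
    rewrite -ge0_integralZl//; last 4 first.
    - exact: measurable_eball.
    - exact: measurable_funTS.
    - by move=> x _; rewrite lee_fin mulr_ge0 ?powR_ge0.
    - by rewrite lee_fin invr_ge0 ltW.
    apply: ae_ge0_le_integral.
    - exact: measurable_eball.
    - by move=> x _; rewrite mule_ge0 ?lee_fin ?powR_ge0.
    - apply: measurable_funTS; apply: emeasurable_funM => //.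
      apply/measurable_EFinP.
      exact: (measurableT_comp (@measurable_powR R gamma) (@measurable_enorm R n)).
    - by move=> x _; rewrite -EFinM lee_fin !mulr_ge0 ?powR_ge0// invr_ge0 ltW.
    - by apply: measurable_funTS; exact: emeasurable_funM.
    - apply: aeS (aeI (ae_direction n_gt0 q_ge) (ae_nonzero R n_gt0)) => x [qx x0] _.
      have x1 := enorm_direction x0.
      have xp : (0 < enorm x)%R.
        rewrite lt_neqAle enorm_ge0 andbT eq_sym.
        by apply: contra x0 => /eqP/enorm_eq0 ->.
      have := q_hom xp x1; rewrite scale_direction => ->.
      rewrite -!EFinM lee_fin [leRHS]mulrC ler_pdivlMr// [leRHS]mulrCA [leRHS]mulrA.
      by apply: ler_wpM2l => //; rewrite mulr_ge0 ?powR_ge0.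
  apply: (@le_trans _ _ ((w t)%:E * ((fine Q)%:E * ((t `^ a)%:E *
      (c^-1 * (N * (s / t) `^ (a * lambda1)))%:E)))).
    apply: lee_wpmul2l; first by rewrite lee_fin.
    apply: lee_wpmul2l; first by rewrite lee_fin.
    by apply: lee_wpmul2l; first by rewrite lee_fin powR_ge0.
  rewrite -!EFinM lee_fin le_eqVlt; apply/orP; left; apply/eqP.
  have -> : ((s / t) `^ (a * lambda1) = s `^ (a * lambda1) * t `^ (- (a * lambda1)))%R.
    rewrite powRM ?ltW ?invr_gt0// -powR_inv1 ?ltW// -powRrM.
    by rewrite mulN1r.
  (* M^-p = t^(-a (1 - lambda1)) splits into the inverses of the two powers of t present in the
     other factors, t^a and t^(-a lambda1). *)
  have -> : (w t = k t * M t * (t `^ a)^-1 * (t `^ (- (a * lambda1)))^-1)%R.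
    rewrite /w; rewrite -!mulrA; congr (_ * (_ * _))%R.
    rewrite /M -powRrM -!powRN opprK -powRD; last by rewrite (gt_eqF t0) implybT.
    congr powR; field; by rewrite gt_eqF.
  by field; rewrite ?gt_eqF ?powR_gt0.
apply: (@le_trans _ _ (C1%:E * ((fine Q * c^-1 * N * s `^ (a * lambda1))%:E * X%:E))).
  have C0 : (0 <= fine Q * c^-1 * N * s `^ (a * lambda1))%R.
    by rewrite !mulr_ge0 ?powR_ge0// invr_ge0 ltW.
  apply: lee_wpmul2l; first by rewrite lee_fin.
  apply: (@le_trans _ _ (\int[m]_t ((fine Q * c^-1 * N * s `^ (a * lambda1))%:E *
      (k t * M t)%:E))).
    apply: ge0_le_integral => //.
    - by move=> t _; exact: integral_ge0.
    - exact: (@measurable_fun_fubini_tonelli_G _ _ VB (measurableTypeR R) R L F mF F0).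
    - apply: emeasurable_funM => //; apply/measurable_EFinP; exact: measurable_funM.
  rewrite ge0_integralZl//; last 2 first.
  - by apply/measurable_EFinP; exact: measurable_funM.
  - by move=> t _; rewrite lee_fin mulr_ge0 ?powR_ge0.
  by apply: lee_wpmul2l; first by rewrite lee_fin.
rewrite -!EFinM lee_fin /C1 -(mulr_powRB1 (ltW X_gt0) p0).
by rewrite le_eqVlt; apply/orP; left; apply/eqP; ring.
Qed.

End radial_majorant.

(** * Borel versions of extended real functions *)

Section ereal_borel_version.
Context (R : realType) (T : pointedType).
Variables (mu : {outer_measure set T -> \bar R}) (G : set (set T)).
Local Notation B := (g_sigma_algebraType G).
Local Notation C := (caratheodory_type mu).
Variable nu : {measure set B -> \bar R}.
Local Notation muC := (mu : {measure set C -> \bar R}).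
Hypothesis GC : G `<=` (@measurable _ C).
Hypothesis nuE : forall A : set B, measurable A -> nu A = mu A.

Lemma emeasurable_fun_ae_cara (D : set B) (f g : T -> \bar R) :
  measurable D -> {ae nu, forall x, D x -> f x = g x} ->
  measurable_fun D (g : B -> \bar R) -> measurable_fun (D : set C) (f : C -> \bar R).
Proof.
move=> mD fg mg; apply: (@ae_measurable_fun _ _ _ muC _ D g).
- exact: measure_is_complete_caratheodory.
- by apply: (ae_cara GC nuE); apply: aeS fg => x /[apply] /= ->.
- exact: measurable_fun_cara.
Qed.

Lemma eintegral_ae_cara (D : set B) (f g : T -> \bar R) :
  measurable D -> {ae nu, forall x, D x -> f x = g x} ->
  measurable_fun D (g : B -> \bar R) ->
  (\int[muC]_(x in D) f x = \int[nu]_(x in D) g x)%E.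
Proof.
move=> mD fg mg; rewrite -(integral_cara GC nuE)//.
apply: ae_eq_integral => //; first exact: borel_sub_cara.
- exact: emeasurable_fun_ae_cara fg mg.
- exact: measurable_fun_cara.
- by apply: (ae_cara GC nuE); apply: aeS fg => x /[apply] /= ->.
Qed.

End ereal_borel_version.

(** * Completed and Borel Lebesgue measure on the line *)

Section completed_lebesgue_borel.
Context (R : realType).
Local Notation m := (@lebesgue_measure R).
Local Notation cm := (@completed_lebesgue_measure R).
Local Notation mu0 := ((@wlength R idfun)^*)%mu.

(** The completed measure is the Caratheodory extension of the length of half-open intervals, so the
    transfer results for outer measures apply to it with these intervals as generator. *)
Lemma ocitv_cara : R.-ocitv.-measurable `<=` (@measurable _ (caratheodory_type mu0)).
Proof. by move=> A mA; apply: sub_caratheodory; exact: sub_sigma_algebra. Qed.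

Lemma lebesgue_measureE (A : set (measurableTypeR R)) : measurable A -> m A = mu0 A.
Proof. by []. Qed.

Lemma completed_ae (P : R -> Prop) :
  {ae m, forall x, P x} -> {ae cm, forall x, P x}.
Proof. exact: (ae_cara ocitv_cara lebesgue_measureE). Qed.

Lemma completed_emeasurable_ae (D : set R) (f g : R -> \bar R) : measurable D ->
  {ae m, forall x, D x -> f x = g x} -> measurable_fun D g ->
  measurable_fun (D : set (caratheodory_type mu0)) (f : caratheodory_type mu0 -> \bar R).
Proof. exact: (emeasurable_fun_ae_cara ocitv_cara lebesgue_measureE). Qed.

Lemma completed_integral_ae (D : set R) (f g : R -> \bar R) : measurable D ->
  {ae m, forall x, D x -> f x = g x} -> measurable_fun D g ->
  (\int[cm]_(x in D) f x = \int[m]_(x in D) g x)%E.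
Proof. exact: (eintegral_ae_cara ocitv_cara lebesgue_measureE). Qed.

Lemma completed_complex_measurable_ae (D : set R) (f g : R -> R[i]) : measurable D ->
  {ae m, forall x, D x -> f x = g x} -> measurable_complex g ->
  complex_measurable cm D f.
Proof. exact: (complex_measurable_ae ocitv_cara lebesgue_measureE). Qed.

Lemma completed_complex_integral_ae (D : set R) (f g : R -> R[i]) : measurable D ->
  {ae m, forall x, D x -> f x = g x} -> measurable_complex g ->
  complex_integral cm D f = complex_integral m D g.
Proof. exact: (complex_integral_ae ocitv_cara lebesgue_measureE). Qed.

(** A null set cannot contain []0, 1]]. This is what selects a generic radius. *)
Lemma ae_positive_exists (P : R -> Prop) :
  {ae m, forall r, 0 < r -> P r} -> exists2 r, 0 < r & P r.
Proof.
move=> [N [mN N0 subN]].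
have [r [r01 Nr]] : exists r, `]0, 1]%classic r /\ ~ N r.
  apply: contrapT => nor.
  have : (m `]0%R, 1%R]%classic <= m N)%E.
    apply: le_measure; [by rewrite inE; apply: measurable_itv|by rewrite inE|].
    by move=> r r01; apply: contrapT => Nr; apply: nor; exists r.
  by rewrite N0 lebesgue_measure_itv/= lte01 oppr0 adde0 lee_fin ler10.
have r0 : 0 < r by move: r01; rewrite /= in_itv/= => /andP[].
by exists r => //; apply: contrapT => nPr; apply/Nr/subN => /= /(_ r0).
Qed.

End completed_lebesgue_borel.

(** * Measurable dependence of integrals on a parameter *)

Section parametric_integral.
Context d1 d2 (T1 : measurableType d1) (T2 : measurableType d2) (R : realType).
Variable m2 : {sigma_finite_measure set T2 -> \bar R}.

(** Tonelli's theorem covers nonnegative integrands; the general integral is by definition the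
    difference of two such integrals, whether or not they are finite. *)
Lemma measurable_integral_param (D : set T2) (g : T1 * T2 -> \bar R) :
  measurable D -> measurable_fun setT g ->
  measurable_fun setT (fun x => \int[m2]_(y in D) g (x, y))%E.
Proof.
move=> mD mg.
have E (h : T1 * T2 -> \bar R) : measurable_fun setT h -> (forall z, 0 <= h z)%E ->
    measurable_fun setT (fun x => \int[m2]_(y in D) h (x, y))%E.
  move=> mh h0.
  pose H (z : T1 * T2) : \bar R := (h z * (\1_D z.2)%:E)%E.
  have mH : measurable_fun setT H.
    apply: emeasurable_funM => //; apply/measurable_EFinP.
    by apply: (measurableT_comp _ measurable_snd); exact: measurable_indic.
  have H0 z : (0 <= H z)%E by rewrite mule_ge0// lee_fin.
  have := @measurable_fun_fubini_tonelli_F _ _ T1 T2 R m2 H mH H0.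
  rewrite (_ : fubini_F m2 H = fun x => \int[m2]_(y in D) h (x, y))%E//.
  by apply/funext => x; rewrite /fubini_F [RHS]integral_mkcond epatch_indic.
rewrite (_ : (fun x => _) = (fun x => \int[m2]_(y in D) (g^\+ (x, y)) -
    \int[m2]_(y in D) (g^\- (x, y))))%E; last first.
  apply/funext => x; rewrite [LHS]integralE; congr (_ - _)%E;
    by apply: eq_integral => y _; rewrite ?funeposE ?funenegE.
by apply: emeasurable_funB; apply: E => //; [exact: measurable_funepos|
  exact: measurable_funeneg].
Qed.

Lemma measurable_complex_integral (D : set T2) (g : T1 * T2 -> R[i]) :
  measurable D -> measurable_complex g ->
  measurable_complex (fun x => complex_integral m2 D (fun y => g (x, y))).
Proof.
move=> mD [g1 g2]; split; rewrite /complex_integral/= /Rintegral.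
- apply: (measurableT_comp (f := fine)); first exact: fine_measurable.
  by apply: (@measurable_integral_param D (fun z => (complex.Re (g z))%:E)) => //;
    exact/measurable_EFinP.
- apply: (measurableT_comp (f := fine)); first exact: fine_measurable.
  by apply: (@measurable_integral_param D (fun z => (complex.Im (g z))%:E)) => //;
    exact/measurable_EFinP.
Qed.

End parametric_integral.

(** * The modulus of a complex integral *)

Section complex_integral_bound.
Context d (T : measurableType d) (R : realType) (mu : {measure set T -> \bar R}).

(** An infinite integral is sent to 0 by [fine], so the bound also covers non-integrable
    functions. *)
Lemma le_normr_fine_integral (D : set T) (h : T -> R) : measurable D ->
  measurable_fun setT h ->
  (`|fine (\int[mu]_(x in D) (h x)%:E)|%:E <= \int[mu]_(x in D) `|h x|%:E)%E.
Proof.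
move=> mD mh; apply: (@le_trans _ _ `| \int[mu]_(x in D) (h x)%:E |%E).
  by case: (integral _ _ _) => [r||] /=; rewrite ?normr0 ?lee_fin ?leey.
by apply: le_abse_integral => //; apply/measurable_EFinP; exact: measurable_funTS.
Qed.

Lemma Re_complex_integral_le (D : set T) (g : T -> R[i]) : measurable D ->
  measurable_complex g ->
  (`|complex.Re (complex_integral mu D g)|%:E <= \int[mu]_(x in D) (normc (g x))%:E)%E.
Proof.
move=> mD mg; apply: le_trans (le_normr_fine_integral mD mg.1) _.
apply: ge0_le_integral => //.
- apply/measurable_EFinP; apply: measurable_funTS.
  by apply: measurableT_comp => //; exact: mg.1.
- by apply/measurable_EFinP; apply: measurable_funTS; exact: measurable_normc.
- by move=> x _; rewrite lee_fin Re_le_normc.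
Qed.

Lemma Im_complex_integral_le (D : set T) (g : T -> R[i]) : measurable D ->
  measurable_complex g ->
  (`|complex.Im (complex_integral mu D g)|%:E <= \int[mu]_(x in D) (normc (g x))%:E)%E.
Proof.
move=> mD mg; apply: le_trans (le_normr_fine_integral mD mg.2) _.
apply: ge0_le_integral => //.
- apply/measurable_EFinP; apply: measurable_funTS.
  by apply: measurableT_comp => //; exact: mg.2.
- by apply/measurable_EFinP; apply: measurable_funTS; exact: measurable_normc.
- by move=> x _; rewrite lee_fin Im_le_normc.
Qed.

(** The factor 2 comes from bounding the modulus by the sum of the moduli of the two components. *)
Lemma normc_complex_integral_le (D : set T) (g : T -> R[i]) : measurable D ->
  measurable_complex g ->
  ((normc (complex_integral mu D g))%:E <=
   2%:E * \int[mu]_(x in D) (normc (g x))%:E)%E.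
Proof.
move=> mD mg.
apply: (@le_trans _ _ (`|complex.Re (complex_integral mu D g)|%:E +
    `|complex.Im (complex_integral mu D g)|%:E)%E).
  by rewrite -EFinD lee_fin normc_le_ReIm.
rewrite -[2]/(1 + 1) EFinD ge0_muleDl// mul1e leeD//.
  exact: Re_complex_integral_le.
exact: Im_complex_integral_le.
Qed.

End complex_integral_bound.

(** * Lipschitz symbols *)

Section lipschitz.
Context (R : realType) (n : nat).
Local Notation V := 'rV[R]_n.
Local Notation VB := (rowBorel R n).

Lemma lipschitz_bound (beta : R) (b : V -> R[i]) : lipschitz_class beta b ->
  exists2 B : R, 0 <= B &
    forall x y, normc (b x - b y) <= B * enorm (x - y) `^ beta.
Proof.
move=> lb; exists (Num.max 0 (fine (lip_seminorm beta b))); first by rewrite le_max lexx.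
move=> x y; have [->|xy] := eqVneq x y.
  by rewrite subrr normc0 mulr_ge0 ?powR_ge0// le_max lexx.
have e0 : 0 < enorm (x - y).
  rewrite lt_neqAle enorm_ge0 andbT eq_sym.
  by apply: contra xy => /eqP/enorm_eq0/eqP; rewrite subr_eq0.
rewrite -ler_pdivrMr ?powR_gt0//.
have le1 : ((normc (b x - b y) / enorm (x - y) `^ beta)%:E <= lip_seminorm beta b)%E.
  by apply: ereal_sup_ubound; exists x, y.
have lfin : lip_seminorm beta b \is a fin_num.
  rewrite fin_numE; apply/andP; split; last by rewrite -ltey.
  by rewrite -ltNye; exact: lt_le_trans (ltNyr _) le1.
by rewrite le_max; apply/orP; right; rewrite -lee_fin fineK.
Qed.

Lemma hoelder_continuous (beta B : R) (g : V -> R) : 0 < beta -> 0 <= B ->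
  (forall x y, `|g x - g y| <= B * enorm (x - y) `^ beta) -> continuous g.
Proof.
move=> beta0 B0 gB x A /nbhs_ballP[e /= e0 eA].
(* Chosen so that B u < e, also when [B] is 0. *)
pose u := e / (B + 1).
have B1 : 0 < B + 1 by rewrite ltr_wpDl.
have u0 : 0 < u by rewrite divr_gt0.
(* Neighbourhoods are sup-norm balls: the Euclidean norm is at most n times the sup norm, and n + 1
   keeps the denominator positive in every dimension. *)
pose dl := u `^ beta^-1 / n.+1%:R.
have dl0 : 0 < dl by rewrite divr_gt0// powR_gt0.
apply/nbhs_ballP; exists dl => //= y [_ xy].
apply: eA; rewrite -ball_normE/=; apply: le_lt_trans (gB x y) _.
have le1 : enorm (x - y) <= u `^ beta^-1.
  apply: le_trans (enorm_le_coord _) _.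
  apply: (@le_trans _ _ (\sum_(i < n) dl)).
    by apply: ler_sum => i _; rewrite !mxE; exact/ltW/(xy ord0 i).
  rewrite sumr_const card_ord -mulr_natr /dl -mulrA ler_piMr ?powR_ge0//.
  by rewrite mulrC ler_pdivrMr// mul1r ler_nat.
have le2 : enorm (x - y) `^ beta <= u.
  have := ge0_ler_powR (ltW beta0) _ _ le1.
  rewrite !nnegrE enorm_ge0 powR_ge0 -powRrM mulVf ?gt_eqF// powRr1 ?(ltW u0)//.
  exact.
apply: (@le_lt_trans _ _ (B * u)); first by rewrite ler_wpM2l.
by rewrite /u mulrA ltr_pdivrMr// mulrC ltr_pM2l// ltrDl.
Qed.

Lemma lipschitz_measurable (beta : R) (b : V -> R[i]) : 0 < beta ->
  lipschitz_class beta b -> measurable_complex (b : VB -> R[i]).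
Proof.
move=> beta0 /lipschitz_bound[B B0 bB]; split; apply: continuous_measurable_row;
  apply: (hoelder_continuous beta0 B0) => x y; apply: le_trans (bB x y).
- by apply: le_trans (Re_le_normc _); case: (b x); case: (b y).
- by apply: le_trans (Im_le_normc _); case: (b x); case: (b y).
Qed.

End lipschitz.

(** * Borel versions of homogeneous weights and of the radial profile *)

Section weights.
Context (R : realType) (n : nat) (n_gt0 : (0 < n)%N).
Local Notation m := (@lebesgue_measure R).
Local Notation V := 'rV[R]_n.
Local Notation VB := (rowBorel R n).
Local Notation L := (@leb_borel R n).
Local Notation S := (@surf_borel R n).

Lemma leb_borelE (A : set VB) : measurable A -> L A = leb_outer A.
Proof. by []. Qed.

Lemma surf_borelE (A : set VB) : measurable A -> S A = surface_outer A.
Proof. by []. Qed.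

Lemma integral_sphereT (F : VB -> \bar R) : measurable_fun setT F ->
  (forall y, 0 <= F y)%E ->
  (\int[S]_(y in @esphere R n) F y = \int[S]_y F y)%E.
Proof.
move=> mF F0; rewrite integral_mkcond; apply: ge0_ae_eq_integral => //.
- by apply/(measurable_restrictT _ (@measurable_esphere R n)); exact: measurable_funTS.
- by move=> y _; rewrite patchE; case: ifPn.
- by apply: aeS (@ae_sphere R n) => y Sy _; rewrite patchE mem_set.
Qed.

(** A Borel version g of the weight need be neither homogeneous nor meaningful on the unit sphere.
    At almost every radius r, however, w = g and w > 0 at almost all points of the sphere of radius
    r, and homogeneity of w carries these values to the unit sphere as r^(-gamma) g(r y); q is their
    homogeneous extension. *)
Lemma weight_borel (gamma : R) (w : V -> R) : weight_class gamma w ->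
  exists q : VB -> R, [/\ measurable_fun setT q, forall x, 0 <= q x,
    homogeneous gamma q, {ae L, forall x, w x = q x} &
    {ae S, forall y, w y = q y}] /\
    (0 < \int[S]_y (q y)%:E < +oo)%E.
Proof.
move=> [mw w0 wS wh].
have [g mg wg] := cara_borel_fun (@coordinate_sets_cara R n) leb_borelE
  (@leb_outer_regular R n) (@leb_outer_sigma_finite R n) mw.
have w0' := ae_borel leb_borelE (@leb_outer_regular R n) w0.
have [r r0 aer] := ae_positive_exists (ae_polar n_gt0 (aeI wg w0')).
have rn0 : r != 0 by rewrite gt_eqF.
(* The maximum with 0 makes the new weight nonnegative everywhere; it has no effect at the almost
   all points where w > 0 and w = g. *)
pose ws (y : VB) : R := Num.max 0 (r `^ (- gamma) * g (r *: (y : V))).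
have mr : measurable_fun setT ((fun y => r *: (y : V)) : VB -> VB).
  exact: (measurable_scale (a := cst r)).
have mws : measurable_fun setT ws.
  apply: measurable_maxr => //; apply: measurable_funM => //.
  exact: (measurableT_comp mg mr).
have ws0 y : 0 <= ws y by rewrite le_max lexx.
have wws : {ae S, forall y, w y = ws y}.
  apply: aeS aer => y []; rewrite wh// gtr0_norm// => E.
  rewrite pmulr_rgt0 ?powR_gt0// => wy0.
  rewrite /ws -E mulrA -powRD ?(gt_eqF r0) ?implybT// addNr powRr0 mul1r.
  by rewrite max_r// ltW.
pose q (x : VB) : R := enorm x `^ gamma * ws (direction x).
have mq : measurable_fun setT q.
  apply: measurable_funM.
    exact: (measurableT_comp (@measurable_powR R gamma) (@measurable_enorm R n)).
  exact: (measurableT_comp mws (@measurable_direction R n)).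
have q0 x : 0 <= q x by rewrite mulr_ge0 ?powR_ge0.
have wq : {ae S, forall y, w y = q y}.
  apply: aeS (aeI wws (@ae_sphere R n)) => y [wy Sy].
  by rewrite /q direction_sphere// (Sy : enorm y = 1) powR1 mul1r.
exists q; split; first split => //.
- move=> s y s0 y1; rewrite /q direction_scale// enormZ y1 mulr1 gtr0_norm//.
  by rewrite powR1 mul1r.
- apply: aeS (aeI (ae_direction n_gt0 wws) (ae_nonzero R n_gt0)) => x [wx x0].
  have xn0 : enorm x != 0 by apply: contra x0 => /eqP/enorm_eq0 ->.
  rewrite -{1}(scale_direction x) wh// ger0_norm ?enorm_ge0// /q.
  by congr (_ * _); exact: wx.
move: wS; rewrite (integral_ae_cara (@coordinate_sets_cara_surface R n) surf_borelE
  (@measurable_esphere R n) (g := q)); last 2 first.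
- by apply: aeS wq => y.
- exact: measurable_funTS.
by rewrite integral_sphereT//; exact/measurable_EFinP.
Qed.

(** For almost every direction y, Phi and its Borel version Psi agree at r y for almost every r.
    Along one such ray, r -> Psi(r y) is a Borel version of the profile. *)
Lemma radial_profile_borel (Phi : V -> R[i]) (phi : R -> R[i]) :
  (0 < S setT)%E -> complex_measurable (@lebesgue R n) setT Phi ->
  (forall x, Phi x = phi (enorm x)) ->
  exists2 psi : R -> R[i], measurable_complex psi &
    {ae m, forall r, 0 < r -> phi r = psi r}.
Proof.
move=> S0 mPhi Phi_rad.
have [Psi mPsi [N [mN N0 subN]]] := cara_borel_complex (@coordinate_sets_cara R n)
  leb_borelE (@leb_outer_regular R n) (@leb_outer_sigma_finite R n)
  (@measurableT _ VB) mPhi.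
have NL : {ae L, forall x, ~ N x} by exists N; split => // x /= /contrapT.
have [M [mM M0 subM]] := ae_polar n_gt0 NL.
(* Discarding the bad radii [M] makes the sections in y null for every r, as [ae_sections]
   demands. *)
pose Z : set (VB * measurableTypeR R) :=
  [set z | ~ M z.2 /\ 0 < z.2 /\ N (z.2 *: (z.1 : V))].
have mZ : measurable Z.
  have ms : measurable_fun setT ((fun z => z.2 *: (z.1 : V)) : VB * measurableTypeR R -> VB).
    by apply: measurable_scale; [exact: measurable_snd|exact: measurable_fst].
  rewrite (_ : Z = (setT `&` snd @^-1` (~` M `&` `]0, +oo[%classic)) `&`
      (setT `&` (fun z : VB * measurableTypeR R => z.2 *: (z.1 : V)) @^-1` N)).
    apply: measurableI; last exact: ms.
    apply: measurable_snd => //; apply: measurableI; first exact: measurableC.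
    exact: measurable_itv.
  rewrite !setTI; apply/seteqP; split => z /=; rewrite in_itv/= andbT.
    by move=> [? []].
  by move=> [[]].
have Z0 r : S [set y | Z (y, r)] = 0%E.
  have [[Mr r0]|nMr] := pselect (~ M r /\ 0 < r); last first.
    rewrite (_ : [set y | _] = set0) ?measure0// -subset0 => y /= [Mr [r0 _]].
    by apply: nMr.
  have [A [mA A0 subA]] : {ae S, forall y, ~ N (r *: y)}.
    by apply: contrapT => h; apply/Mr/subM => /= /(_ r0).
  apply/eqP; rewrite eq_le measure_ge0 andbT -A0; apply: le_surf_borel => y /=.
  by move=> [_ [_ Ny]]; apply: subA => /=.
have [A [mA A0 subA]] := aeI (@ae_sections R _ _ VB (measurableTypeR R) S m Z mZ Z0)
  (@ae_sphere R n).
(* A good direction exists because the sphere has positive measure. *)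
have [y Ay] : exists y, ~ A y.
  apply: contrapT => h; have AT : A = setT.
    by apply/seteqP; split => // y _; apply: contrapT => Ay; apply: h; exists y.
  by move: S0; rewrite -AT A0 ltxx.
have [Zy0 Sy] : m [set r | Z (y, r)] = 0%E /\ esphere y.
  by apply: contrapT => h; apply/Ay/subA.
have mZy : measurable [set r | Z (y, r)].
  by have := measurable_xsection y mZ; rewrite /xsection; under eq_set do rewrite inE.
exists (fun r => Psi (r *: y)).
  apply: (measurable_complex_comp mPsi).
  by apply: (measurable_scale (a := fun r : R => r) (f := cst (y : VB))).
have aeM : {ae m, forall r, ~ M r} by exists M; split => // r /= /contrapT.
have aeZ : {ae m, forall r, ~ Z (y, r)}.
  by exists [set r | Z (y, r)]; split => // r /= /contrapT.
apply: aeS (aeI aeM aeZ) => r [Mr Zr] r0.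
have -> : phi r = Phi (r *: y).
  by rewrite Phi_rad enormZ (Sy : enorm y = 1) mulr1 gtr0_norm.
apply: contrapT => h; apply: Zr; split => //; split => //; apply: subN => /=.
by move=> /(_ I).
Qed.

End weights.

(** * The data of the theorem as bounds on Borel functions *)

Section operator_ingredients.
Context (R : realType) (n : nat) (n_gt0 : (0 < n)%N).
Local Notation m := (@lebesgue_measure R).
Local Notation cm := (@completed_lebesgue_measure R).
Local Notation V := 'rV[R]_n.
Local Notation VB := (rowBorel R n).
Local Notation L := (@leb_borel R n).
Local Notation S := (@surf_borel R n).
Local Open Scope ereal_scope.

Lemma sphere_Lp_hoelder (p : R) (Omega : V -> R[i]) : (1 <= p)%R -> 0 < S setT ->
  sphere_Lp (hoelder_conjugate p%:E) Omega ->
  exists (Om : VB -> R[i]) (K : R), [/\ measurable_complex Om,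
    {ae S, forall y, Omega y = Om y}, (0 <= K)%R &
    forall g : VB -> R, measurable_fun setT g -> (forall y, 0 <= g y)%R ->
    (\int[S]_y (normc (Om y) * g y)%:E) `^ p <= K%:E * \int[S]_y (g y `^ p)%:E].
Proof.
move=> p1 S0 [mO NO].
have [Om mOm OmE0] := cara_borel_complex (@coordinate_sets_cara_surface R n)
  (@surf_borelE R n) (surface_outer_regular n_gt0) (@surface_outer_sigma_finite R n)
  (@measurable_esphere R n) mO.
have OmE : {ae S, forall y, Omega y = Om y}.
  by apply: aeS (aeI OmE0 (@ae_sphere R n)) => y [h Sy]; exact: h.
have mnO := measurable_normc mOm.
(* For p = 1 the conjugate exponent is infinite and the norm of Omega is an essential supremum; for
   p > 1 it is an integral with exponent p / (p - 1). *)
have [pE|pN1] := eqVneq p 1%R.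
  rewrite pE in NO *; move: NO; rewrite hoelder_conjugate1 unlock ifT// => NO.
  have := @ess_sup_ge _ _ _ (@surface R n) (abse \o (fun y => (normc (Omega y))%:E)).
  move: NO; set M := ess_sup _ _ => Moo leM.
  have le1 : {ae S, forall y, (normc (Om y) <= Num.max 0 (fine M))%R}.
    have leMb := ae_borel (@surf_borelE R n) (surface_outer_regular n_gt0) leM.
    apply: aeS (aeI leMb OmE) => y [/= + <-]; rewrite ger0_norm ?normc_ge0//.
    move: Moo; case: (M) => [r _||]//=; rewrite lee_fin => h.
    by rewrite le_max h orbT.
  exists Om, (Num.max 0 (fine M))%R; split => //; first by rewrite le_max lexx.
  move=> g mg g0; rewrite poweRe1; last first.
    by apply: integral_ge0 => y _; rewrite lee_fin mulr_ge0 ?normc_ge0.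
  under [X in _ <= _ * X]eq_integral do rewrite powRr1//.
  apply: hoelder_bounded => //; first by move=> y; exact: normc_ge0.
  by rewrite le_max lexx.
have p1' : (1 < p)%R by rewrite lt_neqAle eq_sym pN1.
have p10 : (0 < p - 1)%R by rewrite subr_gt0.
have p0 : (0 < p)%R by exact: lt_trans p1'.
have q0 : (0 < p / (p - 1))%R by rewrite divr_gt0.
have qE : hoelder_conjugate p%:E = (p / (p - 1))%:E.
  by rewrite /hoelder_conjugate/= eqe (gt_eqF p0) -EFinB inver (gt_eqF p10).
move: NO; rewrite qE unlock => /lty_poweRy; rewrite invr_eq0 gt_eqF// => /(_ isT).
under eq_integral do rewrite /= ger0_norm ?normc_ge0//.
rewrite (integral_ae_cara (@coordinate_sets_cara_surface R n) (@surf_borelE R n)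
  measurableT (g := fun y => normc (Om y) `^ (p / (p - 1)))%R); last 2 first.
- by apply: aeS OmE => y -> _.
- exact: (measurableT_comp (@measurable_powR R _) mnO).
set I := integral _ _ _ => Ioo.
have I0 : 0 <= I by apply: integral_ge0 => y _; rewrite lee_fin powR_ge0.
(* Adding 1 provides the strictly positive bound that [hoelder_power] asks for. *)
have X0 : (0 < fine I + 1)%R by rewrite ltr_wpDl// fine_ge0.
exists Om, (2 `^ p * (fine I + 1) `^ (p - 1))%R; split => //.
  by rewrite mulr_ge0 ?powR_ge0.
move=> g mg g0; apply: hoelder_power => //.
  by move=> y; exact: normc_ge0.
by rewrite EFinD fineK ?ge0_fin_numE// leeDl// lee_fin.
Qed.

Lemma weight_measure_eball (gamma s : R) (w : V -> R) (q : VB -> R) :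
  (0 < n%:R + gamma)%R -> (0 < s)%R -> measurable_fun setT q ->
  (forall x, 0 <= q x)%R -> homogeneous gamma q -> {ae L, forall x, w x = q x} ->
  \int[S]_y (q y)%:E < +oo ->
  weight_measure w (@eball R n s) =
  (fine (\int[S]_y (q y)%:E) * (s `^ (n%:R + gamma) / (n%:R + gamma)))%:E.
Proof.
move=> a0 s0 mq q0 qh wq Qoo; rewrite /weight_measure.
rewrite (integral_ae_cara (@coordinate_sets_cara R n) (@leb_borelE R n)
  (@measurable_eball R n s) (g := q)); last 2 first.
- by apply: aeS wq => x ->.
- exact: measurable_funTS.
rewrite (integral_homogeneous_eball n_gt0 mq q0 qh)// EFinM fineK// ge0_fin_numE//.
by apply: integral_ge0 => y _; rewrite lee_fin.
Qed.

(** One term of the supremum defining the norm, raised to the power p and solved for the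
    integral. *)
Lemma morrey_ball_le (p lambda s W : R) (w1 w2 : V -> R) (f : V -> R[i]) :
  (0 < p)%R -> (0 < s)%R -> (0 < W)%R ->
  weight_measure w2 (@eball R n s) = W%:E ->
  0 <= \int[@lebesgue R n]_(x in @eball R n s) (normc (f x) `^ p * w1 x)%:E ->
  morrey_norm p lambda w1 w2 f < +oo ->
  \int[@lebesgue R n]_(x in @eball R n s) (normc (f x) `^ p * w1 x)%:E <=
  (fine (morrey_norm p lambda w1 w2 f) `^ p * W `^ lambda)%:E.
Proof.
move=> p0 s0 W0 WE; set I := integral _ _ _ => I0 Noo.
have Wl : (0 < W `^ lambda)%R by exact: powR_gt0.
pose J := I * ((W `^ lambda)^-1)%:E.
have J0 : 0 <= J by rewrite mule_ge0// lee_fin invr_ge0 ltW.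
have JN : J `^ p^-1 <= morrey_norm p lambda w1 w2 f.
  apply: ereal_sup_ubound; exists s => //.
  by rewrite WE poweR_EFin inver (gt_eqF Wl).
have N0 : 0 <= morrey_norm p lambda w1 w2 f by apply: le_trans JN; exact: poweR_ge0.
have NE : morrey_norm p lambda w1 w2 f = (fine (morrey_norm p lambda w1 w2 f))%:E.
  by rewrite fineK// ge0_fin_numE.
rewrite EFinM -lee_pdivrMr//.
have -> : I * ((W `^ lambda)^-1)%:E = (J `^ p^-1) `^ p.
  by rewrite -poweRrM mulVf ?gt_eqF// poweRe1.
rewrite -poweR_EFin -NE; apply: gt0_ler_poweR => //; first exact: ltW.
  by rewrite in_itv/= poweR_ge0 leey.
by rewrite in_itv/= N0 leey.
Qed.

Lemma morrey_norm_le (p lambda E : R) (W : R -> R) (w1 w2 : V -> R) (g : V -> R[i]) :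
  (0 < p)%R -> (0 <= E)%R -> (forall s, 0 < s -> 0 < W s)%R ->
  (forall s, (0 < s)%R -> weight_measure w2 (@eball R n s) = (W s)%:E) ->
  (forall s, (0 < s)%R ->
    0 <= \int[@lebesgue R n]_(x in @eball R n s) (normc (g x) `^ p * w1 x)%:E <=
    (E * W s `^ lambda)%:E) ->
  morrey_norm p lambda w1 w2 g <= (E `^ p^-1)%:E.
Proof.
move=> p0 E0 W0 WE gE; apply: ge_ereal_sup => _ [s s0 <-].
have Wl : (0 < W s `^ lambda)%R by apply: powR_gt0; exact: W0.
have /andP[I0 IE] := gE s s0.
rewrite (WE s s0) poweR_EFin inver (gt_eqF Wl) -poweR_EFin.
apply: gt0_ler_poweR; first by rewrite invr_ge0 ltW.
- by rewrite in_itv/= leey andbT mule_ge0// lee_fin invr_ge0 ltW.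
- by rewrite in_itv/= leey andbT lee_fin.
- by rewrite lee_pdivrMr.
Qed.

(** The indicator cuts the kernel off at t <= 0, where the formula could be negative, and lets all
    later integrals run over the line. *)
Definition commutator_kernel (beta : R) (psi : R -> R[i]) (t : R) : R :=
  (normc (psi t) * t^-1 * (1 + t^-1) `^ beta * \1_(`]0%R, +oo[%classic : set R) t)%R.

Lemma measurable_commutator_kernel beta psi : measurable_complex psi ->
  measurable_fun setT (commutator_kernel beta psi).
Proof.
move=> mpsi; apply: measurable_funM; last first.
  by apply: measurable_indic; exact: measurable_itv.
apply: measurable_funM; first apply: measurable_funM.
- exact: measurable_normc.
- exact: measurable_inv.
- apply: (measurableT_comp (@measurable_powR R beta)).
  by apply: measurable_funD => //; exact: measurable_inv.
Qed.

Lemma commutator_kernelE beta psi t : (0 < t)%R ->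
  commutator_kernel beta psi t = (normc (psi t) * t^-1 * (1 + t^-1) `^ beta)%R.
Proof.
by move=> t0; rewrite /commutator_kernel indicE mem_setE in_itv/= t0 mulr1.
Qed.

Lemma commutator_kernel0 beta psi t : (t <= 0)%R -> commutator_kernel beta psi t = 0%R.
Proof.
move=> t0; rewrite /commutator_kernel indicE mem_setE in_itv/= andbT.
by rewrite ltNge t0 mulr0.
Qed.

Lemma commutator_kernel_ge0 beta psi t : (0 <= commutator_kernel beta psi t)%R.
Proof.
have [t0|t0] := leP t 0%R; first by rewrite commutator_kernel0.
by rewrite commutator_kernelE// !mulr_ge0 ?powR_ge0 ?normc_ge0// invr_ge0 ltW.
Qed.

(** For t > 0 the two integrands coincide up to the Borel version of the profile: the 1 in the
    exponent gives the t^-1 of the kernel, the rest of the exponent is the power M, and the negative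
    power of 1 + t^-1 moves to the numerator. *)
Lemma integral_commutator_kernel_lty (p gamma beta lambda1 : R) (phi psi : R -> R[i]) :
  measurable_complex psi -> {ae m, forall r, (0 < r)%R -> phi r = psi r} ->
  \int[cm]_(t in `]0%R, +oo[)
    (normc (phi t) / (t `^ (1 + (gamma + n%:R) * ((lambda1 - 1) / p))
       * (1 + t^-1) `^ (- beta)))%:E < +oo ->
  \int[m]_t (commutator_kernel beta psi t *
    t `^ ((n%:R + gamma) * (1 - lambda1) / p))%:E < +oo.
Proof.
move=> mpsi psiE.
pose h t := (commutator_kernel beta psi t *
    t `^ ((n%:R + gamma) * (1 - lambda1) / p))%R.
have mh : measurable_fun setT (fun t => (h t)%:E).
  apply/measurable_EFinP; apply: measurable_funM => //.
  exact: measurable_commutator_kernel.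
rewrite (completed_integral_ae (g := fun t => (h t)%:E) (measurable_itv _)); last 2 first.
- apply: aeS psiE => t E /=; rewrite in_itv/= andbT => t0; rewrite E//.
  rewrite /h commutator_kernelE//; congr EFin.
  have t10 : (0 < 1 + t^-1)%R by rewrite ltr_wpDr// invr_ge0 ltW.
  rewrite powRD ?(gt_eqF t0) ?implybT// powRr1 ?ltW// powRN.
  rewrite (_ : (n%:R + gamma) * (1 - lambda1) / p =
    - ((gamma + n%:R) * ((lambda1 - 1) / p)))%R; last by ring.
  rewrite powRN; field.
  by rewrite !gt_eqF ?powR_gt0.
- exact: measurable_funTS.
rewrite integral_mkcond => h1; apply: le_lt_trans h1.
rewrite le_eqVlt; apply/orP; left; apply/eqP; apply: eq_integral => t _.
rewrite patchE mem_setE in_itv/= andbT; case: ltP => // t0.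
by rewrite commutator_kernel0// mul0r.
Qed.

End operator_ingredients.

(** * The commutator *)

Section borel_commutator.
Context (R : realType) (n : nat).
Local Notation m := (@lebesgue_measure R).
Local Notation V := 'rV[R]_n.
Local Notation VB := (rowBorel R n).
Local Notation L := (@leb_borel R n).
Local Notation S := (@surf_borel R n).
Local Open Scope ereal_scope.
Variables (beta B : R) (psi : R -> R[i]) (Om f b : VB -> R[i]).
Hypotheses (beta_ge0 : (0 <= beta)%R) (B_ge0 : (0 <= B)%R).
Hypotheses (mpsi : measurable_complex psi) (mOm : measurable_complex Om)
  (mf : measurable_complex f) (mb : measurable_complex b).
Hypothesis bB : forall x y : V,
  (normc (b x - b y) <= B * enorm (x - y) `^ beta)%R.
Local Notation F := (commutator_integrand psi Om b f).
Local Notation k := (commutator_kernel beta psi).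
Local Notation nOm := (fun y : VB => normc (Om y)).
Local Notation nf := (fun x : VB => normc (f x)).
Local Notation G := (radial_majorant k nOm nf).
(** The Lipschitz constant times 2^beta, the 2 being that of [enormB_le]. *)
Let D := (B * 2 `^ beta)%R.

Let D_ge0 : (0 <= D)%R. Proof. by rewrite mulr_ge0// powR_ge0. Qed.

Let nOm_ge0 y : (0 <= nOm y)%R. Proof. exact: normc_ge0. Qed.

Let nf_ge0 x : (0 <= nf x)%R. Proof. exact: normc_ge0. Qed.

(** For |y| = 1 the distance from x to (|x| / t) y is at most 2 |x| (1 + t^-1), which the Lipschitz
    bound raises to the power beta. *)
Lemma normc_commutator_integrand_le x t y : (0 < t)%R -> esphere y ->
  (normc (F x t y) <=
   D * enorm x `^ beta * (k t * (nOm y * nf ((enorm x / t) *: (y : V)))))%R.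
Proof.
move=> t0 Sy; have tC : normc (t%:C)%C = t.
  by rewrite /= expr0n/= addr0 sqrtr_sqr gtr0_norm.
rewrite /commutator_integrand !normcM normcV tC commutator_kernelE//.
set r := (enorm x / t)%R.
have r0 : (0 <= r)%R by rewrite divr_ge0 ?enorm_ge0// ltW.
have t10 : (0 <= 1 + t^-1)%R by rewrite addr_ge0// invr_ge0 ltW.
have bx : (normc (b x - b (r *: (y : V))) <=
    D * (enorm x `^ beta * (1 + t^-1) `^ beta))%R.
  apply: le_trans (bB _ _) _; rewrite /D -mulrA ler_wpM2l//.
  rewrite -!powRM ?enorm_ge0//; last by rewrite mulr_ge0 ?enorm_ge0.
  apply: ge0_ler_powR; rewrite ?nnegrE ?enorm_ge0 ?mulr_ge0 ?enorm_ge0//.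
  apply: le_trans (enormB_le _ _) _.
  by rewrite enormZ (Sy : enorm y = 1%R) mulr1 ger0_norm// [(enorm x * _)%R]mulrDr mulr1.
apply: le_trans (ler_wpM2l _ bx) _.
  by rewrite !mulr_ge0 ?normc_ge0// invr_ge0 ltW.
by rewrite le_eqVlt; apply/orP; left; apply/eqP; ring.
Qed.

(** Joint measurability in x, t and y makes each of the two integrations depend measurably on the
    remaining variables. *)
Lemma measurable_commutator_integrand :
  measurable_complex (fun z : (VB * measurableTypeR R) * VB => F z.1.1 z.1.2 z.2).
Proof.
have m11 : measurable_fun setT (fun z : (VB * measurableTypeR R) * VB => z.1.1).
  exact: (measurableT_comp measurable_fst measurable_fst).
have m12 : measurable_fun setT (fun z : (VB * measurableTypeR R) * VB => z.1.2).
  exact: (measurableT_comp measurable_snd measurable_fst).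
have mpt : measurable_complex (fun t : R => psi t / t%:C%C)%R.
  rewrite (_ : (fun t => _) = fun t : R => psi t * (t^-1)%:C%C)%R; last first.
    by apply/funext => t; rewrite fmorphV.
  by apply: measurable_complexM => //; split => //=; exact: measurable_inv.
have msc : measurable_fun setT
    ((fun z => (enorm z.1.1 / z.1.2) *: (z.2 : V))%R : (VB * measurableTypeR R) * VB -> VB).
  apply: measurable_scale; last exact: measurable_snd.
  apply: measurable_funM; first exact: (measurableT_comp (@measurable_enorm R n) m11).
  exact: (measurableT_comp (@measurable_inv R) m12).
apply: measurable_complexM; last first.
  by apply: measurable_complexB;
    [exact: (measurable_complex_comp mb m11)|exact: (measurable_complex_comp mb msc)].
apply: measurable_complexM; last exact: (measurable_complex_comp mf msc).
apply: measurable_complexM; first exact: (measurable_complex_comp mpt m12).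
exact: (measurable_complex_comp mOm measurable_snd).
Qed.

Let measurable_integrand_sphere x t : measurable_complex (fun y : VB => F x t y).
Proof.
apply: (measurable_complex_comp measurable_commutator_integrand
  (h := fun y : VB => ((x : VB, t : measurableTypeR R), y))).
exact: measurable_pair1.
Qed.

Let measurable_sphere_integral_pair : measurable_complex
  (fun z : VB * measurableTypeR R =>
    complex_integral S (@esphere R n) (fun y => F z.1 z.2 y)).
Proof.
exact: (measurable_complex_integral S (@measurable_esphere R n)
  measurable_commutator_integrand).
Qed.

Let measurable_sphere_complex_integral x : measurable_complex
  (fun t : measurableTypeR R => complex_integral S (@esphere R n) (F x t)).
Proof.
exact: (measurable_complex_comp measurable_sphere_integral_pair
  (@measurable_pair1 _ _ VB (measurableTypeR R) x)).
Qed.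

Lemma measurable_hausdorff_commutator : measurable_complex
  (fun x : VB => complex_integral m `]0%R, +oo[
    (fun t => complex_integral S (@esphere R n) (F x t))).
Proof.
exact: (measurable_complex_integral m (measurable_itv _)
  measurable_sphere_integral_pair).
Qed.

Let J x t := \int[S]_(y in @esphere R n) (normc (F x t y))%:E.

Let J_ge0 x t : 0 <= J x t.
Proof. by apply: integral_ge0 => y _; rewrite lee_fin normc_ge0. Qed.

Let mJ x : measurable_fun setT (J x : measurableTypeR R -> \bar R).
Proof.
have mF := measurable_normc measurable_commutator_integrand.
have mF2 : measurable_fun setT
    (fun z : measurableTypeR R * VB => (normc (F x z.1 z.2))%:E).
  apply/measurable_EFinP; apply: (measurableT_comp mF
    (g := fun z : measurableTypeR R * VB => ((x : VB, z.1), z.2))).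
  apply/measurable_fun_pairP; split; last exact: measurable_snd.
  by apply/measurable_fun_pairP; split; [exact: measurable_cst|exact: measurable_fst].
exact: (measurable_integral_param S (@measurable_esphere R n) mF2).
Qed.

Let J_le x t : (0 < t)%R -> J x t <= (D * enorm x `^ beta)%:E *
  ((k t)%:E * sphere_mean nOm nf (enorm x / t)).
Proof.
move=> t0; pose h (y : VB) := (nOm y * nf ((enorm x / t) *: (y : V)))%R.
have mh : measurable_fun setT (fun y => (h y)%:E).
  apply/measurable_EFinP; apply: measurable_funM; first exact: measurable_normc.
  apply: (measurableT_comp (measurable_normc mf)).
  exact: (measurable_scale (a := cst (enorm x / t)%R)).
have h0 y : 0 <= (h y)%:E by rewrite lee_fin mulr_ge0.
have c0 : 0 <= (D * enorm x `^ beta * k t)%:E.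
  by rewrite lee_fin mulr_ge0 ?commutator_kernel_ge0// mulr_ge0 ?powR_ge0.
apply: (@le_trans _ _ (\int[S]_(y in @esphere R n)
    ((D * enorm x `^ beta * k t)%:E * (h y)%:E))).
  apply: ge0_le_integral => //.
  - exact: measurable_esphere.
  - by move=> y _; rewrite lee_fin normc_ge0.
  - apply: measurable_funTS; apply/measurable_EFinP; exact: measurable_normc.
  - by apply: measurable_funTS; exact: emeasurable_funM.
  - by move=> y Sy; rewrite -EFinM lee_fin -[leRHS]mulrA; exact: (normc_commutator_integrand_le _ t0 Sy).
rewrite integral_sphereT//; first last.
- by move=> y; exact: mule_ge0.
- exact: emeasurable_funM.
by rewrite ge0_integralZl// EFinM muleA.
Qed.

Lemma integral_commutator_integrand_le x :
  \int[m]_(t in `]0%R, +oo[) \int[S]_(y in @esphere R n) (normc (F x t y))%:E <=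
  (D * enorm x `^ beta)%:E * G (enorm x).
Proof.
have c0 : (0 <= D * enorm x `^ beta)%R by rewrite mulr_ge0 ?powR_ge0.
have mk := measurable_commutator_kernel beta mpsi.
have mSM : measurable_fun setT (fun t : R => (k t)%:E * sphere_mean nOm nf (enorm x / t)).
  apply: emeasurable_funM; first exact/measurable_EFinP.
  apply: (measurableT_comp (measurable_sphere_mean (measurable_normc mOm) _
    (measurable_normc mf) _)) => //.
  by apply: measurable_funM => //; exact: measurable_inv.
have SM0 t : 0 <= (k t)%:E * sphere_mean nOm nf (enorm x / t).
  by rewrite mule_ge0 ?lee_fin ?commutator_kernel_ge0 ?sphere_mean_ge0.
rewrite /radial_majorant -ge0_integralZl//.
apply: (@le_trans _ _ (\int[m]_(t in `]0%R, +oo[) ((D * enorm x `^ beta)%:E *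
    ((k t)%:E * sphere_mean nOm nf (enorm x / t))))).
  apply: ge0_le_integral => //.
  - by move=> t _; exact: J_ge0.
  - by apply: measurable_funTS; exact: mJ.
  - by apply: measurable_funTS; exact: emeasurable_funM.
  - by move=> t; rewrite /= in_itv/= andbT => t0; exact: J_le.
apply: ge0_subset_integral => //; first exact: emeasurable_funM.
by move=> t _; rewrite mule_ge0.
Qed.

(** The factor 4 is the 2 of [normc_complex_integral_le], once for the integral in t and once for
    the integral over the sphere. *)
Lemma normc_hausdorff_commutator_le x :
  (normc (complex_integral m `]0%R, +oo[
    (fun t => complex_integral S (@esphere R n) (F x t))))%:E <=
  (4 * D * enorm x `^ beta)%:E * G (enorm x).
Proof.
have H := @normc_complex_integral_le _ (measurableTypeR R) R m `]0%R, +oo[%classic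
  _ (measurable_itv _) (measurable_sphere_complex_integral x).
apply: le_trans H _.
rewrite (_ : 4 * D * enorm x `^ beta = 2 * (2 * (D * enorm x `^ beta)))%R; last by ring.
rewrite EFinM -muleA; apply: lee_wpmul2l => //.
rewrite EFinM -muleA.
apply: le_trans (lee_wpmul2l _ (integral_commutator_integrand_le x)) => //.
rewrite -(ge0_integralZl m (measurable_itv _) (measurable_funTS (mJ x)))//.
apply: ge0_le_integral => //.
- by move=> t _; rewrite lee_fin normc_ge0.
- apply/measurable_EFinP; apply: measurable_funTS.
  exact: (measurable_normc (measurable_sphere_complex_integral x)).
- by apply: emeasurable_funM => //; apply: measurable_funTS; exact: mJ.
- by move=> t _; exact: (normc_complex_integral_le _ (@measurable_esphere R n)).
Qed.

Lemma integral_hausdorff_commutator_le (p s : R) (q : VB -> R) : (0 < p)%R -> (0 < s)%R ->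
  measurable_fun setT q -> (forall x, 0 <= q x)%R ->
  \int[L]_(x in @eball R n s) (normc (complex_integral m `]0%R, +oo[
    (fun t => complex_integral S (@esphere R n) (F x t))) `^ p * q x)%:E <=
  ((4 * D) `^ p * s `^ (beta * p))%:E *
    \int[L]_(x in @eball R n s) ((q x)%:E * G (enorm x) `^ p).
Proof.
move=> p0 s0 mq q0.
have mG : measurable_fun setT (fun x : VB => G (enorm x)).
  by apply: measurable_radial_majorant => //;
    [exact: measurable_commutator_kernel|move=> t; exact: commutator_kernel_ge0|
     exact: measurable_normc|exact: measurable_normc].
have G0 r : 0 <= G r.
  by apply: integral_ge0 => t _;
    rewrite mule_ge0 ?lee_fin ?commutator_kernel_ge0 ?sphere_mean_ge0.
have mqG : measurable_fun setT (fun x => (q x)%:E * G (enorm x) `^ p).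
  apply: emeasurable_funM; first exact/measurable_EFinP.
  exact: (measurableT_comp (measurable_poweR p) mG).
have c0 : (0 <= (4 * D) `^ p * s `^ (beta * p))%R by rewrite mulr_ge0 ?powR_ge0.
rewrite -ge0_integralZl//; last 3 first.
- exact: measurable_eball.
- exact: measurable_funTS.
- by move=> x _; rewrite mule_ge0 ?lee_fin ?poweR_ge0.
apply: ge0_le_integral => //.
- exact: measurable_eball.
- by move=> x _; rewrite lee_fin mulr_ge0 ?powR_ge0.
- apply: measurable_funTS; apply/measurable_EFinP; apply: measurable_funM => //.
  exact: (measurableT_comp (@measurable_powR R p)
    (measurable_normc measurable_hausdorff_commutator)).
- by apply: measurable_funTS; exact: emeasurable_funM.
move=> x xs; rewrite muleCA EFinM muleC; apply: lee_wpmul2l; first by rewrite lee_fin.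
rewrite -poweR_EFin.
have c1 : (0 <= 4 * D * s `^ beta)%R by rewrite !mulr_ge0 ?powR_ge0.
have -> : ((4 * D) `^ p * s `^ (beta * p))%:E = (4 * D * s `^ beta)%:E `^ p.
  by rewrite poweR_EFin powRrM -powRM ?powR_ge0 ?mulr_ge0.
rewrite -poweRM ?lee_fin//; apply: gt0_ler_poweR; first exact: ltW.
- by rewrite in_itv/= leey andbT lee_fin sqrtr_ge0.
- by rewrite in_itv/= leey andbT mule_ge0 ?lee_fin.
apply: le_trans (normc_hausdorff_commutator_le x) _.
apply: lee_wpmul2r => //; rewrite lee_fin ler_wpM2l ?mulr_ge0//.
by apply: ge0_ler_powR; rewrite ?nnegrE ?enorm_ge0 ?(ltW s0)// ltW.
Qed.

(** For almost every t the original integrand agrees with the Borel one at almost every y, so inner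
    integrals agree for almost every t; absolute convergence then comes from the finite majorant. *)
Lemma commutator_converges_borel (phi : R -> R[i]) (Omega f0 : V -> R[i]) (x : V) :
  {ae m, forall t, (0 < t)%R -> phi t = psi t} -> {ae S, forall y, Omega y = Om y} ->
  {ae m, forall t, (0 < t)%R -> {ae S, forall y,
    f0 ((enorm x / t) *: y) = f ((enorm x / t) *: (y : V))}} ->
  G (enorm x) < +oo ->
  commutator_converges phi Omega b f0 x /\
  hausdorff_commutator phi Omega b f0 x = complex_integral m `]0%R, +oo[
    (fun t => complex_integral S (@esphere R n) (F x t)).
Proof.
move=> phiE OmE fE Gx.
have FE : {ae m, forall t, (0 < t)%R -> {ae S, forall y, @esphere R n y ->
    commutator_integrand phi Omega b f0 x t y = F x t y}}.
  apply: aeS (aeI phiE fE) => t [tE ft] t0.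
  apply: aeS (aeI OmE (ft t0)) => y [Oy fy] _.
  by rewrite /commutator_integrand (tE t0) Oy fy.
have mI : measurable (`]0%R, +oo[%classic : set (measurableTypeR R)).
  exact: measurable_itv.
have JE : {ae m, forall t, (`]0%R, +oo[%classic : set R) t ->
    \int[@surface R n]_(y in @esphere R n)
      (normc (commutator_integrand phi Omega b f0 x t y))%:E = J x t}.
  apply: aeS FE => t h; rewrite /= in_itv/= andbT => /h Ft.
  exact: (integral_normc_ae (@coordinate_sets_cara_surface R n) (@surf_borelE R n)
    (@measurable_esphere R n) Ft (measurable_integrand_sphere x t)).
have HE : {ae m, forall t, (`]0%R, +oo[%classic : set R) t ->
    complex_integral (@surface R n) (@esphere R n)
      (commutator_integrand phi Omega b f0 x t) =
    complex_integral S (@esphere R n) (F x t)}.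
  apply: aeS FE => t h; rewrite /= in_itv/= andbT => /h Ft.
  exact: (complex_integral_ae (@coordinate_sets_cara_surface R n) (@surf_borelE R n)
    (@measurable_esphere R n) Ft (measurable_integrand_sphere x t)).
have Joo : \int[m]_(t in `]0%R, +oo[) J x t < +oo.
  apply: le_lt_trans (integral_commutator_integrand_le x) _.
  by apply: lte_mul_pinfty => //; rewrite lee_fin mulr_ge0 ?powR_ge0.
have iJ : m.-integrable `]0%R, +oo[ (J x).
  apply/integrableP; split; first by apply: measurable_funTS; exact: mJ.
  by under eq_integral do rewrite gee0_abs ?J_ge0//.
split; last exact: (completed_complex_integral_ae mI HE
  (measurable_sphere_complex_integral x)).
split.
(* The absolute inner integral is integrable in t, hence finite for almost every t: this is the
   convergence on the sphere. *)
- apply: completed_ae; apply: aeS (aeI (aeI FE JE) (integrable_ae mI iJ)).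
  move=> t [[Ft Jt] Jfin] t0.
  have It : (`]0%R, +oo[%classic : set R) t by rewrite /= in_itv/= t0.
  split.
    exact: (complex_measurable_ae (@coordinate_sets_cara_surface R n)
      (@surf_borelE R n) (@measurable_esphere R n) (Ft t0)
      (measurable_integrand_sphere x t)).
  by rewrite (Jt It) -ge0_fin_numE ?J_ge0//; exact: Jfin.
- exact: (completed_complex_measurable_ae mI HE (measurable_sphere_complex_integral x)).
- apply/integrableP; split.
    exact: (completed_emeasurable_ae mI JE (measurable_funTS (mJ x))).
  rewrite (completed_integral_ae (g := fun t => `|J x t|) mI); last 2 first.
  + by apply: aeS JE => t h It; rewrite (h It).
  + by apply: measurable_funTS; apply: measurableT_comp => //; exact: mJ.
  by under eq_integral do rewrite gee0_abs ?J_ge0//.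
Qed.

End borel_commutator.

(** * Compact sets: measurability and boundedness *)

Section compact_sets.
Context (R : realType) (n : nat).
Local Notation V := 'rV[R]_n.
Local Notation VB := (rowBorel R n).

Lemma measurable_compact (K : set V) : compact K -> measurable (K : set VB).
Proof.
move=> cK; rewrite -[K]setCK; apply: measurableC; apply: open_measurable_row.
by apply: closed_openC; apply: compact_closed cK; exact: norm_hausdorff.
Qed.

Lemma compact_sub_eball (K : set V) : compact K ->
  exists2 s : R, 0 < s & K `<=` @eball R n s.
Proof.
move=> cK.
have bK (i : 'I_n) : exists M : R, forall x, K x -> `|x ord0 i| <= M.
  have ci : continuous (fun x : V => x ord0 i).
    apply: (@hoelder_continuous R n 1 1) => // x y.
    rewrite mul1r powRr1 ?enorm_ge0//; apply: le_trans (coord_le_enorm _ i).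
    by rewrite !mxE.
  have [M [_ MK]] := compact_bounded (continuous_compact (continuous_subspaceT ci) cK).
  exists (M + 1) => x Kx; apply: (MK (M + 1)); first by rewrite ltrDl.
  by exists x.
have [M MK] := choice bK.
exists (\sum_(i < n) `|M i| + 1); first by rewrite ltr_wpDl// sumr_ge0.
move=> x Kx; rewrite /eball/=; apply: le_lt_trans (enorm_le_coord x) _.
rewrite ltr_pwDr//; apply: ler_sum => i _.
by apply: le_trans (MK i x Kx) _; exact: ler_norm.
Qed.

End compact_sets.

(** * Assembly of the operator bound *)

Local Open Scope complex_scope.

Theorem theorem3p7 (R : realType) (n : nat) (n_ge1 : (1 <= n)%N)
    (p gamma beta lambda lambda1 c : R) (w1 w2 : 'rV[R]_n -> R)
    (b Phi Omega : 'rV[R]_n -> R[i]) (phi : R -> R[i])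
    (p_ge1 : 1 <= p) (gamma_gt : - n%:R < gamma)
    (w1_class : weight_class gamma w1) (w2_class : weight_class gamma w2)
    (beta_itv : 0 < beta <= 1) (b_lip : lipschitz_class beta b)
    (Phi_meas : complex_measurable (@lebesgue R n) setT Phi)
    (Phi_radial : forall x, Phi x = phi (enorm x))
    (Omega_Lp : sphere_Lp (hoelder_conjugate p%:E) Omega)
    (Omega_neq0 : {ae @surface R n, forall y, esphere y -> Omega y != 0})
    (c_gt0 : 0 < c) (w1_ge : forall y, esphere y -> c <= w1 y)
    (lambda1E : lambda1 = lambda - beta * p / (n%:R + gamma))
    (lambda1_gt0 : 0 < lambda1)
    (C4_lty : (\int[@completed_lebesgue_measure R]_(t in `]0%R, +oo[)
                 (normc (phi t) /
                   (t `^ (1 + (gamma + n%:R) * ((lambda1 - 1) / p))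
                      * (1 + t^-1) `^ (- beta)))%:E < +oo)%E) :
  bounded_operator
    (hausdorff_commutator phi Omega b)
    (commutator_converges phi Omega b)
    (morrey p lambda1 w1 w2) (morrey p lambda w1 w2)
    (morrey_norm p lambda1 w1 w2) (morrey_norm p lambda w1 w2).
Proof.
have n_gt0 : (0 < n)%N := n_ge1.
have /andP[beta_gt0 _] := beta_itv.
have p_gt0 : 0 < p by exact: lt_le_trans ltr01 p_ge1.
have a_gt0 : 0 < n%:R + gamma by rewrite -ltrBlDl sub0r.
have [q1 [[mq1 q1_ge0 q1_hom w1E w1SE] /andP[Q1_gt0 Q1_lty]]] :=
  weight_borel n_gt0 w1_class.
have [q2 [[mq2 q2_ge0 q2_hom w2E _] /andP[Q2_gt0 Q2_lty]]] :=
  weight_borel n_gt0 w2_class.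
(* Otherwise the integral of the weight over the sphere would be 0. *)
have S_gt0 : (0 < surf_borel [set: rowBorel R n])%E.
  rewrite lt_neqAle measure_ge0 andbT eq_sym; apply/eqP => S0.
  by move: Q1_gt0; rewrite null_set_integral ?ltxx//; exact/measurable_EFinP.
have q1_ge : {ae @surf_borel R n, forall y, c <= q1 y}.
  by apply: aeS (aeI w1SE (@ae_sphere R n)) => y [<- Sy]; exact: w1_ge.
have q1_gt0 : {ae @leb_borel R n, forall x, 0 < q1 x}.
  have [_ w1_gt0 _ _] := w1_class.
  have w1_gt0b := ae_borel (@leb_borelE R n) (@leb_outer_regular R n) w1_gt0.
  by apply: aeS (aeI w1_gt0b w1E) => x [+ <-].
have [psi mpsi psiE] := radial_profile_borel n_gt0 S_gt0 Phi_meas Phi_radial.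
have [Om [K [mOm OmE K_ge0 Om_hoelder]]] :=
  sphere_Lp_hoelder n_gt0 p_ge1 S_gt0 Omega_Lp.
have mb := lipschitz_measurable beta_gt0 b_lip.
have [B B_ge0 bB] := lipschitz_bound b_lip.
have kM_lty := integral_commutator_kernel_lty mpsi psiE C4_lty.
set k := commutator_kernel beta psi in kM_lty.
set X0 := (integral _ _ _) in kM_lty.
have k_ge0 t : 0 <= k t by exact: commutator_kernel_ge0.
have X0_ge0 : (0 <= X0)%E.
  by apply: integral_ge0 => t _; rewrite lee_fin mulr_ge0 ?powR_ge0.
pose X := fine X0 + 1.
(* The 1 added in [X] makes the bound strictly positive, as Jensen's inequality requires. *)
have X_gt0 : 0 < X by rewrite ltr_wpDl// fine_ge0.
have kM_le : (X0 <= X%:E)%E by rewrite EFinD fineK ?ge0_fin_numE// leeDl// lee_fin.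
have mk := measurable_commutator_kernel beta mpsi.
have k_le0 t : t <= 0 -> k t = 0 by exact: commutator_kernel0.
pose Q1 := fine (\int[@surf_borel R n]_y (q1 y)%:E).
pose Q2 := fine (\int[@surf_borel R n]_y (q2 y)%:E).
have Q1_ge0 : 0 <= Q1 by rewrite fine_ge0// ltW.
have Q2a_gt0 : 0 < Q2 / (n%:R + gamma) by rewrite divr_gt0// fine_gt0// Q2_gt0.
pose W s := Q2 * (s `^ (n%:R + gamma) / (n%:R + gamma)).
have WE s : 0 < s -> weight_measure w2 (@eball R n s) = (W s)%:E.
  by move=> s0; exact: (weight_measure_eball n_gt0 a_gt0 s0 mq2).
have W_powE l s : 0 < s ->
    W s `^ l = (Q2 / (n%:R + gamma)) `^ l * s `^ ((n%:R + gamma) * l).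
  by move=> s0; rewrite /W mulrA mulrAC powRM ?powR_ge0 ?(ltW Q2a_gt0)// -powRrM.
have W_gt0 s : 0 < s -> 0 < W s.
  by move=> s0; rewrite /W mulrA mulrAC mulr_gt0// powR_gt0.
have integral_weightE (D : set (rowBorel R n)) (g : 'rV[R]_n -> R[i])
    (g' : rowBorel R n -> R[i]) : measurable D -> measurable_complex g' ->
    {ae @leb_borel R n, forall x, g x = g' x} ->
    (\int[@lebesgue R n]_(x in D) (normc (g x) `^ p * w1 x)%:E =
     \int[@leb_borel R n]_(x in D) (normc (g' x) `^ p * q1 x)%:E)%E.
  move=> mD mg' gE; apply: (integral_ae_cara (@coordinate_sets_cara R n)
    (@leb_borelE R n) mD (g := fun x => normc (g' x) `^ p * q1 x)).
  - by apply: aeS (aeI gE w1E) => x [-> ->].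
  - apply: measurable_funTS; apply: measurable_funM => //.
    exact: (measurableT_comp (@measurable_powR R p) (measurable_normc mg')).
have integral_weight_ge0 (D : set (rowBorel R n)) (g' : rowBorel R n -> R[i]) :
    (0 <= \int[@leb_borel R n]_(x in D) (normc (g' x) `^ p * q1 x)%:E)%E.
  by apply: integral_ge0 => x _; rewrite lee_fin mulr_ge0 ?powR_ge0.
pose D := B * 2 `^ beta.
(* The p-th power of the operator norm bound: the commutator bound, then the majorant bound without
   the Morrey norm of f, then the factor converting the power lambda1 of the constant in the measure
   of a ball into the power lambda. *)
pose E0 := (4 * D) `^ p * (2 `^ p * X `^ p * K * Q1 / c) *
  (Q2 / (n%:R + gamma)) `^ (lambda1 - lambda).
have E0_ge0 : 0 <= E0 by rewrite !mulr_ge0 ?powR_ge0// invr_ge0 ltW.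
exists (E0 `^ p^-1) => f [mf _ f_norm].
have [f' mf' fE0] := cara_borel_complex (@coordinate_sets_cara R n) (@leb_borelE R n)
  (@leb_outer_regular R n) (@leb_outer_sigma_finite R n)
  (@measurableT _ (rowBorel R n)) mf.
have fE : {ae @leb_borel R n, forall x, f x = f' x} by apply: aeS fE0 => x; exact.
have norm_ge0 : (0 <= morrey_norm p lambda1 w1 w2 f)%E.
  apply: (@le_trans _ _ _ _ _ (poweR_ge0 _ _)); apply: ereal_sup_ubound.
  by exists 1 => /=.
set nf := fine (morrey_norm p lambda1 w1 w2 f).
have nf_ge0 : 0 <= nf by exact: fine_ge0.
have nfE : morrey_norm p lambda1 w1 w2 f = nf%:E by rewrite fineK// ge0_fin_numE.
pose N := nf `^ p * (Q2 / (n%:R + gamma)) `^ lambda1.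
have N_ge0 : 0 <= N by rewrite mulr_ge0 ?powR_ge0.
have f_le s : 0 < s ->
    (\int[@leb_borel R n]_(x in @eball R n s) (normc (f' x) `^ p * q1 x)%:E <=
     (N * s `^ ((n%:R + gamma) * lambda1))%:E)%E.
  move=> s0; have E := integral_weightE _ f f' (@measurable_eball R n s) mf' fE.
  rewrite -E -mulrA -W_powE//.
  by apply: morrey_ball_le => //; [exact: W_gt0|exact: WE|rewrite E].
pose nOm (y : rowBorel R n) := normc (Om y).
pose nf' (x : rowBorel R n) := normc (f' x).
have nOm_ge0 y : 0 <= nOm y by exact: normc_ge0.
have nf'_ge0 x : 0 <= nf' x by exact: normc_ge0.
have G_le s (s0 : 0 < s) := integral_radial_majorant n_gt0 p_ge1 mk k_ge0 k_le0
  (measurable_normc mOm) nOm_ge0 (measurable_normc mf') nf'_ge0 mq1 q1_ge0 q1_hom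
  X_gt0 K_ge0 c_gt0 N_ge0 kM_le Om_hoelder q1_ge f_le Q1_lty s0.
have mG := measurable_radial_majorant mk k_ge0 (measurable_normc mOm) nOm_ge0
  (measurable_normc mf') nf'_ge0.
have G_ge0 r : (0 <= radial_majorant k nOm nf' r)%E.
  by apply: integral_ge0 => t _; rewrite mule_ge0 ?lee_fin ?sphere_mean_ge0.
(* On each ball of integer radius j + 1 the integral of q1 G^p is finite, so q1 G^p is finite almost
   everywhere; where q1 > 0, this forces G itself to be finite. *)
have G_lty : {ae @leb_borel R n, forall x, (radial_majorant k nOm nf' (enorm x) < +oo)%E}.
  have h : {ae @leb_borel R n, forall x, forall j : nat, @eball R n j.+1%:R x ->
      ((q1 x)%:E * poweR (radial_majorant k nOm nf' (enorm x)) p)%E \is a fin_num}.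
    apply: ae_foralln => j; apply: integrable_ae; first exact: measurable_eball.
    apply/integrableP; split.
      apply: measurable_funTS; apply: emeasurable_funM; first exact/measurable_EFinP.
      exact: (measurableT_comp (measurable_poweR p) mG).
    under eq_integral do rewrite gee0_abs ?mule_ge0 ?lee_fin ?poweR_ge0//.
    exact: le_lt_trans (G_le _ (ltr0Sn _ j)) (ltry _).
  apply: aeS (aeI h q1_gt0) => x [hx qx]; rewrite ltey; apply/eqP => Gx.
  have := hx _ (truncnS_gt (enorm x)).
  by rewrite Gx poweRyr ?gt_eqF// gt0_muley.
pose T (x : rowBorel R n) : R[i] := complex_integral (@lebesgue_measure R) `]0, +oo[
  (fun t => complex_integral (@surf_borel R n) (@esphere R n)
    (commutator_integrand psi Om b f' x t)).
have mT : measurable_complex T by exact: measurable_hausdorff_commutator.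
have cvT : {ae @leb_borel R n, forall x, commutator_converges phi Omega b f x /\
    hausdorff_commutator phi Omega b f x = T x}.
  (* The equality f = f' is needed at the points (|x| / t) y: [ae_polar] gives it on almost every
     sphere, and [ae_quotient] turns almost every radius into almost every t for almost every x. *)
  apply: aeS (aeI G_lty (ae_quotient n_gt0 (ae_polar n_gt0 fE))) => x [Gx fx].
  exact: (commutator_converges_borel (ltW beta_gt0) B_ge0 mpsi mOm mf' mb bB
    psiE OmE fx Gx).
have TE : {ae @leb_borel R n, forall x, hausdorff_commutator phi Omega b f x = T x}.
  by apply: aeS cvT => x [].
have T_le s : 0 < s ->
    (0 <= \int[@lebesgue R n]_(x in @eball R n s)
      (normc (hausdorff_commutator phi Omega b f x) `^ p * w1 x)%:E <=
     (E0 * nf `^ p * W s `^ lambda)%:E)%E.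
  move=> s0; rewrite (integral_weightE _ _ T (@measurable_eball R n s) mT TE).
  rewrite integral_weight_ge0/=.
  apply: le_trans (integral_hausdorff_commutator_le (ltW beta_gt0) B_ge0 mpsi
    mOm mf' mb bB p_gt0 s0 mq1 q1_ge0) _.
  apply: le_trans (lee_wpmul2l _ (G_le s s0)) _.
    by rewrite lee_fin mulr_ge0 ?powR_ge0.
  rewrite -EFinM lee_fin W_powE// -/Q1 -/D.
  (* By the definition of lambda1, (n + gamma) lambda = beta p + (n + gamma) lambda1: the shift of
     the Morrey exponent is exactly what absorbs the factor |x|^(beta p). *)
  have -> : s `^ ((n%:R + gamma) * lambda) =
      s `^ (beta * p) * s `^ ((n%:R + gamma) * lambda1).
    rewrite -powRD ?(gt_eqF s0) ?implybT//; congr powR; rewrite lambda1E; field.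
    by rewrite gt_eqF.
  rewrite /N (_ : (Q2 / (n%:R + gamma)) `^ lambda1 =
      (Q2 / (n%:R + gamma)) `^ (lambda1 - lambda) *
      (Q2 / (n%:R + gamma)) `^ lambda); last first.
    by rewrite -powRD ?subrK// (gt_eqF Q2a_gt0) implybT.
  by rewrite le_eqVlt; apply/orP; left; apply/eqP; rewrite /E0; ring.
have norm_le : (morrey_norm p lambda w1 w2 (hausdorff_commutator phi Omega b f) <=
    ((E0 * nf `^ p) `^ p^-1)%:E)%E.
  by apply: (@morrey_norm_le R n p lambda _ W) => //; rewrite mulr_ge0 ?powR_ge0.
split.
- by apply: (ae_cara (@coordinate_sets_cara R n) (@leb_borelE R n));
    apply: aeS cvT => x [].
- split.
  + apply: (complex_measurable_ae (@coordinate_sets_cara R n) (@leb_borelE R n)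
      measurableT _ mT).
    by apply: aeS TE => x ->.
  (* A compact set lies in some ball, where the estimate just proved already bounds the integral. *)
  + move=> C cC; have mC := measurable_compact cC.
    have [s s0 Cs] := compact_sub_eball cC.
    rewrite (integral_weightE _ _ T mC mT TE).
    have /andP[_] := T_le s s0.
    rewrite (integral_weightE _ _ T (@measurable_eball R n s) mT TE).
    move=> /le_lt_trans/(_ (ltry _)); apply: le_lt_trans.
    apply: ge0_subset_integral => //; first exact: measurable_eball.
    * apply: measurable_funTS; apply/measurable_EFinP; apply: measurable_funM => //.
      exact: (measurableT_comp (@measurable_powR R p) (measurable_normc mT)).
    * by move=> x _; rewrite lee_fin mulr_ge0 ?powR_ge0.
  + exact: le_lt_trans norm_le (ltry _).
- apply: le_trans norm_le _; rewrite nfE -EFinM lee_fin powRM ?powR_ge0//.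
  by rewrite -powRrM mulfV ?gt_eqF// powRr1.
Qed.
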